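(* Let $h:[0,1]\to(0,\infty)$ and $f:[0,\infty)\to[0,\infty)$ be continuously differentiable, suppose there is $t_0\ge0$ with $f>0$ on $[t_0,\infty)$ and $f\in C^2([t_0,\infty))$, put $g=\log f$ on $[t_0,\infty)$, and assume condition (H1) of the context with $q\in[1,2)$. Let $(\lambda_n,\mu_n,u_n)\in(0,\infty)\times(0,\infty)\times C^2([0,1])$ satisfy $-u_n''-\frac1r u_n'=\lambda_n h(r)f(u_n)$, $u_n>0$ in $(0,1)$, $u_n(0)=\mu_n$, $u_n'(0)=0=u_n(1)$, with $\mu_n\to\infty$. Then, after extracting a subsequence if necessary, for each $k\in\mathbb{N}$ there exists a sequence $(r_{k,n})\subset(0,1)$ such that $u_n(r_{k,n})/\mu_n\to\delta_k$ and $$\lambda_n r_{k,n}^2 h(r_{k,n}) f'(u_n(r_{k,n}))\to \frac{a_k^2}{2}$$ as $n\to\infty$, and, defining for each large $n$ the number $\gamma_{k,n}>0$ by $\lambda_n h(r_{k,n})f'(u_n(r_{k,n}))\gamma_{k,n}^2=1$ and the function $z_{k,n}(r)=g'(u_n(r_{k,n}))(u_n(\gamma_{k,n}r)-u_n(r_{k,n}))$ for $r\in[0,1/\gamma_{k,n}]$, we have $\gamma_{k,n}\to0$, and there exist sequences $(\bar\rho_{k,n}),(\rho_{k,n})\subset[0,1)$, with $\bar\rho_{1,n}=0$ for all $n$ when $k=1$, such that $\rho_{k,n}\to0$, $\bar\rho_{k,n}/\gamma_{k,n}\to0$, $\rho_{k,n}/\gamma_{k,n}\to\infty$, $u_n(\bar\rho_{k,n})/\mu_n\to\delta_k$,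 $u_n(\rho_{k,n})/\mu_n\to\delta_k$, and $$\|z_{k,n}-z_k\|_{C^2([\bar\rho_{k,n}/\gamma_{k,n},\,\rho_{k,n}/\gamma_{k,n}])}\to0$$ as $n\to\infty$. Further, if $q=1$, then for each of the sequences $(r_n)=(r_{k,n}),(\rho_{k,n}),(\bar\rho_{k,n})$, $$u_n(r_n)=\mu_n-\Big(\log\frac1{\eta_k}+o(1)\Big)\frac{g(\mu_n)}{g'(\mu_n)}\quad (n\to\infty).$$ Moreover, for all $k\in\mathbb{N}$, $$\lim_{n\to\infty} g'(u_n(r_{k,n}))\int_{\bar\rho_{k,n}}^{\rho_{k,n}}\lambda_n h f(u_n)\,r\,dr=2a_k=\lim_{n\to\infty}\int_{\bar\rho_{k,n}}^{\rho_{k,n}}\lambda_n h f'(u_n)\,r\,dr$$ and $$\lim_{n\to\infty} g'(\mu_n)\int_{\rho_{k,n}}^{\bar\rho_{k+1,n}}\lambda_n h f(u_n)\,r\,dr=0.$$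
   Context: Condition (H1): (i) $g'(t)>0$ and $g''(t)>0$ for all $t\ge t_0$, and there is a pair $(q,p)$ with either $q=1$ and $p\in(0,\infty]$, or $q\in(1,\infty)$ and $p\in(0,\infty)$, such that $\lim_{t\to\infty}\frac{g'(t)^2}{g(t)g''(t)}=q$ and $\lim_{t\to\infty}\frac{tg'(t)}{g(t)}=p$; (ii) if $q=1$, then $tg'(t)/g(t)$ is nondecreasing on $[t_0,\infty)$ and there exist $k\in\mathbb{N}$ and $\hat g\in C^2([t_0,\infty))$ with $f=\exp_k\circ\hat g$ and $\hat g'/\hat g$ nonincreasing on $[t_0,\infty)$ ($\exp_1=\exp$, $\exp_k=\exp_{k-1}\circ\exp$). Under (H1) one has $1/p+1/q=1$ (with $1/\infty=0$), so for $q\in(1,2)$, $p=q/(q-1)\in(2,\infty)$, and for $q=1$, $p=\infty$. Sequences: $a_1=2$, $\delta_1=1$, $\eta_1=1$. If $q\in(1,2)$: for $k\ge1$, $\delta_{k+1}\in(0,\delta_k)$ is determined by $\frac{2p}{2+a_k}\big(1-\frac{\delta_{k+1}}{\delta_k}\big)-1+\big(\frac{\delta_{k+1}}{\delta_k}\big)^p=0$, and $a_{k+1}=2-\big(\frac{\delta_{k+1}}{\delta_k}\big)^{p-1}(2+a_k)$; set $\eta_k=\delta_k^p$. If $q=1$: $\eta_{k+1}\in(0,\eta_k)$ is determined by $\frac{2}{2+a_k}\log\frac{\eta_k}{\eta_{k+1}}-1+\frac{\eta_{k+1}}{\eta_k}=0$, $a_{k+1}=2-\frac{\eta_{k+1}}{\eta_k}(2+a_k)$,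 and $\delta_k=1$ for all $k$. These sequences are well-defined with $a_k\in(0,2]$. Profiles: for $k\in\mathbb{N}$, $b_k=(\sqrt2/a_k)^{a_k}$ and $z_k(r)=\log\frac{2a_k^2 b_k}{r^{2-a_k}(1+b_k r^{a_k})^2}$ (for $r\ge0$ if $k=1$, $r>0$ if $k>1$); these solve $-z''-\frac1r z'=e^{z}$ on $(0,\infty)$ with $\int_0^\infty e^{z_k}r\,dr=2a_k$. In integrals $h=h(r)$, $f(u_n)=f(u_n(r))$. *)

(* Defs.v *)
From Stdlib Require Import Reals Lra.
From Coquelicot Require Import Coquelicot.
Open Scope R_scope.

Definition is_deriv_within (D : R -> Prop) (F : R -> R) (x l : R) : Prop :=
  forall eps, 0 < eps -> exists delta, 0 < delta /\
    forall y, D y -> y <> x -> Rabs (y - x) < delta ->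
      Rabs ((F y - F x) / (y - x) - l) < eps.

Definition cont_within (D : R -> Prop) (F : R -> R) (x : R) : Prop :=
  forall eps, 0 < eps -> exists delta, 0 < delta /\
    forall y, D y -> Rabs (y - x) < delta -> Rabs (F y - F x) < eps.

Definition C1_with (D : R -> Prop) (F F1 : R -> R) : Prop :=
  (forall x, D x -> is_deriv_within D F x (F1 x)) /\
  (forall x, D x -> cont_within D F1 x).

Definition C2_with (D : R -> Prop) (F F1 F2 : R -> R) : Prop :=
  (forall x, D x -> is_deriv_within D F x (F1 x)) /\
  (forall x, D x -> is_deriv_within D F1 x (F2 x)) /\
  (forall x, D x -> cont_within D F2 x).

Definition I01 (r : R) : Prop := 0 <= r <= 1.

Definition exp_k (k : nat) (x : R) : R := Nat.iter k exp x.

(* Condition (H1) for f on [t0,oo), with g = log f and g1 = g', g2 = g''. *)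
Definition H1 (t0 : R) (f g g1 g2 : R -> R) (q : R) (p : Rbar) : Prop :=
  (forall t, t0 <= t -> 0 < g1 t /\ 0 < g2 t) /\
  ((q = 1 /\ Rbar_lt 0 p) \/ (1 < q /\ exists pr : R, p = Finite pr /\ 0 < pr)) /\
  is_lim (fun t => g1 t ^ 2 / (g t * g2 t)) p_infty (Finite q) /\
  is_lim (fun t => t * g1 t / g t) p_infty p /\
  (q = 1 ->
     (forall s t, t0 <= s -> s <= t -> s * g1 s / g s <= t * g1 t / g t) /\
     exists (k : nat) (gh gh1 gh2 : R -> R),
       (1 <= k)%nat /\ C2_with (Rle t0) gh gh1 gh2 /\
       (forall t, t0 <= t -> f t = exp_k k (gh t)) /\
       (forall s t, t0 <= s -> s <= t -> gh1 t / gh t <= gh1 s / gh s)).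

(* The sequences a_k, delta_k, eta_k (indexed from k = 1); P is the real p. *)
Definition seq_spec (q P : R) (a delta eta : nat -> R) : Prop :=
  a 1%nat = 2 /\ delta 1%nat = 1 /\ eta 1%nat = 1 /\
  (1 < q < 2 ->
     forall k, (1 <= k)%nat ->
       0 < delta (S k) < delta k /\
       2 * P / (2 + a k) * (1 - delta (S k) / delta k) - 1
         + Rpower (delta (S k) / delta k) P = 0 /\
       a (S k) = 2 - Rpower (delta (S k) / delta k) (P - 1) * (2 + a k) /\
       eta k = Rpower (delta k) P) /\
  (q = 1 ->
     forall k, (1 <= k)%nat ->
       0 < eta (S k) < eta k /\
       2 / (2 + a k) * ln (eta k / eta (S k)) - 1 + eta (S k) / eta k = 0 /\
       a (S k) = 2 - eta (S k) / eta k * (2 + a k) /\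
       delta k = 1).

(* Profile z_k with parameter a = a_k, valid for r > 0. *)
Definition zprof (a r : R) : R :=
  let b := Rpower (sqrt 2 / a) a in
  ln (2 * a ^ 2 * b / (Rpower r (2 - a) * (1 + b * Rpower r a) ^ 2)).

(* gamma_{k,n}: the positive solution of lam * h(r) * f'(U r) * gamma^2 = 1. *)
Definition gam (lam : R) (h f1 U : R -> R) (r : R) : R :=
  / sqrt (lam * h r * f1 (U r)).

Definition zn (g1 U : R -> R) (r gm s : R) : R := g1 (U r) * (U (gm * s) - U r).
Definition zn1 (g1 U U1 : R -> R) (r gm s : R) : R := g1 (U r) * gm * U1 (gm * s).
Definition zn2 (g1 U U2 : R -> R) (r gm s : R) : R := g1 (U r) * gm ^ 2 * U2 (gm * s).

(* Main.v *)
Require Import Defs.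
From Stdlib Require Import Reals Lra Lia ClassicalEpsilon.
From Coquelicot Require Import Coquelicot.
Open Scope R_scope.

(* With tau = log r, v(tau) = u(r) and m = -dv/dtau one has dm/dtau = lam r^2 h f(v) >= 0, so v is
   concave. Let E = lam r^2 h f'(v) and y = g'(v) m. Since (g/g')' tends to kap = 1 - 1/q, the
   ratios g(v - s g(v)/g'(v)) / g(v) converge, and the large parameter g(v) separates two scales.
   Where y = 2 and E is near a^2/2, rescaling gives the Liouville equation (Gronwall), and y
   increases from 2 - a to 2 + a across the bubble. After it v lies below its tangent line, so f(v)
   is bounded along that line by the exponential of a convex function: m stays constant to leading
   order until this exponent returns to its initial value, which is the equation defining
   delta_{k+1} (or eta_{k+1}), and there y = 2 - a_{k+1}. From then on (y - 2)^2/2 + E is almost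
   conserved, so that E is near a_{k+1}^2/2 when y reaches 2, which is the next bubble. The
   boundary r = 1 is never met because v is still large. All limits are determined, so no
   subsequence is needed. *)

(** * Limits along sequences and monotonicity *)

(** The obstacle is the neck between two bubbles: its logarithmic length is of order [g (v)], which
    tends to infinity, and the same large factor multiplies every error made in the exponent. A
    limit value for the end of the neck is therefore useless. The end is instead defined, for each
    n, by an exact root of the tangent-line equation; then [A], the logarithm of E, changes along
    the neck only by bounded terms and by g(v) - g(line) <= 0. Hence [A] still tends to minus
    infinity, yet it is o(g), so the time O(|A| + 1) spent before the next bubble costs no height at
    leading order. Heights are measured by the drop s in units of g/g'. The exponent 2 (x - x0) +
    g(line) - g(V), divided by g(V), tends to 2 s / Y - 1 + [Ef kap s] with Y the value of y on
    leaving the bubble. Both recursions of the statement are this single equation: if q > 1, then 1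
    - kap s is a ratio of heights and [Ef] is its power p; if q = 1, then kap = 0 and [Ef] is
    exp(-s). *)

Lemma ev_mp (P Q : nat -> Prop) :
  eventually P -> eventually (fun n => P n -> Q n) -> eventually Q.
Proof.
  intros [N HN] [M HM]. exists (max N M). intros n Hn.
  apply HM; [lia|]. apply HN; lia.
Qed.

Lemma ev_all (P : nat -> Prop) : (forall n, P n) -> eventually P.
Proof. intros H. exists 0%nat. auto. Qed.

Ltac ev_use H := apply (ev_mp _ _ H); clear H.
Ltac ev_keep H := apply (ev_mp _ _ H).
Tactic Notation "ev_intros" simple_intropattern_list(l) := apply ev_all; intros l.

Lemma ev_choice (Q : nat -> R -> Prop) :
  eventually (fun n => exists x, Q n x) ->
  exists x : nat -> R, eventually (fun n => Q n (x n)).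
Proof.
  intros H. exists (fun n => epsilon (inhabits 0) (Q n)).
  ev_use H. ev_intros n Hn. now apply epsilon_spec.
Qed.

(** Diagonal extraction: [T] is an increasing majorant of the thresholds and [J n] is the largest
    [j] with [T j <= n]. It turns statements about each fixed window, or each fixed tolerance, into
    one about windows that grow slowly with [n]. *)
Lemma ev_diag (P : nat -> nat -> Prop) :
  (forall j, eventually (P j)) ->
  exists J : nat -> nat, (forall M, eventually (fun n => (M <= J n)%nat)) /\
    eventually (fun n => P (J n) n).
Proof.
  intros H.
  destruct (choice (fun j N => forall n, (N <= n)%nat -> P j n) H) as [N HN].
  set (T := fix T j := match j with O => N O | S i => S (max (T i) (N (S i))) end).
  assert (TN : forall j, (N j <= T j)%nat) by (intros [|j]; simpl; lia).
  assert (Tmon : forall i j, (i <= j)%nat -> (T i <= T j)%nat).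
  { intros i j Hij. induction Hij; [lia|]. simpl. lia. }
  assert (Tge : forall j, (j <= T j)%nat) by (induction j; simpl; lia).
  assert (E : forall n, exists j, (T 0%nat <= n)%nat ->
            (T j <= n)%nat /\ forall i, (T i <= n)%nat -> (i <= j)%nat).
  { intros n.
    (* Since [T i >= i], only the indices up to [n] compete; the largest is found by induction on
       the bound [b]. *)
    assert (Q : forall b, (T 0%nat <= n)%nat -> exists j, (T j <= n)%nat /\
              forall i, (i <= b)%nat -> (T i <= n)%nat -> (i <= j)%nat).
    { induction b as [|b IH]; intros H0.
      - exists 0%nat. split; [lia|]. intros; lia.
      - destruct (IH H0) as [j [Hj1 Hj2]].
        destruct (Compare_dec.le_dec (T (S b)) n) as [Hb|Hb].
        + exists (S b). split; [auto|intros; lia].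
        + exists j. split; [auto|]. intros i Hi HT.
          destruct (PeanoNat.Nat.eq_dec i (S b)) as [->|Hne]; [tauto|].
          apply Hj2; [lia|auto]. }
    destruct (Compare_dec.le_dec (T 0%nat) n) as [H0|H0].
    - destruct (Q n H0) as [j [Hj1 Hj2]]. exists j. intros _. split; [auto|].
      intros i Hi. apply Hj2; [|auto]. specialize (Tge i). lia.
    - exists 0%nat. intros; lia. }
  destruct (choice _ E) as [J HJ]. exists J. split.
  - intros M. exists (T M). intros n Hn.
    apply HJ; [|auto]. specialize (Tmon 0%nat M). lia.
  - exists (T 0%nat). intros n Hn. apply HN.
    destruct (HJ n Hn) as [H1 _]. specialize (TN (J n)). lia.
Qed.

Lemma lim_eps (u : nat -> R) (l : R) :
  is_lim_seq u l <-> forall eps, 0 < eps -> eventually (fun n => Rabs (u n - l) <= eps).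
Proof.
  split.
  - intros H eps He. apply is_lim_seq_spec in H. destruct (H (mkposreal eps He)) as [N HN].
    exists N. intros n Hn. left. now apply HN.
  - intros H. apply is_lim_seq_spec. intros eps.
    destruct (H (eps / 2)) as [N HN]. { destruct eps; simpl; lra. }
    exists N. intros n Hn. specialize (HN n Hn). destruct eps as [e He]; simpl in *. lra.
Qed.

Lemma lim_lt (u : nat -> R) (l c : R) :
  is_lim_seq u l -> l < c -> eventually (fun n => u n < c).
Proof.
  intros H Hc. apply lim_eps with (eps := (c - l) / 2) in H; [|lra].
  ev_use H. ev_intros n Hn. apply Rabs_le_between in Hn. lra.
Qed.

Lemma lim_gt (u : nat -> R) (l c : R) :
  is_lim_seq u l -> c < l -> eventually (fun n => c < u n).
Proof.
  intros H Hc. apply lim_eps with (eps := (l - c) / 2) in H; [|lra].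
  ev_use H. ev_intros n Hn. apply Rabs_le_between in Hn. lra.
Qed.

Lemma lim_inf (u : nat -> R) :
  is_lim_seq u p_infty <-> forall M, eventually (fun n => M < u n).
Proof. split; intros H; [apply is_lim_seq_spec in H | apply is_lim_seq_spec]; exact H. Qed.

Lemma lim_minf (u : nat -> R) :
  is_lim_seq u m_infty <-> forall M, eventually (fun n => u n < M).
Proof. split; intros H; [apply is_lim_seq_spec in H | apply is_lim_seq_spec]; exact H. Qed.

Lemma lim_inf_le (u v : nat -> R) :
  is_lim_seq u p_infty -> eventually (fun n => u n <= v n) -> is_lim_seq v p_infty.
Proof.
  intros Hu Hle. apply lim_inf. intros M. rewrite lim_inf in Hu. specialize (Hu M).
  ev_use Hu. ev_use Hle. ev_intros ?; lra.
Qed.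

Lemma lim_ext_ev (u v : nat -> R) (l : Rbar) :
  is_lim_seq u l -> eventually (fun n => u n = v n) -> is_lim_seq v l.
Proof. intros Hu He. apply is_lim_seq_ext_loc with u; auto. Qed.

Lemma lim_squeeze0 (u w : nat -> R) (l : R) :
  is_lim_seq w 0 -> eventually (fun n => Rabs (u n - l) <= w n) -> is_lim_seq u l.
Proof.
  intros Hw Hle. apply lim_eps. intros eps He.
  apply lim_lt with (c := eps) in Hw; [|lra].
  ev_use Hw. ev_use Hle. ev_intros ?; lra.
Qed.

Lemma lim_inv_inf (u : nat -> R) : is_lim_seq u p_infty -> is_lim_seq (fun n => / u n) 0.
Proof.
  intros H. change (Finite 0) with (Rbar_inv p_infty). apply is_lim_seq_inv; [auto|discriminate].
Qed.

Lemma lim_div_inf (w u : nat -> R) (l : R) :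
  is_lim_seq w l -> is_lim_seq u p_infty -> is_lim_seq (fun n => w n / u n) 0.
Proof.
  intros Hw Hu. replace 0 with (l * 0) by ring. apply is_lim_seq_mult'; [auto|].
  now apply lim_inv_inf.
Qed.

Lemma lim_exp (u : nat -> R) (l : R) :
  is_lim_seq u l -> is_lim_seq (fun n => exp (u n)) (exp l).
Proof.
  intros. apply is_lim_seq_continuous; [|auto].
  apply derivable_continuous_pt, derivable_pt_exp.
Qed.

Lemma lim_ln (u : nat -> R) (l : R) :
  0 < l -> is_lim_seq u l -> is_lim_seq (fun n => ln (u n)) (ln l).
Proof.
  intros. apply is_lim_seq_continuous; [|auto].
  apply derivable_continuous_pt. exists (/ l). now apply derivable_pt_lim_ln.
Qed.

Lemma lim_exp_minf (u : nat -> R) :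
  is_lim_seq u m_infty -> is_lim_seq (fun n => exp (u n)) 0.
Proof.
  intros Hu. apply lim_eps. intros eps He. rewrite lim_minf in Hu.
  specialize (Hu (ln eps)). ev_use Hu. ev_intros n Hn.
  rewrite Rminus_0_r, Rabs_pos_eq by (left; apply exp_pos).
  left. rewrite <- (exp_ln eps He). now apply exp_increasing.
Qed.

Lemma deriv_cont (F : R -> R) (x l : R) : is_derive F x l -> continuity_pt F x.
Proof.
  intros H. apply derivable_continuous_pt. exists l. now apply is_derive_Reals.
Qed.

(** * Mean value and intermediate value arguments on closed intervals *)

Lemma mvt_closed (F F1 : R -> R) (a b : R) :
  a <= b -> (forall x, a <= x <= b -> is_derive F x (F1 x)) ->
  exists c, a <= c <= b /\ F b - F a = F1 c * (b - a).
Proof.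
  intros Hab HD.
  destruct (MVT_gen F a b F1) as [c Hc].
  - rewrite Rmin_left, Rmax_right by auto. intros; apply HD; lra.
  - rewrite Rmin_left, Rmax_right by auto. intros. eapply deriv_cont, HD; lra.
  - rewrite Rmin_left, Rmax_right in Hc by auto. now exists c.
Qed.

Lemma incr_le (F F1 : R -> R) (a b c : R) :
  a <= b -> (forall x, a <= x <= b -> is_derive F x (F1 x)) ->
  (forall x, a <= x <= b -> F1 x <= c) -> F b <= F a + c * (b - a).
Proof.
  intros Hab HD Hc. destruct (mvt_closed F F1 a b Hab HD) as [x [Hx E]].
  specialize (Hc x Hx). assert (F1 x * (b - a) <= c * (b - a)) by (apply Rmult_le_compat_r; lra). lra.
Qed.

Lemma incr_ge (F F1 : R -> R) (a b c : R) :
  a <= b -> (forall x, a <= x <= b -> is_derive F x (F1 x)) ->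
  (forall x, a <= x <= b -> c <= F1 x) -> F a + c * (b - a) <= F b.
Proof.
  intros Hab HD Hc. destruct (mvt_closed F F1 a b Hab HD) as [x [Hx E]].
  specialize (Hc x Hx). assert (c * (b - a) <= F1 x * (b - a)) by (apply Rmult_le_compat_r; lra). lra.
Qed.

Lemma decr_le (F F1 : R -> R) (a b : R) :
  a <= b -> (forall x, a <= x <= b -> is_derive F x (F1 x)) ->
  (forall x, a <= x <= b -> F1 x <= 0) -> F b <= F a.
Proof.
  intros Hab HD Hc. generalize (incr_le F F1 a b 0 Hab HD Hc). lra.
Qed.

Lemma incr_le0 (F F1 : R -> R) (a b : R) :
  a <= b -> (forall x, a <= x <= b -> is_derive F x (F1 x)) ->
  (forall x, a <= x <= b -> 0 <= F1 x) -> F a <= F b.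
Proof.
  intros Hab HD Hc. generalize (incr_ge F F1 a b 0 Hab HD Hc). lra.
Qed.

Lemma exp_le (x y : R) : x <= y -> exp x <= exp y.
Proof. intros [H| ->]; [left; now apply exp_increasing|lra]. Qed.

Lemma ivt (F F1 : R -> R) (a b y : R) :
  a <= b -> (forall x, a <= x <= b -> is_derive F x (F1 x)) ->
  F a <= y <= F b -> exists x, a <= x <= b /\ F x = y.
Proof.
  intros Hab HD Hy.
  destruct (Req_dec a b) as [->|Hne]. { exists b. split; lra. }
  destruct (Req_dec (F a) y) as [Ha|Ha]. { exists a. split; lra. }
  destruct (Req_dec (F b) y) as [Hb|Hb]. { exists b. split; lra. }
  destruct (Ranalysis5.IVT_interv (fun x => F x - y) a b) as [x Hx]; [| lra | lra | lra |].
  - intros x Hx. apply continuity_pt_minus.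
    + eapply deriv_cont, HD; lra.
    + apply continuity_pt_const. now intros ? ?.
  - exists x. split; [tauto|lra].
Qed.

(** * Slow variation of g at the scale g/g' *)

(* Ef and ef are the limits, as v tends to infinity, of the ratios of g and of g' at v - s chi(v)
   and at v, where chi = g / g'; Lf = log Ef. *)
Definition Lf (kap s : R) : R :=
  if Req_EM_T kap 0 then - s else ln (1 - kap * s) / kap.
Definition Ef (kap s : R) : R := exp (Lf kap s).
Definition ef (kap s : R) : R := Ef kap s / (1 - kap * s).

Lemma Lf_deriv (kap s : R) :
  kap * s < 1 -> is_derive (Lf kap) s (- / (1 - kap * s)).
Proof.
  intros Hs. unfold Lf. destruct (Req_EM_T kap 0) as [->|Hk].
  - auto_derive; [auto|field; lra].
  - auto_derive; [lra|field; lra].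
Qed.

Lemma Lf_0 (kap : R) : Lf kap 0 = 0.
Proof.
  unfold Lf. destruct (Req_EM_T kap 0); [ring|].
  rewrite Rmult_0_r, Rminus_0_r, ln_1. unfold Rdiv; ring.
Qed.

Lemma Ef_0 (kap : R) : Ef kap 0 = 1.
Proof. unfold Ef. now rewrite Lf_0, exp_0. Qed.

Lemma Ef_pos (kap s : R) : 0 < Ef kap s.
Proof. apply exp_pos. Qed.

Lemma Ef_deriv (kap s : R) : kap * s < 1 -> is_derive (Ef kap) s (- ef kap s).
Proof.
  intros Hs. unfold Ef, ef. evar_last.
  - apply (is_derive_comp exp (Lf kap)).
    + apply is_derive_Reals, derivable_pt_lim_exp.
    + now apply Lf_deriv.
  - unfold scal; simpl; unfold mult; simpl. unfold Ef. field. lra.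
Qed.

Lemma ef_deriv (kap s : R) :
  kap * s < 1 -> is_derive (ef kap) s (- ((1 - kap) * (Ef kap s / (1 - kap * s) ^ 2))).
Proof.
  intros Hs. unfold ef. evar_last.
  - apply (is_derive_div (Ef kap) (fun s => 1 - kap * s)); [now apply Ef_deriv| |lra].
    instantiate (1 := - kap). auto_derive; [auto|ring].
  - unfold ef. field. lra.
Qed.

Lemma ef_pos (kap s : R) : kap * s < 1 -> 0 < ef kap s.
Proof. intros. apply Rdiv_lt_0_compat; [apply Ef_pos|lra]. Qed.

(* Passing from v to v - s chi(v), then from there by t chi: the drops compose to s + t (1 - kap s). *)
Lemma Lf_comp (kap s t : R) :
  kap * s < 1 -> kap * t < 1 -> Lf kap (s + t * (1 - kap * s)) = Lf kap s + Lf kap t.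
Proof.
  intros Hs Ht. unfold Lf. destruct (Req_EM_T kap 0) as [->|Hk]; [ring|].
  replace (1 - kap * (s + t * (1 - kap * s))) with ((1 - kap * s) * (1 - kap * t)) by ring.
  rewrite ln_mult by lra. field. auto.
Qed.

Lemma ef_comp (kap s t : R) :
  kap * s < 1 -> kap * t < 1 -> ef kap (s + t * (1 - kap * s)) = ef kap s * ef kap t.
Proof.
  intros Hs Ht. unfold ef, Ef. rewrite Lf_comp, exp_plus by auto.
  replace (1 - kap * (s + t * (1 - kap * s))) with ((1 - kap * s) * (1 - kap * t)) by ring.
  field. lra.
Qed.

(** [kap] is the limit of (g/g')' = 1 - g g''/g'^2, that is 1/p. The conditions are imposed for
    [t0 < t] only, because at [t0] the theorem provides one-sided derivatives. *)
Record growth (g g1 g2 : R -> R) (t0 q kap : R) : Prop := {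
  gr_g : forall t, t0 < t -> is_derive g t (g1 t);
  gr_g1 : forall t, t0 < t -> is_derive g1 t (g2 t);
  gr_g1pos : forall t, t0 < t -> 0 < g1 t;
  gr_g2pos : forall t, t0 < t -> 0 < g2 t;
  gr_lim : is_lim (fun t => g1 t ^ 2 / (g t * g2 t)) p_infty (Finite q);
  gr_q : 1 <= q;
  gr_kap : kap = 1 - / q }.
Arguments gr_g {g g1 g2 t0 q kap}.
Arguments gr_g1 {g g1 g2 t0 q kap}.
Arguments gr_g1pos {g g1 g2 t0 q kap}.
Arguments gr_g2pos {g g1 g2 t0 q kap}.
Arguments gr_lim {g g1 g2 t0 q kap}.
Arguments gr_q {g g1 g2 t0 q kap}.
Arguments gr_kap {g g1 g2 t0 q kap}.

Definition drop_scale (g g1 : R -> R) (t : R) : R := g t / g1 t.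

Section SlowVariation.
Context {g g1 g2 : R -> R} {t0 q kap : R} (HG : growth g g1 g2 t0 q kap).
Local Notation chi := (drop_scale g g1).
Let Hg := gr_g HG.
Let Hg1 := gr_g1 HG.
Let Hg1p := gr_g1pos HG.
Let Hg2p := gr_g2pos HG.
Let Hlim := gr_lim HG.
Let Hq := gr_q HG.
Let Hkap := gr_kap HG.

Lemma kap_range : 0 <= kap < 1.
Proof.
  rewrite Hkap. assert (0 < / q) by (apply Rinv_0_lt_compat; lra).
  assert (/ q <= / 1) by (apply Rinv_le_contravar; lra). lra.
Qed.

Lemma g1_mono (s t : R) : t0 < s -> s <= t -> g1 s <= g1 t.
Proof.
  intros Hs Hst. apply (incr_le0 g1 g2); [auto| |].
  - intros; apply Hg1; lra.
  - intros; left; apply Hg2p; lra.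
Qed.

Lemma g_mono (s t : R) : t0 < s -> s <= t -> g s <= g t.
Proof.
  intros Hs Hst. apply (incr_le0 g g1); [auto| |].
  - intros; apply Hg; lra.
  - intros; left; apply Hg1p; lra.
Qed.

Lemma g_lower (s t : R) : t0 < s -> s <= t -> g s + g1 s * (t - s) <= g t.
Proof.
  intros Hs Hst. apply (incr_ge g g1); [auto| |].
  - intros; apply Hg; lra.
  - intros; apply g1_mono; lra.
Qed.

Lemma g_upper (s t : R) : t0 < s -> s <= t -> g t <= g s + g1 t * (t - s).
Proof.
  intros Hs Hst. apply (incr_le g g1); [auto| |].
  - intros; apply Hg; lra.
  - intros; apply g1_mono; lra.
Qed.

Lemma g_infty (M : R) : exists T, t0 + 1 <= T /\ forall t, T <= t -> M <= g t.
Proof.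
  assert (P := Hg1p (t0 + 1) ltac:(lra)).
  exists (t0 + 1 + Rabs (M - g (t0 + 1)) / g1 (t0 + 1)).
  assert (Q : 0 <= Rabs (M - g (t0 + 1)) / g1 (t0 + 1)).
  { apply Rmult_le_pos; [apply Rabs_pos|]. left. now apply Rinv_0_lt_compat. }
  split; [lra|]. intros t Ht.
  assert (G := g_lower (t0 + 1) t ltac:(lra) ltac:(lra)).
  assert (g1 (t0 + 1) * (Rabs (M - g (t0 + 1)) / g1 (t0 + 1)) <= g1 (t0 + 1) * (t - (t0 + 1))).
  { apply Rmult_le_compat_l; lra. }
  replace (g1 (t0 + 1) * (Rabs (M - g (t0 + 1)) / g1 (t0 + 1)))
    with (Rabs (M - g (t0 + 1))) in H by (field; lra).
  generalize (Rle_abs (M - g (t0 + 1))). lra.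
Qed.

Lemma chi_deriv (t : R) :
  t0 < t -> is_derive chi t (1 - g t * g2 t / g1 t ^ 2).
Proof.
  intros Ht. unfold drop_scale. assert (P := Hg1p t Ht). evar_last.
  - apply (is_derive_div g g1); [now apply Hg|now apply Hg1|lra].
  - field. lra.
Qed.

Lemma chi_slope (eps : R) : 0 < eps ->
  exists T, t0 + 1 <= T /\ forall t, T <= t -> 0 < g t /\ Rabs (1 - g t * g2 t / g1 t ^ 2 - kap) <= eps.
Proof.
  intros He.
  destruct (g_infty 1) as [T1 [HT1 HT1']].
  assert (L : is_lim (fun t => / (g1 t ^ 2 / (g t * g2 t))) p_infty (Rbar_inv q)).
  { apply is_lim_inv; [auto|]. intros E. inversion E. lra. }
  apply is_lim_spec in L. destruct (L (mkposreal eps He)) as [T2 HT2].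
  exists (Rmax T1 (T2 + 1)). split. { generalize (Rmax_l T1 (T2 + 1)); lra. }
  intros t Ht. assert (T1 <= t) by (generalize (Rmax_l T1 (T2 + 1)); lra).
  assert (T2 < t) by (generalize (Rmax_r T1 (T2 + 1)); lra).
  specialize (HT1' t H). split; [lra|]. specialize (HT2 t H0).
  assert (P1 := Hg1p t ltac:(lra)). assert (P2 := Hg2p t ltac:(lra)).
  replace (1 - g t * g2 t / g1 t ^ 2 - kap) with (- (/ (g1 t ^ 2 / (g t * g2 t)) - / q)).
  - rewrite Rabs_Ropp. change (Rabs (/ (g1 t ^ 2 / (g t * g2 t)) - / q) < eps) in HT2. lra.
  - rewrite Hkap. field. repeat split; lra.
Qed.

Lemma chi_diff (eps T s t : R) :
  (forall t, T <= t -> Rabs (1 - g t * g2 t / g1 t ^ 2 - kap) <= eps) ->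
  t0 < T -> T <= s -> T <= t -> Rabs (chi t - chi s - kap * (t - s)) <= eps * Rabs (t - s).
Proof.
  intros HT HT0. assert (W : forall s t, T <= s -> s <= t ->
    Rabs (chi t - chi s - kap * (t - s)) <= eps * (t - s)).
  { clear s t. intros s t Hs Hst.
    destruct (mvt_closed chi (fun t => 1 - g t * g2 t / g1 t ^ 2) s t Hst) as [c [Hc E]].
    { intros; apply chi_deriv; lra. }
    rewrite E. replace (_ - _) with ((1 - g c * g2 c / g1 c ^ 2 - kap) * (t - s)) by ring.
    rewrite Rabs_mult, (Rabs_pos_eq (t - s)) by lra.
    apply Rmult_le_compat_r; [lra|]. apply HT; lra. }
  intros Hs Ht. destruct (Rle_dec s t) as [H|H].
  - rewrite (Rabs_pos_eq (t - s)) by lra. auto.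
  - specialize (W t s Ht ltac:(lra)). rewrite (Rabs_left (t - s)) by lra.
    replace (chi t - chi s - kap * (t - s)) with (- (chi s - chi t - kap * (s - t))) by ring.
    rewrite Rabs_Ropp. lra.
Qed.

Lemma chi_over (v : nat -> R) :
  is_lim_seq v p_infty -> is_lim_seq (fun n => chi (v n) / v n) kap.
Proof.
  intros Hv. apply lim_eps. intros eps He.
  destruct (chi_slope (eps / 2)) as [T [HT HT']]; [lra|].
  set (T' := Rmax T 1). assert (T'1 : T <= T' /\ 1 <= T') by (split; [apply Rmax_l|apply Rmax_r]).
  set (C := Rabs (chi T' - kap * T')).
  assert (E := proj1 (lim_inf v) Hv (Rmax T' (2 * C / eps))).
  ev_use E. ev_intros n Hn.
  assert (B1 := Rmax_l T' (2 * C / eps)). assert (B2 := Rmax_r T' (2 * C / eps)).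
  assert (D := chi_diff (eps / 2) T T' (v n) (fun t Ht => proj2 (HT' t Ht)) ltac:(lra) ltac:(lra) ltac:(lra)).
  rewrite (Rabs_pos_eq (v n - T')) in D by lra.
  replace (chi (v n) / v n - kap) with ((chi (v n) - kap * v n) / v n) by (field; lra).
  unfold Rdiv. rewrite Rabs_mult, (Rabs_pos_eq (/ v n)) by (left; apply Rinv_0_lt_compat; lra).
  apply Rmult_le_reg_r with (v n); [lra|].
  rewrite Rmult_assoc, Rinv_l, Rmult_1_r by lra.
  replace (chi (v n) - kap * v n) with
    ((chi (v n) - chi T' - kap * (v n - T')) + (chi T' - kap * T')) by ring.
  eapply Rle_trans; [apply Rabs_triang|]. fold C.
  assert (2 * C / eps * eps <= v n * eps) by (apply Rmult_le_compat_r; lra).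
  replace (2 * C / eps * eps) with (2 * C) in H by (field; lra).
  assert (eps / 2 * (v n - T') <= eps / 2 * v n) by (apply Rmult_le_compat_l; lra). lra.
Qed.

Lemma lim_g (v : nat -> R) : is_lim_seq v p_infty -> is_lim_seq (fun n => g (v n)) p_infty.
Proof.
  intros Hv. apply lim_inf. intros M. destruct (g_infty (M + 1)) as [T [_ HT]].
  assert (E := proj1 (lim_inf v) Hv T). ev_use E. ev_intros n Hn.
  specialize (HT (v n)). lra.
Qed.

(** The new height is [v n] times 1 - s chi(v)/v, and this factor tends to 1 - kap l > 0. *)
Lemma drop_infty (v s : nat -> R) (l : R) :
  is_lim_seq v p_infty -> is_lim_seq s l -> kap * l < 1 ->
  is_lim_seq (fun n => v n - s n * chi (v n)) p_infty.
Proof.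
  intros Hv Hs Hl.
  assert (Q : is_lim_seq (fun n => 1 - s n * (chi (v n) / v n)) (1 - l * kap)).
  { apply is_lim_seq_minus'; [apply is_lim_seq_const|].
    apply is_lim_seq_mult'; [auto|]. now apply chi_over. }
  apply lim_ext_ev with (fun n => v n * (1 - s n * (chi (v n) / v n))).
  - eapply is_lim_seq_mult; [exact Hv|exact Q|].
    apply is_Rbar_mult_p_infty_pos. simpl. lra.
  - assert (E := proj1 (lim_inf v) Hv 1). ev_use E. ev_intros n Hn. field. lra.
Qed.

(** Because chi' tends to [kap], chi at v - x chi(v) is (1 - kap x + o(1)) chi(v), uniformly for x
    between 0 and s. The x-derivative of log g(v - x chi(v)) is minus the inverse of that ratio,
    close to the derivative of [Lf], and the mean value theorem compares the two. The ratio of g' is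
    the quotient of the ratios of g and of chi. *)
Lemma slow_variation (v s : nat -> R) (l : R) :
  is_lim_seq v p_infty -> is_lim_seq s l -> kap * l < 1 ->
  is_lim_seq (fun n => chi (v n - s n * chi (v n)) / chi (v n)) (1 - kap * l) /\
  is_lim_seq (fun n => g (v n - s n * chi (v n)) / g (v n)) (Ef kap l) /\
  is_lim_seq (fun n => g1 (v n - s n * chi (v n)) / g1 (v n)) (ef kap l).
Proof.
  intros Hv Hs Hl. assert (K := kap_range).
  set (t := fun n => v n - s n * chi (v n)).
  assert (Ht : is_lim_seq t p_infty) by (eapply drop_infty; eauto).
  (* The two conditions on [x] say that it lies between 0 and [s n], whichever sign [s n] has. *)
  assert (U : forall eps, 0 < eps -> eventually (fun n =>
     forall x, Rabs x <= Rabs (s n) -> x * s n >= 0 ->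
       t0 < v n - x * chi (v n) /\ 0 < g (v n - x * chi (v n)) /\ 0 < g (v n) /\ t0 < v n /\
       Rabs (chi (v n - x * chi (v n)) / chi (v n) - (1 - kap * x)) <= eps * Rabs x)).
  { intros eps He. destruct (chi_slope eps He) as [T [HT HT']].
    assert (E1 := proj1 (lim_inf v) Hv T). assert (E2 := proj1 (lim_inf t) Ht T).
    ev_use E1. ev_use E2. ev_intros n H2 H1 x Hx Hxs. unfold t in H2.
    assert (Gv : 0 < g (v n)) by (apply HT'; lra).
    assert (Cv : 0 < chi (v n)). { apply Rdiv_lt_0_compat; [auto|]. apply Hg1p; lra. }
    assert (Hb : T <= v n - x * chi (v n)).
    { destruct (Rle_dec x 0) as [Hx0|Hx0].
      - assert (x * chi (v n) <= 0 * chi (v n)) by (apply Rmult_le_compat_r; lra). lra.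
      - assert (0 <= s n). { destruct (Rle_dec 0 (s n)); [auto|]. nra. }
        rewrite !Rabs_pos_eq in Hx by lra.
        assert (x * chi (v n) <= s n * chi (v n)) by (apply Rmult_le_compat_r; lra). lra. }
    assert (D := chi_diff eps T (v n) (v n - x * chi (v n)) (fun t Ht => proj2 (HT' t Ht))
       ltac:(lra) ltac:(lra) Hb).
    split; [lra|]. split; [apply HT'; lra|]. split; [auto|]. split; [lra|].
    replace (chi (v n - x * chi (v n)) / chi (v n) - (1 - kap * x)) with
      ((chi (v n - x * chi (v n)) - chi (v n) - kap * (v n - x * chi (v n) - v n)) / chi (v n))
      by (field; lra).
    unfold Rdiv. rewrite Rabs_mult, (Rabs_pos_eq (/ chi (v n))) by (left; now apply Rinv_0_lt_compat).
    apply Rmult_le_reg_r with (chi (v n)); [auto|].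
    rewrite Rmult_assoc, Rinv_l, Rmult_1_r by lra.
    eapply Rle_trans; [exact D|].
    replace (v n - x * chi (v n) - v n) with (- (x * chi (v n))) by ring.
    rewrite Rabs_Ropp, Rabs_mult, (Rabs_pos_eq (chi (v n))) by lra. lra. }
  set (B := Rabs l + 1). assert (HB : 0 < B) by (generalize (Rabs_pos l); unfold B; lra).
  assert (Bs : eventually (fun n => Rabs (s n) <= B)).
  { assert (E := proj1 (lim_eps s l) Hs 1 ltac:(lra)). ev_use E. ev_intros n Hn.
    replace (s n) with ((s n - l) + l) by ring. eapply Rle_trans; [apply Rabs_triang|]. unfold B; lra. }
  assert (C1 : is_lim_seq (fun n => chi (t n) / chi (v n)) (1 - kap * l)).
  { assert (Z : is_lim_seq (fun n => 1 - kap * s n) (1 - kap * l)).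
    { apply is_lim_seq_minus'; [apply is_lim_seq_const|].
      apply is_lim_seq_mult'; [apply is_lim_seq_const|auto]. }
    assert (W : is_lim_seq (fun n => chi (t n) / chi (v n) - (1 - kap * s n)) 0).
    { apply lim_eps. intros eps He. specialize (U (eps / B) ltac:(apply Rdiv_lt_0_compat; lra)).
      ev_use U. ev_use Bs. ev_intros n Hn Un.
      destruct (Un (s n) ltac:(lra) ltac:(apply Rle_ge; apply Rle_0_sqr)) as [_ [_ [_ [_ Q]]]].
      fold (t n) in Q. rewrite Rminus_0_r. eapply Rle_trans; [exact Q|].
      apply Rle_trans with (eps / B * B); [|right; field; lra].
      apply Rmult_le_compat_l; [|auto]. left. apply Rdiv_lt_0_compat; lra. }
    replace (Finite (1 - kap * l)) with (Finite (0 + (1 - kap * l))) by (f_equal; ring).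
    eapply is_lim_seq_ext; [|apply is_lim_seq_plus'; [exact W|exact Z]].
    intros n; simpl; ring. }
  set (d := (1 - kap * l) / 2). assert (Hd : 0 < d) by (unfold d; lra).
  assert (Ds : eventually (fun n => 2 * d - d <= 1 - kap * s n)).
  { assert (Z : is_lim_seq (fun n => 1 - kap * s n) (1 - kap * l)).
    { apply is_lim_seq_minus'; [apply is_lim_seq_const|].
      apply is_lim_seq_mult'; [apply is_lim_seq_const|auto]. }
    apply lim_gt with (c := d) in Z; [|unfold d; lra]. ev_use Z. ev_intros ?; lra. }
  (* A lower bound for [1 - kap * x] on the whole segment: the minimum with 1 takes care of negative
     [x]. *)
  set (d1 := Rmin d 1). assert (Hd1 : 0 < d1 <= 1 /\ d1 <= d).
  { unfold d1. split; [split|]; [apply Rmin_glb_lt; lra|apply Rmin_r|apply Rmin_l]. }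
  assert (C2 : is_lim_seq (fun n => ln (g (t n)) - ln (g (v n)) - Lf kap (s n)) 0).
  { apply lim_eps. intros eps He.
    (* The first entry keeps the ratio of [chi] above [d1 / 2]; the second then makes the derivative
       of [Phi] at most [eps / B], on a segment of length at most [B]. *)
    set (e1 := Rmin (d1 / (2 * B)) (eps * (d1 * (d1 / 2)) / (B * B))).
    assert (He1 : 0 < e1).
    { unfold e1. apply Rmin_glb_lt.
      - apply Rdiv_lt_0_compat; lra.
      - apply Rdiv_lt_0_compat; [|nra]. apply Rmult_lt_0_compat; nra. }
    specialize (U e1 He1). ev_use U. ev_use Bs. ev_use Ds. ev_intros n Dn Bn Un.
    set (Phi := fun x => ln (g (v n - x * chi (v n))) - Lf kap x).
    set (Phi1 := fun x => / (1 - kap * x) - / (chi (v n - x * chi (v n)) / chi (v n))).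
    assert (R1 : forall x, Rabs x <= Rabs (s n) -> x * s n >= 0 -> 
      d1 <= 1 - kap * x /\ is_derive Phi x (Phi1 x) /\ Rabs (Phi1 x) <= eps / B).
    { intros x Hx Hxs. destruct (Un x Hx Hxs) as [Q1 [Q2 [Q3 [Q3' Q4]]]].
      assert (D1 : d1 <= 1 - kap * x).
      { destruct (Rle_dec x 0) as [Hx0|Hx0]; [nra|].
        assert (0 <= s n). { destruct (Rle_dec 0 (s n)); [auto|nra]. }
        rewrite !Rabs_pos_eq in Hx by lra. nra. }
      split; [auto|].
      assert (P1 : 0 < g1 (v n - x * chi (v n))) by (apply Hg1p; lra).
      assert (P2 : 0 < g1 (v n)) by (apply Hg1p; lra).
      assert (P3 : 0 < chi (v n)) by (apply Rdiv_lt_0_compat; lra).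
      assert (P4 : 0 < chi (v n - x * chi (v n))) by (apply Rdiv_lt_0_compat; lra).
      split.
      - unfold Phi, Phi1. evar_last.
        + apply (is_derive_minus (fun x => ln (g (v n - x * chi (v n)))) (Lf kap)).
          * apply (is_derive_comp ln (fun x => g (v n - x * chi (v n)))).
            { apply is_derive_Reals. apply derivable_pt_lim_ln. auto. }
            apply (is_derive_comp g (fun x => v n - x * chi (v n))).
            { apply Hg. auto. }
            instantiate (1 := - chi (v n)). auto_derive; [auto|ring].
          * apply Lf_deriv. lra.
        + unfold minus, plus, opp, scal; simpl; unfold mult; simpl.
          unfold drop_scale at 4. set (w := v n - x * chi (v n)) in *. field.
          split; [|split]; lra.
      - set (rr := chi (v n - x * chi (v n)) / chi (v n)) in *.
        assert (Hrr : d1 / 2 <= rr).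
        { assert (e1 * Rabs x <= d1 / (2 * B) * B).
          { apply Rmult_le_compat; [lra|apply Rabs_pos|apply Rmin_l|lra]. }
          replace (d1 / (2 * B) * B) with (d1 / 2) in H by (field; lra).
          apply Rabs_le_between in Q4. lra. }
        unfold Phi1. fold rr. replace (/ (1 - kap * x) - / rr) with ((rr - (1 - kap * x)) / ((1 - kap * x) * rr)) by (field; lra).
        unfold Rdiv. rewrite Rabs_mult, (Rabs_pos_eq (/ _)) by (left; apply Rinv_0_lt_compat; nra).
        apply Rle_trans with ((eps * (d1 * (d1 / 2)) / (B * B) * B) * / (d1 * (d1 / 2))).
        + apply Rmult_le_compat.
          * apply Rabs_pos.
          * left; apply Rinv_0_lt_compat; nra.
          * eapply Rle_trans; [exact Q4|]. apply Rmult_le_compat; [lra|apply Rabs_pos|apply Rmin_r|lra].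
          * apply Rinv_le_contravar; [nra|]. apply Rmult_le_compat; lra.
        + right. field. lra. }
    rewrite Rminus_0_r.
    assert (MV : exists c, Rabs c <= Rabs (s n) /\ c * s n >= 0 /\ Phi (s n) - Phi 0 = Phi1 c * s n).
    { destruct (Rle_dec 0 (s n)) as [H0|H0].
      - destruct (mvt_closed Phi Phi1 0 (s n) H0) as [c [Hc Ec]].
        + intros x Hx. apply R1; [rewrite !Rabs_pos_eq; lra|nra].
        + exists c. rewrite !Rabs_pos_eq by lra. split; [lra|]. split; [nra|]. lra.
      - destruct (mvt_closed Phi Phi1 (s n) 0 ltac:(lra)) as [c [Hc Ec]].
        + intros x Hx. apply R1; [rewrite !Rabs_left1; lra|nra].
        + exists c. rewrite !Rabs_left1 by lra. split; [lra|]. split; [nra|]. lra. }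
    destruct MV as [c [Hc1 [Hc2 Ec]]].
    assert (P0 : Phi 0 = ln (g (v n))).
    { unfold Phi. rewrite Lf_0. replace (v n - 0 * chi (v n)) with (v n) by ring. ring. }
    replace (ln (g (t n)) - ln (g (v n)) - Lf kap (s n)) with (Phi (s n) - Phi 0)
      by (rewrite P0; unfold Phi, t; ring).
    rewrite Ec, Rabs_mult. destruct (R1 c Hc1 Hc2) as [_ [_ Q]].
    apply Rle_trans with (eps / B * B); [|right; field; lra].
    apply Rmult_le_compat; auto using Rabs_pos. }
  assert (LL : is_lim_seq (fun n => Lf kap (s n)) (Lf kap l)).
  { apply is_lim_seq_continuous; [|auto]. eapply deriv_cont. now apply Lf_deriv. }
  assert (Pos : eventually (fun n => 0 < g (t n) /\ 0 < g (v n) /\ t0 < t n /\ t0 < v n)).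
  { specialize (U 1 ltac:(lra)). ev_use U. ev_intros n Un.
    destruct (Un (s n) ltac:(lra) ltac:(apply Rle_ge, Rle_0_sqr)) as [? [? [? [? ?]]]]. unfold t. auto. }
  assert (C3 : is_lim_seq (fun n => g (t n) / g (v n)) (Ef kap l)).
  { apply lim_ext_ev with (fun n => exp ((ln (g (t n)) - ln (g (v n)) - Lf kap (s n)) + Lf kap (s n))).
    - unfold Ef. replace (Lf kap l) with (0 + Lf kap l) by ring. apply lim_exp.
      now apply is_lim_seq_plus'.
    - ev_keep Pos. ev_intros n [P1 [P2 _]].
      replace (_ + _) with (ln (g (t n)) - ln (g (v n))) by ring.
      unfold Rminus. rewrite exp_plus, exp_Ropp, !exp_ln by auto. reflexivity. }
  split; [exact C1|]. split; [exact C3|].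
  apply lim_ext_ev with (fun n => (g (t n) / g (v n)) / (chi (t n) / chi (v n))).
  - apply is_lim_seq_div'; auto. lra.
  - ev_keep Pos. ev_intros n [P1 [P2 [P3 P4]]].
    assert (Q1 := Hg1p _ P3). assert (Q2 := Hg1p _ P4). fold (t n). unfold drop_scale. field. repeat split; lra.
Qed.

End SlowVariation.

(** * Logarithmic radius and the a priori drop estimate *)

(** Below [t0] the function [f] need not be monotone. [nl_le] is the substitute: every value of [f]
    below a level [y >= Lv] is dominated by exp (g y). *)
Record nonlin (f g : R -> R) (t0 Lv : R) : Prop := {
  nl_lev : t0 < Lv;
  nl_pos : forall x, 0 <= x -> 0 <= f x;
  nl_le : forall x y, 0 <= x -> x <= y -> Lv <= y -> f x <= exp (g y);
  nl_eq : forall x, Lv <= x -> f x = exp (g x) }.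
Arguments nl_lev {f g t0 Lv}.
Arguments nl_pos {f g t0 Lv}.
Arguments nl_le {f g t0 Lv}.
Arguments nl_eq {f g t0 Lv}.

(** For k(x) = log h(e^x) the derivative carries the factor e^x, so it disappears as x tends to
    minus infinity. Long necks use only the boundedness of [k]; the conservation law before a bubble
    uses the decay of [k1]. *)
Record weight (k k1 : R -> R) (K : R) : Prop := {
  wt_d : forall x, x < 0 -> is_derive k x (k1 x);
  wt_d1 : forall x, x < 0 -> Rabs (k1 x) <= K * exp x;
  wt_b : forall x, x < 0 -> Rabs (k x) <= K }.
Arguments wt_d {k k1 K}.
Arguments wt_d1 {k k1 K}.
Arguments wt_b {k k1 K}.

(* A radial solution in the logarithmic radius x = log r: v x = u(e^x), m x = - r u'(r), and the
   right-hand side lam r^2 h f(u) is exp (l + 2 x + k x) * f (v x), with l = log lam, k = log h. *)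
Record lsol (f k : R -> R) (l : R) (v m : R -> R) : Prop := {
  ls_v : forall x, x < 0 -> is_derive v x (- m x);
  ls_m : forall x, x < 0 -> is_derive m x (exp (l + 2 * x + k x) * f (v x));
  ls_m0 : forall x, x < 0 -> 0 <= m x;
  ls_v0 : forall x, x < 0 -> 0 <= v x;
  ls_bd : forall c y, 0 < c -> y < 0 -> exists x, y < x < 0 /\ v x < c }.
Arguments ls_v {f k l v m}.
Arguments ls_m {f k l v m}.
Arguments ls_m0 {f k l v m}.
Arguments ls_v0 {f k l v m}.
Arguments ls_bd {f k l v m}.

Lemma strict_mvt (F F1 : R -> R) (a b : R) :
  a < b -> (forall x, a <= x <= b -> is_derive F x (F1 x)) ->
  exists c, a < c < b /\ F b - F a = F1 c * (b - a).
Proof.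
  intros Hab HD. destruct (MVT_cor2 F F1 a b Hab) as [c [E Hc]].
  - intros x Hx. apply is_derive_Reals. now apply HD.
  - now exists c.
Qed.

Lemma convex_chord (F F1 : R -> R) (a b x : R) :
  a < b -> a <= x <= b -> (forall x, a <= x <= b -> is_derive F x (F1 x)) ->
  (forall x y, a <= x -> x <= y -> y <= b -> F1 x <= F1 y) ->
  F x <= F a + (F b - F a) * ((x - a) / (b - a)).
Proof.
  intros Hab Hx HD Hm.
  destruct (mvt_closed F F1 a x) as [c1 [Hc1 E1]]; [lra|intros; apply HD; lra|].
  destruct (mvt_closed F F1 x b) as [c2 [Hc2 E2]]; [lra|intros; apply HD; lra|].
  assert (Q := Hm c1 c2 ltac:(lra) ltac:(lra) ltac:(lra)).
  apply Rmult_le_reg_r with (b - a); [lra|].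
  replace ((F a + (F b - F a) * ((x - a) / (b - a))) * (b - a))
    with (F a * (b - a) + (F b - F a) * (x - a)) by (field; lra).
  replace (F b) with (F a + F1 c1 * (x - a) + F1 c2 * (b - x)) by lra.
  replace (F x) with (F a + F1 c1 * (x - a)) by lra.
  assert (0 <= (F1 c2 - F1 c1) * ((b - x) * (x - a))).
  { apply Rmult_le_pos; [lra|]. apply Rmult_le_pos; lra. }
  nra.
Qed.

Lemma ef_decr (kap x y : R) : 0 <= kap < 1 -> x < y -> kap * y < 1 -> ef kap y < ef kap x.
Proof.
  intros Hk Hxy Hy.
  assert (W : forall z, x <= z <= y -> kap * z < 1) by (intros; nra).
  destruct (strict_mvt (ef kap) (fun s => - ((1 - kap) * (Ef kap s / (1 - kap * s) ^ 2))) x y Hxy)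
    as [c [Hc E]].
  { intros z Hz. apply ef_deriv. auto. }
  assert (0 < (1 - kap) * (Ef kap c / (1 - kap * c) ^ 2)).
  { apply Rmult_lt_0_compat; [lra|]. apply Rdiv_lt_0_compat; [apply Ef_pos|].
    apply pow_lt. specialize (W c ltac:(lra)). lra. }
  nra.
Qed.

(** * The limit of the tangent-line exponent divided by g *)

Section TransitionProfile.
Context (kap Y s : R) (Hk : 0 <= kap < 1) (HY : 2 < Y) (Hs : 0 < s) (Hks : kap * s < 1)
  (Hz : 2 / Y * s - 1 + Ef kap s = 0).

(** The function of this section is strictly convex, since [ef] decreases, and vanishes at 0 and at
    [s]. This determines its sign on both sides of [s] and makes its slope at [s] positive. *)
Lemma Ffun_deriv (x : R) : kap * x < 1 ->
  is_derive (fun x => 2 / Y * x - 1 + Ef kap x) x (2 / Y - ef kap x).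
Proof.
  intros Hx. evar_last.
  - apply (is_derive_plus (fun x => 2 / Y * x - 1) (Ef kap)); [|now apply Ef_deriv].
    instantiate (1 := 2 / Y). auto_derive; [auto|ring].
  - unfold plus; simpl; ring.
Qed.

Lemma Ffun_0 : 2 / Y * 0 - 1 + Ef kap 0 = 0.
Proof. rewrite Ef_0. ring. Qed.

Lemma Ffun_crit : exists c, 0 < c < s /\ ef kap c = 2 / Y.
Proof.
  destruct (strict_mvt (fun x => 2 / Y * x - 1 + Ef kap x) (fun x => 2 / Y - ef kap x) 0 s Hs)
    as [c [Hc E]].
  { intros x Hx. apply Ffun_deriv. nra. }
  cbv beta in E. rewrite Ffun_0, Hz in E. exists c. split; [auto|]. nra.
Qed.

Lemma Ffun_neg (x : R) : 0 < x < s -> 2 / Y * x - 1 + Ef kap x < 0.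
Proof.
  intros Hx. apply Rnot_le_lt. intros H.
  destruct (strict_mvt (fun x => 2 / Y * x - 1 + Ef kap x) (fun x => 2 / Y - ef kap x) 0 x)
    as [c1 [Hc1 E1]]; [lra|intros; apply Ffun_deriv; nra|].
  destruct (strict_mvt (fun x => 2 / Y * x - 1 + Ef kap x) (fun x => 2 / Y - ef kap x) x s)
    as [c2 [Hc2 E2]]; [lra|intros; apply Ffun_deriv; nra|].
  cbv beta in E1, E2. rewrite Ffun_0 in E1. rewrite Hz in E2.
  assert (Q := ef_decr kap c1 c2 Hk ltac:(lra) ltac:(nra)).
  assert (0 <= (2 / Y - ef kap c1) * (x - 0)) by lra.
  assert ((2 / Y - ef kap c2) * (s - x) <= 0) by lra.
  assert (ef kap c1 <= 2 / Y) by nra. assert (2 / Y <= ef kap c2) by nra. lra.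
Qed.

Lemma Ffun_pos (x : R) : s < x -> kap * x < 1 -> 0 < 2 / Y * x - 1 + Ef kap x.
Proof.
  intros Hx Hkx. destruct Ffun_crit as [c1 [Hc1 E1]].
  destruct (strict_mvt (fun x => 2 / Y * x - 1 + Ef kap x) (fun x => 2 / Y - ef kap x) s x)
    as [c2 [Hc2 E2]]; [lra|intros; apply Ffun_deriv; nra|].
  cbv beta in E2. rewrite Hz in E2.
  assert (Q := ef_decr kap c1 c2 Hk ltac:(lra) ltac:(nra)). nra.
Qed.

(** The positive slope at the second zero is what keeps the next parameter 2 - Y [ef kap s]
    positive: the neck is left with y still below 2. *)
Lemma Ffun_slope : Y * ef kap s < 2.
Proof.
  destruct Ffun_crit as [c [Hc E]].
  assert (Q := ef_decr kap c s Hk ltac:(lra) Hks). rewrite E in Q.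
  apply Rmult_lt_compat_l with (r := Y) in Q; [|lra].
  replace (Y * (2 / Y)) with 2 in Q by (field; lra). lra.
Qed.
End TransitionProfile.

Section System.
Context {g g1 g2 : R -> R} {t0 q kap : R} (HG : growth g g1 g2 t0 q kap).
Context {f : R -> R} {Lv : R} (HF : nonlin f g t0 Lv).
Context {k k1 : R -> R} {K : R} (HW : weight k k1 K).
Context {l : nat -> R} {v m : nat -> R -> R} (HS : forall n, lsol f k (l n) (v n) (m n)).
Local Notation chi := (drop_scale g g1).

(* log of lam r^2 h f'(u) *)
Definition Afun (n : nat) (x : R) : R := l n + 2 * x + k x + g (v n x) + ln (g1 (v n x)).

Lemma m_incr (n : nat) (x y : R) : x <= y -> y < 0 -> m n x <= m n y.
Proof.
  intros Hxy Hy. apply (incr_le0 _ (fun x => exp (l n + 2 * x + k x) * f (v n x))); [auto| |].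
  - intros z Hz. apply (ls_m (HS n)). lra.
  - intros z Hz. apply Rmult_le_pos; [left; apply exp_pos|].
    apply (nl_pos HF), (ls_v0 (HS n)). lra.
Qed.

Lemma v_decr (n : nat) (x y : R) : x <= y -> y < 0 -> v n y <= v n x.
Proof.
  intros Hxy Hy. apply (decr_le _ (fun x => - m n x)); [auto| |].
  - intros z Hz. apply (ls_v (HS n)). lra.
  - intros z Hz. generalize (ls_m0 (HS n) z ltac:(lra)). lra.
Qed.

Lemma K_nonneg : 0 <= K.
Proof. eapply Rle_trans; [apply Rabs_pos|]. apply (wt_b HW (-1)). lra. Qed.

Lemma k_diff (x y : R) : x < 0 -> y < 0 -> k x <= k y + 2 * K.
Proof.
  intros Hx Hy. generalize (wt_b HW x Hx) (wt_b HW y Hy). intros H1 H2.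
  apply Rabs_le_between in H1. apply Rabs_le_between in H2. lra.
Qed.

(** This is how the boundary r = 1 is excluded. A lower bound for [v], proved only on the part of
    [y, z] where the solution lives, already forces [z < 0], as [v] takes values below [c]
    arbitrarily close to x = 0. *)
Lemma inside (n : nat) (y z c : R) :
  0 < c -> y < 0 -> (forall x, y <= x <= z -> x < 0 -> c <= v n x) -> z < 0.
Proof.
  intros Hc Hy H. apply Rnot_le_lt. intros Hz.
  destruct (ls_bd (HS n) c y Hc Hy) as [x [Hx Hv]].
  specialize (H x ltac:(lra) ltac:(lra)). lra.
Qed.

(* Over a bounded logarithmic window to the right of a point with bounded energy, v drops only by
   O(1/g1 v); as v vanishes at r = 1, the window stays inside (0,1). *)
Lemma crude (C T : R) : 0 <= T -> exists C3, forall x : nat -> R,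
  eventually (fun n => x n < 0) -> is_lim_seq (fun n => v n (x n)) p_infty ->
  eventually (fun n => g1 (v n (x n)) * m n (x n) <= C) ->
  eventually (fun n => Afun n (x n) <= C) ->
  eventually (fun n => x n + T < 0 /\ forall y, x n <= y <= x n + T ->
     v n (x n) - C3 / g1 (v n (x n)) <= v n y <= v n (x n) /\
     g1 (v n (x n)) * m n y <= C3).
Proof.
  (* [C2] bounds g'(V) m' on the window: it is the exponential of the bound on [A], increased by the
     possible changes of 2x and of [k]. Integration gives [C4] for g'(V) m, and a second one gives
     the drop. *)
  intros HT. set (C2 := exp (C + 2 * T + 2 * K)). assert (HC2 : 0 < C2) by apply exp_pos.
  set (C4 := Rabs C + C2 * T). assert (HC4 : 0 <= C4).
  { unfold C4. generalize (Rabs_pos C). nra. }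
  set (C3 := Rmax C4 (C4 * T)). exists C3. intros x Hx Hv Hm HA.
  assert (C3a : C4 <= C3) by apply Rmax_l. assert (C3b : C4 * T <= C3) by apply Rmax_r.
  assert (P0 := gr_g1pos HG (Lv) (nl_lev HF)).
  (* The term [C3 / g1 Lv + 1] leaves [v] at least 1 on the window, as [inside] requires. *)
  assert (E := proj1 (lim_inf _) Hv (Rmax Lv (C3 / g1 Lv + 1))).
  ev_use E. ev_use Hx. ev_use Hm. ev_use HA. ev_intros n HA Hm Hx E.
  set (V := v n (x n)) in *.
  assert (EL : Lv <= V) by (generalize (Rmax_l Lv (C3 / g1 Lv + 1)); lra).
  assert (EV : C3 / g1 Lv + 1 <= V) by (generalize (Rmax_r Lv (C3 / g1 Lv + 1)); lra).
  assert (HLv := nl_lev HF).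
  assert (Gm : g1 Lv <= g1 V) by (apply (g1_mono HG); lra).
  assert (Bnd : forall y, x n <= y <= x n + T -> y < 0 ->
     g1 V * m n y <= C4 /\ V - C3 / g1 V <= v n y <= V).
  { intros y Hy Hy0.
    assert (M : forall z, x n <= z <= y -> g1 V * m n z <= C4).
    { intros z Hz.
      assert (I := incr_le (fun z => g1 V * m n z)
        (fun z => g1 V * (exp (l n + 2 * z + k z) * f (v n z))) (x n) z C2 ltac:(lra)).
      cbv beta in I. eapply Rle_trans; [apply I|].
      - intros w Hw. apply (is_derive_scal (m n)). apply (ls_m (HS n)). lra.
      - intros w Hw.
        assert (F1 : f (v n w) <= exp (g V)).
        { apply (nl_le HF); [apply (ls_v0 (HS n)); lra| |auto].
          apply v_decr; lra. }
        apply Rle_trans with (g1 V * (exp (l n + 2 * w + k w) * exp (g V))).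
        + apply Rmult_le_compat_l; [lra|]. apply Rmult_le_compat_l; [left; apply exp_pos|auto].
        + rewrite <- (exp_ln (g1 V)) at 1 by lra. rewrite <- !exp_plus. apply exp_le.
          assert (Kd := k_diff w (x n) ltac:(lra) Hx). unfold Afun in HA. fold V in HA. lra.
      - unfold C4. generalize (Rle_abs C). assert (C2 * (z - x n) <= C2 * T) by (apply Rmult_le_compat_l; lra).
        lra. }
    split; [apply M; lra|]. split; [|apply v_decr; lra].
    assert (I := incr_ge (v n) (fun z => - m n z) (x n) y (- (C4 / g1 V)) ltac:(lra)).
    fold V in I. eapply Rle_trans; [|apply I].
    - assert (C4 / g1 V * (y - x n) <= C3 / g1 V); [|lra].
      unfold Rdiv. rewrite Rmult_assoc, (Rmult_comm (/ _)), <- Rmult_assoc.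
      apply Rmult_le_compat_r; [left; apply Rinv_0_lt_compat; lra|].
      eapply Rle_trans; [|exact C3b]. apply Rmult_le_compat_l; lra.
    - intros z Hz. apply (ls_v (HS n)). lra.
    - intros z Hz. apply Ropp_le_contravar. apply Rmult_le_reg_l with (g1 V); [lra|].
      replace (g1 V * (C4 / g1 V)) with C4 by (field; lra). apply M; lra. }
  assert (C3 / g1 V <= C3 / g1 Lv).
  { apply Rmult_le_compat_l; [lra|]. apply Rinv_le_contravar; lra. }
  assert (IN : x n + T < 0).
  { apply inside with n (x n) 1; [lra|lra|]. intros y Hy Hy0.
    destruct (Bnd y Hy Hy0) as [_ [B _]]. lra. }
  split; [auto|]. intros y Hy. destruct (Bnd y Hy ltac:(lra)) as [B1 B2].
  split; [auto|lra].
Qed.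

(** A window of length |M| starting at [x n] still fits inside the ball, so [x n < - |M|]; [M] is
    arbitrary. This is why concentration radii shrink to 0. *)
Lemma crude_minf (C : R) (x : nat -> R) :
  eventually (fun n => x n < 0) -> is_lim_seq (fun n => v n (x n)) p_infty ->
  eventually (fun n => g1 (v n (x n)) * m n (x n) <= C) ->
  eventually (fun n => Afun n (x n) <= C) -> is_lim_seq x m_infty.
Proof.
  intros Hx Hv Hm HA. apply lim_minf. intros M.
  destruct (crude C (Rabs M) (Rabs_pos M)) as [C3 H]. specialize (H x Hx Hv Hm HA).
  ev_use H. ev_intros n [Hn _]. generalize (Rle_abs (- M)). rewrite Rabs_Ropp. lra.
Qed.

End System.

(** * From one bubble to the next *)

Section Transition.
Context {g g1 g2 : R -> R} {t0 q kap : R} (HG : growth g g1 g2 t0 q kap).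
Context {f : R -> R} {Lv : R} (HF : nonlin f g t0 Lv).
Context {k k1 : R -> R} {K : R} (HW : weight k k1 K).
Context {l : nat -> R} {v m : nat -> R -> R} (HS : forall n, lsol f k (l n) (v n) (m n)).
Local Notation chi := (drop_scale g g1).
Local Notation A := (@Afun g g1 k l v).

Lemma g_pos_ev (V : nat -> R) (M : R) : is_lim_seq V p_infty ->
  eventually (fun n => M < g (V n) /\ Lv < V n /\ t0 < V n /\ 0 < g1 (V n)).
Proof.
  intros HV. assert (E1 := proj1 (lim_inf _) (lim_g HG _ HV) M).
  assert (E2 := proj1 (lim_inf _) HV Lv). ev_use E1. ev_use E2. ev_intros n H1 H2.
  assert (t0 < V n) by (generalize (nl_lev HF); lra).
  repeat split; auto. now apply (gr_g1pos HG).
Qed.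

(* The times at which the tangent-line exponent returns to its initial value. *)
Lemma return_times (Y s : R) (V y : nat -> R) :
  2 < Y -> 0 < s -> kap * s < 1 -> 2 / Y * s - 1 + Ef kap s = 0 ->
  is_lim_seq V p_infty -> is_lim_seq y Y ->
  exists x : nat -> R, is_lim_seq x s /\
    eventually (fun n => 2 / y n * x n - 1 + g (V n - x n * chi (V n)) / g (V n) = 0).
Proof.
  intros HY Hs Hks Hz HV Hy. assert (Hk := kap_range HG).
  (* Keeps [s - d] positive and [kap * (s + d)] below 1, hence inside the range of the profile. *)
  set (d := Rmin (s / 2) ((1 - kap * s) / 2)).
  assert (Hd : 0 < d /\ d <= s / 2 /\ d <= (1 - kap * s) / 2).
  { unfold d. split; [apply Rmin_glb_lt; lra|]. split; [apply Rmin_l|apply Rmin_r]. }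
  assert (Lim : forall z, kap * z < 1 ->
    is_lim_seq (fun n => 2 / y n * z - 1 + g (V n - z * chi (V n)) / g (V n)) (2 / Y * z - 1 + Ef kap z)).
  { intros z Hkz. destruct (slow_variation HG V (fun _ => z) z HV (is_lim_seq_const z) Hkz) as [_ [Q _]].
    apply is_lim_seq_plus'; [|exact Q]. apply is_lim_seq_minus'; [|apply is_lim_seq_const].
    apply is_lim_seq_mult'; [|apply is_lim_seq_const].
    apply is_lim_seq_div'; [apply is_lim_seq_const|auto|lra]. }
  (* The limit function changes sign strictly at [s], so each tolerance admits an exact root for
     large [n]. Exactness matters because the equation is later multiplied by [g (V n)]; convergence
     of the roots to [s] comes from the diagonal choice of [j]. *)
  assert (Ev : forall j, eventually (fun n => exists x, Rabs (x - s) <= d / INR (S j) /\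
     2 / y n * x - 1 + g (V n - x * chi (V n)) / g (V n) = 0)).
  { intros j. set (e := d / INR (S j)).
    assert (He : 0 < e <= d).
    { assert (1 <= INR (S j)) by (apply (le_INR 1); lia). unfold e. split.
      - apply Rdiv_lt_0_compat; lra.
      - apply Rmult_le_reg_r with (INR (S j)); [lra|]. unfold Rdiv.
        rewrite Rmult_assoc, Rinv_l by lra. nra. }
    assert (L1 := Lim (s - e) ltac:(nra)). assert (L2 := Lim (s + e) ltac:(nra)).
    apply lim_lt with (c := 0) in L1; [|apply Ffun_neg with (s := s); auto; lra].
    apply lim_gt with (c := 0) in L2; [|apply Ffun_pos with (s := s); auto; nra].
    assert (E1 := g_pos_ev V 1 HV).
    assert (Low := drop_infty HG V (fun _ => s + e) (s + e) HV (is_lim_seq_const _) ltac:(nra)).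
    assert (E2 := proj1 (lim_inf _) Low t0).
    apply lim_gt with (c := 1) in Hy; [|lra].
    ev_use L1. ev_use L2. ev_use E1. ev_use E2. ev_use Hy. ev_intros n Hy E2 [E1 [E3 [E4 E5]]] L2 L1.
    assert (Hc : 0 < chi (V n)) by (apply Rdiv_lt_0_compat; lra).
    destruct (ivt (fun z => 2 / y n * z - 1 + g (V n - z * chi (V n)) / g (V n))
       (fun z => 2 / y n + (- chi (V n)) * g1 (V n - z * chi (V n)) / g (V n)) (s - e) (s + e) 0) as [x [Hx E]].
    - lra.
    - intros z Hzz. 
      assert (t0 < V n - z * chi (V n)).
      { assert (z * chi (V n) <= (s + e) * chi (V n)) by (apply Rmult_le_compat_r; lra). lra. }
      evar_last.
      + apply (is_derive_plus (fun z => 2 / y n * z - 1) (fun z => g (V n - z * chi (V n)) / g (V n))).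
        * instantiate (1 := 2 / y n). auto_derive; [auto|ring].
        * apply (is_derive_scal_l (fun z => g (V n - z * chi (V n))) z (- chi (V n) * g1 (V n - z * chi (V n))) (/ g (V n))).
          apply (is_derive_comp g (fun z => V n - z * chi (V n))).
          { apply (gr_g HG). auto. }
          auto_derive; [auto|ring].
      + unfold plus, scal; simpl; unfold mult; simpl. unfold Rdiv. ring.
    - lra.
    - exists x. split; [|exact E]. apply Rabs_le_between. lra. }
  destruct (ev_diag _ Ev) as [J [HJ1 HJ2]].
  destruct (ev_choice _ HJ2) as [x Hx]. exists x. split.
  - apply lim_eps. intros eps He.
    destruct (nfloor_ex (d / eps)) as [M [_ HM]]. { left. apply Rdiv_lt_0_compat; lra. }
    specialize (HJ1 M). ev_use HJ1. ev_use Hx. ev_intros n [Hx _] HJ.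
    eapply Rle_trans; [exact Hx|].
    assert (INR M <= INR (J n)) by now apply le_INR. rewrite S_INR.
    assert (0 <= INR M) by apply pos_INR.
    apply Rmult_le_reg_r with (INR (J n) + 1); [lra|]. unfold Rdiv.
    rewrite Rmult_assoc, Rinv_l, Rmult_1_r by lra.
    assert (d / eps * eps <= (INR (J n) + 1) * eps) by (apply Rmult_le_compat_r; lra).
    replace (d / eps * eps) with d in H1 by (field; lra). lra.
  - ev_use Hx. apply ev_all. tauto.
Qed.

(** Crossing a neck. Since m increases, v stays below the tangent line [ell], and g'(V) m' is at
    most [B n] times exp (X), with X the exponent along [ell]. X is convex, vanishes at both ends
    and is of size -g(V) in the middle, so exp (X) has an integral bounded independently of the
    length of the neck, while [B n] tends to 0. *)
Lemma transition (Y s : R) (x0 : nat -> R) :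
  2 < Y -> 0 < s -> kap * s < 1 -> 2 / Y * s - 1 + Ef kap s = 0 ->
  eventually (fun n => x0 n < 0) ->
  is_lim_seq (fun n => v n (x0 n)) p_infty ->
  is_lim_seq (fun n => g1 (v n (x0 n)) * m n (x0 n)) Y ->
  is_lim_seq (fun n => A n (x0 n)) m_infty ->
  is_lim_seq (fun n => A n (x0 n) / g (v n (x0 n))) 0 ->
  exists x1 : nat -> R,
    eventually (fun n => x1 n < 0) /\
    is_lim_seq (fun n => (v n (x0 n) - v n (x1 n)) / chi (v n (x0 n))) s /\
    is_lim_seq (fun n => g1 (v n (x1 n)) * m n (x1 n)) (Y * ef kap s) /\
    is_lim_seq (fun n => A n (x1 n)) m_infty /\
    is_lim_seq (fun n => A n (x1 n) / g (v n (x1 n))) 0.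
Proof.
  intros HY Hs Hks Hz Hx0 HV Hy HA HAg. assert (Hk := kap_range HG).
  set (V := fun n => v n (x0 n)) in *. set (y := fun n => g1 (V n) * m n (x0 n)).
  fold V in HV. change (is_lim_seq y Y) in Hy.
  destruct (return_times Y s V y HY Hs Hks Hz HV Hy) as [s1 [Hs1 Hret]].
  (* Half the depth of the limit exponent at the midpoint, so that the actual exponent is below
     [- c * g (V n)] there for large [n]. *)
  set (c := - (2 / Y * (s / 2) - 1 + Ef kap (s / 2)) / 2).
  assert (Hc : 0 < c).
  { unfold c. assert (Q := Ffun_neg kap Y s Hk Hks Hz (s / 2) ltac:(lra)). lra. }
  (* A decay rate free of [n]: the exponent changes by at least [c * g (V n)] over a length at most
     [s * g (V n) / y n], with [y n > 2]. *)
  set (al := c / s). assert (Hal : 0 < al) by (apply Rdiv_lt_0_compat; lra).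
  set (B := fun n => exp (A n (x0 n) + 2 * K)).
  assert (HB : is_lim_seq B 0).
  { apply lim_exp_minf. apply lim_minf. intros M. assert (E := proj1 (lim_minf _) HA (M - 2 * K)).
    ev_use E. ev_intros ?; lra. }
  (* The drop, in units of [chi (V n)], that would result if m had its upper bound along the whole
     neck; the true drop lies between [s1] and [s2]. *)
  set (s2 := fun n => s1 n * (1 + 2 * B n / (al * y n))).
  assert (Hs2 : is_lim_seq s2 s).
  { replace s with (s * (1 + 2 * 0 / (al * Y))) by (field; lra).
    apply is_lim_seq_mult'; [auto|]. apply is_lim_seq_plus'; [apply is_lim_seq_const|].
    apply is_lim_seq_div'.
    - apply is_lim_seq_mult'; [apply is_lim_seq_const|auto].
    - apply is_lim_seq_mult'; [apply is_lim_seq_const|auto].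
    - assert (0 < al * Y) by (apply Rmult_lt_0_compat; lra). lra. }
  assert (Low := drop_infty HG V s2 s HV Hs2 Hks).
  (* The time at which the tangent line, of slope [- y n / g1 (V n)], has dropped by
     [s1 n * chi (V n)]. *)
  set (x1 := fun n => x0 n + s1 n * g (V n) / y n).
  assert (Main : eventually (fun n => x0 n <= x1 n /\ x1 n < 0 /\ 0 < g1 (V n) /\
     t0 < v n (x1 n) /\
     V n - s2 n * chi (V n) <= v n (x1 n) <= V n - s1 n * chi (V n) /\
     y n <= g1 (V n) * m n (x1 n) <= y n + 2 * B n / al)).
  { assert (Mid : is_lim_seq (fun n => 2 / y n * (s / 2) - 1 + g (V n - s / 2 * chi (V n)) / g (V n))
        (2 / Y * (s / 2) - 1 + Ef kap (s / 2))).
    { destruct (slow_variation HG V (fun _ => s / 2) (s / 2) HV (is_lim_seq_const _) ltac:(nra)) as [_ [Q _]].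
      apply is_lim_seq_plus'; [|exact Q]. apply is_lim_seq_minus'; [|apply is_lim_seq_const].
      apply is_lim_seq_mult'; [|apply is_lim_seq_const].
      apply is_lim_seq_div'; [apply is_lim_seq_const|auto|lra]. }
    apply lim_lt with (c := - c) in Mid; [|unfold c in *; lra].
    assert (E1 := g_pos_ev V 1 HV).
    assert (E2 := proj1 (lim_inf _) Low (Rmax Lv 1)).
    assert (E3 := lim_gt _ _ (s / 2) Hs1 ltac:(lra)).
    assert (E4 := lim_lt _ _ (3 / 2 * s) Hs1 ltac:(lra)).
    assert (E5 := lim_gt _ _ 2 Hy HY).
    ev_use Mid. ev_use E1. ev_use E2. ev_use E3. ev_use E4. ev_use E5. ev_use Hret. ev_use Hx0.
    ev_intros n Hx0 Hret E5 E4 E3 E2 [E1 [E1a [E1b E1c]]] Mid.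
    cbv beta in *.
    assert (Gc : chi (V n) = g (V n) / g1 (V n)) by reflexivity.
    set (G := g (V n)) in *. set (G1 := g1 (V n)) in *.
    assert (HBn : 0 < B n) by apply exp_pos.
    set (m0 := m n (x0 n)) in *. assert (Em : m0 = y n / G1) by (unfold y, G1, m0; field; fold G1; lra).
    assert (Hm0 : 0 < m0). { rewrite Em. apply Rdiv_lt_0_compat; lra. }
    set (ell := fun x => V n - m0 * (x - x0 n)).
    assert (ell1 : ell (x1 n) = V n - s1 n * chi (V n)).
    { unfold ell, x1. rewrite Em, Gc. fold G. field. split; lra. }
    assert (Hx01 : x0 n < x1 n).
    { unfold x1. fold G. assert (0 < s1 n * G / y n); [|lra].
      apply Rdiv_lt_0_compat; [|lra]. apply Rmult_lt_0_compat; lra. }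
    assert (Hc0 : 0 < chi (V n)) by (rewrite Gc; apply Rdiv_lt_0_compat; lra).
    assert (Hs12 : s1 n * chi (V n) <= s2 n * chi (V n)).
    { apply Rmult_le_compat_r; [lra|]. unfold s2.
      assert (0 < 2 * B n / (al * y n)). { apply Rdiv_lt_0_compat; [lra|]. apply Rmult_lt_0_compat; lra. }
      nra. }
    assert (ellL : forall x, x0 n <= x <= x1 n -> Rmax Lv 1 <= ell x).
    { intros x Hx. assert (ell (x1 n) <= ell x).
      { unfold ell. assert (m0 * (x - x0 n) <= m0 * (x1 n - x0 n)) by (apply Rmult_le_compat_l; lra). lra. }
      lra. }
    assert (RL := Rmax_l Lv 1). assert (RR := Rmax_r Lv 1). assert (HLv := nl_lev HF).
    set (X := fun x => 2 * (x - x0 n) + g (ell x) - G).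
    set (X1 := fun x => 2 - m0 * g1 (ell x)).
    assert (XD : forall x, x0 n <= x <= x1 n -> is_derive X x (X1 x)).
    { intros x Hx. specialize (ellL x Hx). unfold X, X1. evar_last.
      - apply (is_derive_minus (fun x => 2 * (x - x0 n) + g (ell x)) (fun _ => G)); [|apply is_derive_const].
        apply (is_derive_plus (fun x => 2 * (x - x0 n)) (fun x => g (ell x))).
        + instantiate (1 := 2). auto_derive; [auto|ring].
        + apply (is_derive_comp g ell).
          * apply (gr_g HG). lra.
          * unfold ell. instantiate (1 := - m0). auto_derive; [auto|ring].
      - unfold minus, plus, opp, scal, zero; simpl; unfold mult; simpl. ring. }
    assert (XM : forall z w, x0 n <= z -> z <= w -> w <= x1 n -> X1 z <= X1 w).
    { intros z w Hz1 Hzw Hw. unfold X1.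
      assert (g1 (ell w) <= g1 (ell z)).
      { apply (g1_mono HG). - specialize (ellL w ltac:(lra)). lra.
        - unfold ell. assert (m0 * (z - x0 n) <= m0 * (w - x0 n)) by (apply Rmult_le_compat_l; lra). lra. }
      assert (m0 * g1 (ell w) <= m0 * g1 (ell z)) by (apply Rmult_le_compat_l; lra). lra. }
    assert (X0 : X (x0 n) = 0).
    { unfold X, ell. replace (V n - m0 * (x0 n - x0 n)) with (V n) by ring. fold G. ring. }
    assert (XE : X (x1 n) = 0).
    { unfold X. rewrite ell1. replace (x1 n - x0 n) with (s1 n * G / y n) by (unfold x1; fold G; ring).
      replace (2 * (s1 n * G / y n) + g (V n - s1 n * chi (V n)) - G) with
        (G * (2 / y n * s1 n - 1 + g (V n - s1 n * chi (V n)) / G)) by (field; lra).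
      rewrite Hret. ring. }
    set (xm := x0 n + s / 2 * G / y n).
    assert (Hxm : x0 n < xm < x1 n).
    { unfold xm, x1. fold G. split.
      - assert (0 < s / 2 * G / y n); [|lra]. apply Rdiv_lt_0_compat; [|lra]. apply Rmult_lt_0_compat; lra.
      - apply Rplus_lt_compat_l. apply Rmult_lt_compat_r; [apply Rinv_0_lt_compat; lra|].
        apply Rmult_lt_compat_r; lra. }
    assert (XMid : X xm <= - c * G).
    { unfold X. replace (ell xm) with (V n - s / 2 * chi (V n)).
      2:{ unfold ell, xm. rewrite Em, Gc. fold G. field. split; lra. }
      replace (xm - x0 n) with (s / 2 * G / y n) by (unfold xm; ring).
      replace (2 * (s / 2 * G / y n) + g (V n - s / 2 * chi (V n)) - G) with
        (G * (2 / y n * (s / 2) - 1 + g (V n - s / 2 * chi (V n)) / G)) by (field; lra).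
      assert (G * (2 / y n * (s / 2) - 1 + g (V n - s / 2 * chi (V n)) / G) <= G * (- c)); [|lra].
      apply Rmult_le_compat_l; lra. }
    assert (cG : 0 < c * G) by (apply Rmult_lt_0_compat; lra).
    assert (Quot : forall d, 0 < d <= s * G / y n -> al * 2 <= c * G / d).
    { intros d Hd. apply Rmult_le_reg_r with d; [lra|].
      replace (c * G / d * d) with (c * G) by (field; lra).
      apply Rle_trans with (al * 2 * (s * G / y n)).
      - apply Rmult_le_compat_l; lra.
      - unfold al. replace (c / s * 2 * (s * G / y n)) with (c * G * (2 / y n)) by (field; lra).
        rewrite <- (Rmult_1_r (c * G)) at 2. apply Rmult_le_compat_l; [lra|].
        apply Rmult_le_reg_r with (y n); [lra|]. replace (2 / y n * y n) with 2 by (field; lra). lra. }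
    (* The chord bound on each half of the neck; the sum of the two exponentials covers both
       halves. *)
    assert (XB : forall x, x0 n <= x <= x1 n -> exp (X x) <= exp (- al * (x - x0 n)) + exp (- al * (x1 n - x))).
    { intros x Hx. destruct (Rle_dec x xm) as [Hm|Hm].
      - assert (CC := convex_chord X X1 (x0 n) xm x ltac:(lra) ltac:(lra)
          ltac:(intros; apply XD; lra) ltac:(intros; apply XM; lra)).
        rewrite X0 in CC.
        assert (Q := Quot (xm - x0 n)). assert (Hd : xm - x0 n = s / 2 * G / y n) by (unfold xm; ring).
        assert (0 < s * G / y n). { apply Rdiv_lt_0_compat; [|lra]. apply Rmult_lt_0_compat; lra. }
        assert (s / 2 * G / y n = s * G / y n / 2) by (field; lra).
        specialize (Q ltac:(lra)).
        assert (X x <= - al * (x - x0 n)).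
        { eapply Rle_trans; [exact CC|].
          apply Rle_trans with (- (c * G) * ((x - x0 n) / (xm - x0 n))).
          - rewrite Rminus_0_r, Rplus_0_l. apply Rmult_le_compat_r; [|lra].
            apply Rmult_le_pos; [lra|left; apply Rinv_0_lt_compat; lra].
          - replace (- (c * G) * ((x - x0 n) / (xm - x0 n))) with (- (c * G / (xm - x0 n)) * (x - x0 n)) by (field; lra).
            apply Rmult_le_compat_r; lra. }
        apply exp_le in H1. generalize (exp_pos (- al * (x1 n - x))). lra.
      - assert (CC := convex_chord X X1 xm (x1 n) x ltac:(lra) ltac:(lra)
          ltac:(intros; apply XD; lra) ltac:(intros; apply XM; lra)).
        rewrite XE in CC.
        assert (Q := Quot (x1 n - xm)).
        assert (Hd : x1 n - xm = (s1 n - s / 2) * G / y n) by (unfold x1, xm; fold G; field; lra).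
        assert ((s1 n - s / 2) * G / y n <= s * G / y n).
        { apply Rmult_le_compat_r; [left; apply Rinv_0_lt_compat; lra|]. apply Rmult_le_compat_r; lra. }
        specialize (Q ltac:(lra)).
        assert (X x <= - al * (x1 n - x)).
        { eapply Rle_trans; [exact CC|].
          replace (X xm + (0 - X xm) * ((x - xm) / (x1 n - xm))) with (X xm * ((x1 n - x) / (x1 n - xm))) by (field; lra).
          apply Rle_trans with (- c * G * ((x1 n - x) / (x1 n - xm))).
          - apply Rmult_le_compat_r; [|lra].
            apply Rmult_le_pos; [lra|left; apply Rinv_0_lt_compat; lra].
          - replace (- c * G * ((x1 n - x) / (x1 n - xm))) with (- (c * G / (x1 n - xm)) * (x1 n - x)) by (field; lra).
            apply Rmult_le_compat_r; lra. }
        apply exp_le in H0. generalize (exp_pos (- al * (x - x0 n))). lra. }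
    assert (vl : forall x, x0 n <= x <= x1 n -> x < 0 -> v n x <= ell x).
    { intros x Hx Hxn. assert (I := incr_le (v n) (fun z => - m n z) (x0 n) x (- m0) ltac:(lra)).
      fold (V n) in I. eapply Rle_trans; [apply I|unfold ell; lra].
      - intros z Hzz. apply (ls_v (HS n)). lra.
      - intros z Hzz. apply Ropp_le_contravar. apply (m_incr HF HS); lra. }
    (* Instead of integrating, an explicit antiderivative of the majorant is subtracted and the
       difference shown to decrease. Its total variation gives the term [2 * B n / al]. *)
    assert (mb : forall x, x0 n <= x <= x1 n -> x < 0 -> G1 * m n x <= y n + 2 * B n / al).
    { intros x Hx Hxn.
      assert (D := decr_le (fun z => G1 * m n z - B n / al * (- exp (- al * (z - x0 n)) + exp (- al * (x1 n - z))))
        (fun z => G1 * (exp (l n + 2 * z + k z) * f (v n z)) -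
           B n / al * (al * exp (- al * (z - x0 n)) + al * exp (- al * (x1 n - z)))) (x0 n) x ltac:(lra)).
      cbv beta in D.
      assert (D' : G1 * m n x - B n / al * (- exp (- al * (x - x0 n)) + exp (- al * (x1 n - x))) <=
        G1 * m n (x0 n) - B n / al * (- exp (- al * (x0 n - x0 n)) + exp (- al * (x1 n - x0 n)))).
      { apply D.
        - intros z Hzz. apply (is_derive_minus (fun z => G1 * m n z)).
          + apply (is_derive_scal (m n)). apply (ls_m (HS n)). lra.
          + auto_derive; [auto|unfold Rminus; ring].
        - intros z Hzz. specialize (ellL z ltac:(lra)).
          assert (F1 : f (v n z) <= exp (g (ell z))).
          { apply (nl_le HF); [apply (ls_v0 (HS n)); lra|apply vl; lra|lra]. }
          assert (F2 : G1 * (exp (l n + 2 * z + k z) * f (v n z)) <= B n * exp (X z)).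
          { apply Rle_trans with (G1 * (exp (l n + 2 * z + k z) * exp (g (ell z)))).
            - apply Rmult_le_compat_l; [lra|]. apply Rmult_le_compat_l; [left; apply exp_pos|auto].
            - rewrite <- (exp_ln G1) at 1 by lra. unfold B. rewrite <- !exp_plus. apply exp_le.
              assert (Kd := k_diff HW z (x0 n) ltac:(lra) Hx0).
              unfold Afun, X. fold (V n). fold G G1. lra. }
          specialize (XB z ltac:(lra)).
          assert (B n * exp (X z) <= B n * (exp (- al * (z - x0 n)) + exp (- al * (x1 n - z))))
            by (apply Rmult_le_compat_l; lra).
          replace (B n / al * (al * exp (- al * (z - x0 n)) + al * exp (- al * (x1 n - z)))) with
            (B n * (exp (- al * (z - x0 n)) + exp (- al * (x1 n - z)))) by (field; lra).
          lra. }
      fold m0 in D'. replace (G1 * m0) with (y n) in D' by (rewrite Em; field; lra).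
      assert (Q1 : exp (- al * (x1 n - x)) <= 1). { rewrite <- exp_0. apply exp_le. nra. }
      assert (Q2 := exp_pos (- al * (x1 n - x0 n))). assert (Q3 := exp_pos (- al * (x - x0 n))).
      replace (- al * (x0 n - x0 n)) with 0 in D' by ring. rewrite exp_0 in D'.
      assert (Ba : 0 < B n / al) by (apply Rdiv_lt_0_compat; lra).
      replace (2 * B n / al) with (B n / al * 2) by (field; lra).
      assert (B n / al * (- exp (- al * (x - x0 n)) + exp (- al * (x1 n - x)) + 1 - exp (- al * (x1 n - x0 n)))
        <= B n / al * 2) by (apply Rmult_le_compat_l; lra).
      lra. }
    assert (vlow : forall x, x0 n <= x <= x1 n -> x < 0 -> V n - s2 n * chi (V n) <= v n x).
    { intros x Hx Hxn.
      set (M := (y n + 2 * B n / al) / G1).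
      assert (HM : 0 < M). { unfold M. apply Rdiv_lt_0_compat; [|lra].
        assert (0 < 2 * B n / al) by (apply Rdiv_lt_0_compat; lra). lra. }
      assert (I := incr_ge (v n) (fun z => - m n z) (x0 n) x (- M) ltac:(lra)).
      fold (V n) in I. eapply Rle_trans; [|apply I].
      - assert (M * (x - x0 n) <= M * (x1 n - x0 n)) by (apply Rmult_le_compat_l; lra).
        assert (s2 n * chi (V n) = M * (x1 n - x0 n)).
        { unfold s2, M, x1. rewrite Gc. fold G. field. repeat split; lra. }
        lra.
      - intros z Hzz. apply (ls_v (HS n)). lra.
      - intros z Hzz. apply Ropp_le_contravar. unfold M. apply Rmult_le_reg_l with G1; [lra|].
        replace (G1 * ((y n + 2 * B n / al) / G1)) with (y n + 2 * B n / al) by (field; lra).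
        apply mb; lra. }
    assert (IN : x1 n < 0).
    { apply (inside HS n (x0 n) (x1 n) 1); [lra|lra|]. intros x Hx Hxn.
      specialize (vlow x Hx Hxn). lra. }
    assert (VL := vlow (x1 n) ltac:(lra) IN).
    repeat split; try lra.
    - rewrite <- ell1. apply vl; lra.
    - replace (y n) with (G1 * m0) by (rewrite Em; field; lra).
      apply Rmult_le_compat_l; [lra|]. apply (m_incr HF HS); lra.
    - apply mb; lra. }
  set (s3 := fun n => (V n - v n (x1 n)) / chi (V n)).
  assert (Cpos := g_pos_ev V 1 HV).
  assert (Hs3 : is_lim_seq s3 s).
  { apply is_lim_seq_le_le_loc with s1 s2; auto.
    ev_keep Main. ev_keep Cpos. ev_intros n [P1 [P2 [P3 P4]]] [_ [_ [Q1 [_ [Q2 _]]]]].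
    assert (Hc0 : 0 < chi (V n)) by (apply Rdiv_lt_0_compat; lra). unfold s3. split.
    - apply Rmult_le_reg_r with (chi (V n)); [auto|].
      replace ((V n - v n (x1 n)) / chi (V n) * chi (V n)) with (V n - v n (x1 n)) by (field; lra). lra.
    - apply Rmult_le_reg_r with (chi (V n)); [auto|].
      replace ((V n - v n (x1 n)) / chi (V n) * chi (V n)) with (V n - v n (x1 n)) by (field; lra). lra. }
  destruct (slow_variation HG V s3 s HV Hs3 Hks) as [_ [SV1 SV2]].
  destruct (slow_variation HG V s1 s HV Hs1 Hks) as [_ [SW1 _]].
  assert (Eq : eventually (fun n => V n - s3 n * chi (V n) = v n (x1 n))).
  { ev_keep Cpos. ev_intros n [P1 [P2 [P3 P4]]].
    assert (Hc0 : 0 < chi (V n)) by (apply Rdiv_lt_0_compat; lra). unfold s3. field. lra. }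
  assert (R1 : is_lim_seq (fun n => g (v n (x1 n)) / g (V n)) (Ef kap s)).
  { apply lim_ext_ev with (1 := SV1). ev_keep Eq. ev_intros n ->. reflexivity. }
  assert (R2 : is_lim_seq (fun n => g1 (v n (x1 n)) / g1 (V n)) (ef kap s)).
  { apply lim_ext_ev with (1 := SV2). ev_keep Eq. ev_intros n ->. reflexivity. }
  assert (efp := ef_pos kap s Hks).
  assert (Lln := lim_ln _ _ efp R2).
  (* The exact root replaces 2 (x1 - x0) by g(V) - g(line at x1). What remains besides bounded terms
     is g(v) - g(line): nonpositive, because v is below the line, and o(g), because both quotients
     by g(V) tend to [Ef kap s]. *)
  assert (EA : eventually (fun n => A n (x1 n) = A n (x0 n) + (k (x1 n) - k (x0 n)) +
     g (V n) * (g (v n (x1 n)) / g (V n) - g (V n - s1 n * chi (V n)) / g (V n)) + ln (g1 (v n (x1 n)) / g1 (V n)))).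
  { assert (E5 := lim_gt _ _ 2 Hy HY).
    ev_use E5. ev_use Hret. ev_keep Cpos. ev_keep Main. ev_intros n [Q0 [Q1 [Q2 [Q3 [Q4 Q5]]]]] [P1 [P2 [P3 P4]]] Hret E5.
    unfold Afun. fold (V n). rewrite ln_div; [|apply (gr_g1pos HG); auto|auto].
    replace (g (V n) * (g (v n (x1 n)) / g (V n) - g (V n - s1 n * chi (V n)) / g (V n)))
     with (g (v n (x1 n)) - g (V n) * (g (V n - s1 n * chi (V n)) / g (V n))) by (field; lra).
    replace (g (V n - s1 n * chi (V n)) / g (V n)) with (1 - 2 / y n * s1 n) by lra.
    replace (2 * x1 n) with (2 * x0 n + 2 / y n * s1 n * g (V n)) by (unfold x1; field; lra). ring. }
  assert (Kb : eventually (fun n => Rabs (k (x1 n) - k (x0 n)) <= 2 * K)).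
  { ev_keep Main. ev_use Hx0. ev_intros n Hx0 [Q0 [Q1 _]].
    assert (D1 := k_diff HW (x1 n) (x0 n) Q1 Hx0). assert (D2 := k_diff HW (x0 n) (x1 n) Hx0 Q1).
    apply Rabs_le_between. lra. }
  assert (Hg := lim_g HG V HV).
  assert (Bd : forall w : nat -> R, (exists C, eventually (fun n => Rabs (w n) <= C)) ->
     is_lim_seq (fun n => w n / g (V n)) 0).
  { intros w [C Hw]. apply lim_squeeze0 with (fun n => C / g (V n)).
    - apply lim_div_inf with C; [apply is_lim_seq_const|auto].
    - ev_use Hw. ev_keep Cpos. ev_intros n [P1 _] Hw.
      rewrite Rminus_0_r. unfold Rdiv. rewrite Rabs_mult, (Rabs_pos_eq (/ _)) by (left; apply Rinv_0_lt_compat; lra).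
      apply Rmult_le_compat_r; [left; apply Rinv_0_lt_compat; lra|auto]. }
  exists x1. split; [|split; [|split; [|split]]].
  - ev_keep Main. apply ev_all. tauto.
  - exact Hs3.
  - rewrite Rmult_comm.
    apply lim_ext_ev with (fun n => g1 (v n (x1 n)) / g1 (V n) * (g1 (V n) * m n (x1 n))).
    + apply is_lim_seq_mult'; [auto|].
      apply is_lim_seq_le_le_loc with y (fun n => y n + 2 * B n / al); auto.
      * ev_keep Main. apply ev_all. tauto.
      * replace Y with (Y + 2 * 0 / al) at 1 by (field; lra).
        apply is_lim_seq_plus'; [auto|]. apply is_lim_seq_div'; [|apply is_lim_seq_const|lra].
        apply is_lim_seq_mult'; [apply is_lim_seq_const|auto].
    + ev_keep Cpos. ev_intros n [P1 [P2 [P3 P4]]]. field. lra.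
  - apply lim_minf. intros M.
    assert (E := proj1 (lim_minf _) HA (M - 2 * K - ln (ef kap s) - 1)).
    assert (E' := lim_lt _ _ (ln (ef kap s) + 1) Lln ltac:(lra)).
    ev_use E. ev_use E'. ev_use EA. ev_use Kb. ev_keep Main. ev_keep Cpos. ev_intros n [P1 [P2 [P3 P4]]] [Q0 [Q1 [Q2 [Q3 [Q4 Q5]]]]] Kb EA E' E.
    rewrite EA. apply Rabs_le_between in Kb.
    assert (g (v n (x1 n)) <= g (V n - s1 n * chi (V n))) by (apply (g_mono HG); lra).
    replace (g (V n) * (g (v n (x1 n)) / g (V n) - g (V n - s1 n * chi (V n)) / g (V n)))
      with (g (v n (x1 n)) - g (V n - s1 n * chi (V n))) by (field; lra).
    lra.
  - assert (Z : is_lim_seq (fun n => A n (x1 n) / g (V n)) 0).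
    { apply lim_ext_ev with (fun n => A n (x0 n) / g (V n) + (k (x1 n) - k (x0 n)) / g (V n) +
        (g (v n (x1 n)) / g (V n) - g (V n - s1 n * chi (V n)) / g (V n)) + ln (g1 (v n (x1 n)) / g1 (V n)) / g (V n)).
      - replace (Finite 0) with (Finite (0 + 0 + (Ef kap s - Ef kap s) + 0)) by (f_equal; ring).
        apply is_lim_seq_plus'; [apply is_lim_seq_plus'; [apply is_lim_seq_plus'|apply is_lim_seq_minus']|]; auto.
        + apply Bd. now exists (2 * K).
        + apply lim_div_inf with (ln (ef kap s)); auto.
      - ev_use EA. ev_keep Cpos. ev_intros n [P1 [P2 [P3 P4]]] ->. field. lra. }
    apply lim_ext_ev with (fun n => A n (x1 n) / g (V n) / (g (v n (x1 n)) / g (V n))).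
    + replace 0 with (0 / Ef kap s) by (field; apply Rgt_not_eq, Ef_pos).
      apply is_lim_seq_div'; auto. apply Rgt_not_eq, Ef_pos.
    + assert (R1' := lim_gt _ _ 0 R1 (Ef_pos _ _)). ev_use R1'.
      ev_keep Cpos. ev_intros n [P1 [P2 [P3 P4]]] Q.
      assert (g (v n (x1 n)) <> 0). { intros E. rewrite E in Q. unfold Rdiv in Q. lra. }
      field. split; lra.
Qed.

End Transition.

(** * Entering the next bubble *)

Section Entry.
Context {g g1 g2 : R -> R} {t0 q kap : R} (HG : growth g g1 g2 t0 q kap).
Context {f : R -> R} {Lv : R} (HF : nonlin f g t0 Lv).
Context {k k1 : R -> R} {K : R} (HW : weight k k1 K).
Context {l : nat -> R} {v m : nat -> R -> R} (HS : forall n, lsol f k (l n) (v n) (m n)).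
Local Notation chi := (drop_scale g g1).
Local Notation A := (@Afun g g1 k l v).

(* With G = g1 (v x1) frozen, y = G m and om = log (y') satisfy om' = 2 - y + o(1), so that
   (y - 2)^2 / 2 + exp om is conserved up to o(1), however long the window is. *)
Lemma entry (a : R) (x1 : nat -> R) :
  0 < a < 2 ->
  eventually (fun n => x1 n < 0) ->
  is_lim_seq (fun n => v n (x1 n)) p_infty ->
  is_lim_seq (fun n => g1 (v n (x1 n)) * m n (x1 n)) (2 - a) ->
  is_lim_seq (fun n => A n (x1 n)) m_infty ->
  is_lim_seq (fun n => A n (x1 n) / g (v n (x1 n))) 0 ->
  exists x2 : nat -> R,
    eventually (fun n => x2 n < 0) /\
    is_lim_seq (fun n => (v n (x1 n) - v n (x2 n)) / chi (v n (x1 n))) 0 /\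
    is_lim_seq (fun n => g1 (v n (x2 n)) * m n (x2 n)) 2 /\
    is_lim_seq (fun n => A n (x2 n)) (ln (a ^ 2 / 2)).
Proof.
  intros Ha Hx1 HV Hy HA HAg. assert (Hk := kap_range HG).
  set (V := fun n => v n (x1 n)) in *. set (y1 := fun n => g1 (V n) * m n (x1 n)).
  fold V in HV. change (is_lim_seq y1 (2 - a)) in Hy.
  assert (Kp := K_nonneg HW).
  (* A bound for exp (om): exp (om) - (2 + K) y decreases along the window, exp (om) starts below 1,
     and y stays between 0 and 2. *)
  set (Cb := 1 + 2 * (2 + K)).
  (* Chosen so that a slope [a / 4] kept during the time [De n] would exceed the total growth
     available to om + (4/a) y; this contradiction later shows that y reaches 2. *)
  set (Kc := 4 / a * (2 + Rabs (ln Cb) + 8 / a)).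
  assert (HKc : 0 < Kc).
  { unfold Kc. assert (0 < 4 / a) by (apply Rdiv_lt_0_compat; lra).
    assert (0 < 8 / a) by (apply Rdiv_lt_0_compat; lra).
    generalize (Rabs_pos (ln Cb)). intros. apply Rmult_lt_0_compat; lra. }
  set (De := fun n => Kc * (Rabs (A n (x1 n)) + 1)).
  assert (HDe : forall n, 0 < De n).
  { intros n. unfold De. generalize (Rabs_pos (A n (x1 n))). intros. apply Rmult_lt_0_compat; lra. }
  (* While y <= 2, the height falls by at most [2 * De n / g1 (V n)] during the time [De n], that is
     by [s n] units of [chi]. It is negligible because [A] is o(g). *)
  set (s := fun n => 2 * De n / g (V n)).
  assert (Hg := lim_g HG V HV). assert (Cpos := g_pos_ev HG HF V 1 HV).
  assert (Hs : is_lim_seq s 0).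
  { apply lim_ext_ev with (fun n => 2 * Kc * (Rabs (A n (x1 n) / g (V n)) + 1 / g (V n))).
    - replace (Finite 0) with (Finite (2 * Kc * (0 + 0))) by (f_equal; ring).
      apply is_lim_seq_mult'; [apply is_lim_seq_const|]. apply is_lim_seq_plus'.
      + apply (is_lim_seq_abs _ 0) in HAg. simpl in HAg. rewrite Rabs_R0 in HAg. exact HAg.
      + apply lim_div_inf with 1; [apply is_lim_seq_const|auto].
    - ev_keep Cpos. ev_intros n [P1 _]. unfold s, De, Rdiv.
      rewrite Rabs_mult, (Rabs_pos_eq (/ _)) by (left; apply Rinv_0_lt_compat; lra). ring. }
  set (low := fun n => V n - s n * chi (V n)).
  assert (Hlow : is_lim_seq low p_infty) by (apply (drop_infty HG V s 0); auto; lra).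
  destruct (slow_variation HG V s 0 HV Hs ltac:(lra)) as [_ [_ SV]].
  replace (ef kap 0) with 1 in SV by (unfold ef; rewrite Ef_0; field).
  change (is_lim_seq (fun n => g1 (low n) / g1 (V n)) 1) in SV.
  assert (lowE : eventually (fun n => V n - 2 * De n / g1 (V n) = low n)).
  { ev_keep Cpos. ev_intros n [P1 [P2 [P3 P4]]]. unfold low, s, drop_scale. field. lra. }
  (* the window ends when y reaches 2, or after time De *)
  assert (Main : eventually (fun n => exists xe, x1 n <= xe /\ xe <= x1 n + De n /\ xe < 0 /\
     (forall x, x1 n <= x <= xe -> g1 (V n) * m n x <= 2 /\ low n <= v n x <= V n) /\
     (g1 (V n) * m n xe = 2 \/ xe = x1 n + De n))).
  { assert (E1 := proj1 (lim_inf _) Hlow 1). assert (E2 := lim_lt _ _ 2 Hy ltac:(lra)).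
    ev_use E1. ev_use E2. ev_use lowE. ev_keep Cpos. ev_keep Hx1. ev_intros n Hxn [P1 [P2 [P3 P4]]] lowE E2 E1. unfold y1 in E2. specialize (HDe n).
    assert (vb : forall z, x1 n <= z -> z <= x1 n + De n -> z < 0 -> 
       (forall x, x1 n <= x <= z -> g1 (V n) * m n x <= 2) -> low n <= v n z <= V n).
    { intros z Hz1 Hz2 Hz3 Hmz. split; [|apply (v_decr HS); auto].
      rewrite <- lowE.
      assert (I := incr_ge (v n) (fun z => - m n z) (x1 n) z (- (2 / g1 (V n))) Hz1).
      fold (V n) in I. eapply Rle_trans; [|apply I].
      - assert (2 / g1 (V n) * (z - x1 n) <= 2 / g1 (V n) * De n).
        { apply Rmult_le_compat_l; [|lra]. left. apply Rdiv_lt_0_compat; lra. }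
        unfold Rdiv in *. lra.
      - intros w Hw. apply (ls_v (HS n)). lra.
      - intros w Hw. apply Ropp_le_contravar. apply Rmult_le_reg_l with (g1 (V n)); [auto|].
        replace (g1 (V n) * (2 / g1 (V n))) with 2 by (field; lra). auto. }
    destruct (classic (exists x, x1 n <= x /\ x <= x1 n + De n /\ x < 0 /\ 2 <= g1 (V n) * m n x))
      as [[x [Hxa [Hxb [Hxc Hxd]]]]|Hno].
    - destruct (ivt (fun z => g1 (V n) * m n z)
        (fun z => g1 (V n) * (exp (l n + 2 * z + k z) * f (v n z))) (x1 n) x 2) as [xe [He1 He2]].
      + lra.
      + intros z Hz. apply (is_derive_scal (m n)). apply (ls_m (HS n)). lra.
      + lra.
      + assert (mb : forall z, x1 n <= z <= xe -> g1 (V n) * m n z <= 2).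
        { intros z Hz. rewrite <- He2. apply Rmult_le_compat_l; [lra|]. apply (m_incr HF HS); lra. }
        exists xe. repeat split; try lra.
        * apply mb; lra.
        * apply vb; try lra. intros; apply mb; lra.
        * apply (v_decr HS); lra.
    - assert (mb : forall z, x1 n <= z -> z <= x1 n + De n -> z < 0 -> g1 (V n) * m n z <= 2).
      { intros z Hz1 Hz2 Hz3. apply Rnot_lt_le. intros Hlt. apply Hno. exists z. repeat split; lra. }
      assert (IN : x1 n + De n < 0).
      { apply (inside HS n (x1 n) _ 1); [lra|auto|]. intros z Hz Hz0.
        destruct (vb z) as [B _]; try lra. intros; apply mb; lra. }
      exists (x1 n + De n). repeat split; try lra.
      + apply mb; lra.
      + apply vb; try lra. intros; apply mb; lra.
      + apply (v_decr HS); lra. }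
  destruct (ev_choice _ Main) as [xe Hxe]. clear Main.
  set (om := fun n x => l n + 2 * x + k x + ln (g1 (V n)) + g (v n x)).
  set (eps := fun n => 1 - g1 (low n) / g1 (V n)).
  assert (Heps : is_lim_seq eps 0).
  { replace (Finite 0) with (Finite (1 - 1)) by (f_equal; ring).
    apply is_lim_seq_minus'; [apply is_lim_seq_const|auto]. }
  assert (Om1 : forall n, om n (x1 n) = A n (x1 n)).
  { intros n. unfold om, Afun. fold (V n). ring. }
  assert (Win : eventually (fun n => x1 n <= xe n /\ xe n < 0 /\
     (g1 (V n) * m n (xe n) = 2 \/ xe n = x1 n + De n) /\ low n <= v n (xe n) /\
     forall x, x1 n <= x <= xe n -> 
       0 <= g1 (V n) * m n x <= 2 /\ low n <= v n x <= V n /\ Lv <= v n x /\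
       0 <= 1 - g1 (v n x) / g1 (V n) <= eps n /\
       is_derive (fun x => g1 (V n) * m n x) x (exp (om n x)) /\
       is_derive (om n) x (2 + k1 x - g1 (v n x) * m n x))).
  { assert (E1 := proj1 (lim_inf _) Hlow Lv). ev_use E1. ev_keep Cpos. ev_keep Hxe. ev_intros n [H1 [H2 [H3 [H4 H5]]]] [P1 [P2 [P3 P4]]] E1.
    assert (HLv := nl_lev HF).
    split; [auto|]. split; [auto|]. split; [auto|]. split; [apply H4; lra|].
    intros x Hx. destruct (H4 x Hx) as [B1 B2].
    assert (m0 := ls_m0 (HS n) x ltac:(lra)).
    assert (gm1 : g1 (v n x) <= g1 (V n)) by (apply (g1_mono HG); lra).
    assert (gm2 : g1 (low n) <= g1 (v n x)) by (apply (g1_mono HG); lra).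
    split; [split; [apply Rmult_le_pos; lra|auto]|]. split; [auto|]. split; [lra|]. split.
    { unfold eps. split.
      - assert (g1 (v n x) / g1 (V n) <= 1); [|lra]. apply Rmult_le_reg_r with (g1 (V n)); [auto|].
        replace (g1 (v n x) / g1 (V n) * g1 (V n)) with (g1 (v n x)) by (field; lra). lra.
      - assert (g1 (low n) / g1 (V n) <= g1 (v n x) / g1 (V n)); [|lra].
        apply Rmult_le_compat_r; [left; apply Rinv_0_lt_compat; lra|auto]. }
    split.
    - evar_last; [apply (is_derive_scal (m n)); apply (ls_m (HS n)); lra|].
      rewrite (nl_eq HF) by lra. rewrite <- (exp_ln (g1 (V n))) at 1 by lra.
      unfold scal; simpl; unfold mult; simpl. rewrite <- !exp_plus. f_equal. unfold om. ring.
    - unfold om. evar_last.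
      + apply (is_derive_plus (fun x => l n + 2 * x + k x + ln (g1 (V n))) (fun x => g (v n x))).
        * apply (is_derive_plus (fun x => l n + 2 * x + k x) (fun _ => ln (g1 (V n)))); [|apply is_derive_const].
          apply (is_derive_plus (fun x => l n + 2 * x) k); [|apply (wt_d HW); lra].
          instantiate (1 := 2). auto_derive; [auto|ring].
        * apply (is_derive_comp g (v n)); [apply (gr_g HG); lra|].
          apply (ls_v (HS n)). lra.
      + unfold plus, scal, zero; simpl; unfold mult; simpl. ring. }
  clear Hxe.
  assert (OmB : eventually (fun n => forall x, x1 n <= x <= xe n -> exp (om n x) <= Cb)).
  { assert (E := proj1 (lim_minf _) HA 0). ev_use E. ev_keep Win. ev_intros n [W1 [W2 [W3 [W4 W5]]]] E x Hx.
    assert (D := decr_le (fun x => exp (om n x) - (2 + K) * (g1 (V n) * m n x))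
      (fun x => exp (om n x) * (2 + k1 x - g1 (v n x) * m n x) - (2 + K) * exp (om n x)) (x1 n) x ltac:(lra)).
    assert (D' : exp (om n x) - (2 + K) * (g1 (V n) * m n x) <= exp (om n (x1 n)) - (2 + K) * (g1 (V n) * m n (x1 n))).
    { apply D.
      - intros z Hz. destruct (W5 z ltac:(lra)) as [_ [_ [_ [_ [D1 D2]]]]].
        evar_last.
        + apply (is_derive_minus (fun x => exp (om n x)) (fun x => (2 + K) * (g1 (V n) * m n x))).
          * apply (is_derive_comp exp (om n)); [apply is_derive_Reals, derivable_pt_lim_exp|exact D2].
          * apply (is_derive_scal (fun x => g1 (V n) * m n x)). exact D1.
        + unfold minus, plus, opp, scal; simpl; unfold mult; simpl. ring.
      - intros z Hz. destruct (W5 z ltac:(lra)) as [_ [B2 [B3 _]]].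
        assert (m0 := ls_m0 (HS n) z ltac:(lra)).
        assert (0 < g1 (v n z)). { apply (gr_g1pos HG). generalize (nl_lev HF); lra. }
        assert (k1 z <= K).
        { generalize (wt_d1 HW z ltac:(lra)). intros Q. apply Rabs_le_between in Q.
          assert (exp z <= 1) by (rewrite <- exp_0; apply exp_le; lra).
          assert (K * exp z <= K * 1) by (apply Rmult_le_compat_l; lra). lra. }
        assert (0 <= g1 (v n z) * m n z) by (apply Rmult_le_pos; lra).
        generalize (exp_pos (om n z)). nra. }
    destruct (W5 x Hx) as [B1 _]. destruct (W5 (x1 n) ltac:(lra)) as [B1' _].
    rewrite Om1 in D'. assert (exp (A n (x1 n)) <= 1) by (rewrite <- exp_0; apply exp_le; lra).
    unfold Cb. nra. }
  assert (Ve : is_lim_seq (fun n => v n (xe n)) p_infty).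
  { apply lim_inf_le with low; auto. ev_keep Win. apply ev_all. tauto. }
  assert (Ae : eventually (fun n => A n (xe n) = om n (xe n) + ln (g1 (v n (xe n)) / g1 (V n)) /\
       g1 (low n) / g1 (V n) <= g1 (v n (xe n)) / g1 (V n) <= 1)).
  { ev_keep Cpos. ev_keep Win. ev_intros n [W1 [W2 [W3 [W4 W5]]]] [P1 [P2 [P3 P4]]].
    destruct (W5 (xe n) ltac:(lra)) as [_ [B2 [B3 [B4 _]]]].
    assert (0 < g1 (v n (xe n))). { apply (gr_g1pos HG). generalize (nl_lev HF); lra. }
    unfold eps in B4. split; [|lra]. unfold Afun, om. rewrite ln_div by auto. ring. }
  (* Needed for the weight: its derivative is at most [K * exp (xe n)] on the window, which now
     tends to 0. *)
  assert (Minf : is_lim_seq xe m_infty).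
  { apply (crude_minf HG HF HW HS (Rmax 2 (ln Cb))); auto.
    - ev_keep Win. apply ev_all. tauto.
    - ev_keep Cpos. ev_keep Win. ev_intros n [W1 [W2 [W3 [W4 W5]]]] [P1 [P2 [P3 P4]]].
      destruct (W5 (xe n) ltac:(lra)) as [B1 [B2 [B3 _]]].
      assert (g1 (v n (xe n)) <= g1 (V n)). { apply (g1_mono HG); [generalize (nl_lev HF); lra|lra]. }
      assert (m0 := ls_m0 (HS n) (xe n) ltac:(lra)).
      assert (g1 (v n (xe n)) * m n (xe n) <= g1 (V n) * m n (xe n)) by (apply Rmult_le_compat_r; lra).
      generalize (Rmax_l 2 (ln Cb)). lra.
    - assert (SVp := lim_gt _ _ 0 SV ltac:(lra)).
      ev_use SVp. ev_keep Ae. ev_keep OmB. ev_keep Win. ev_intros n [W1 [W2 _]] Ob [EA [B1 B2]] SVp. rewrite EA.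
      assert (ln (g1 (v n (xe n)) / g1 (V n)) <= ln 1). { apply ln_le; lra. } rewrite ln_1 in H.
      specialize (Ob (xe n) ltac:(lra)).
      assert (om n (xe n) <= ln Cb). { rewrite <- (ln_exp (om n (xe n))). apply ln_le; [apply exp_pos|auto]. }
      generalize (Rmax_r 2 (ln Cb)). lra. }
  set (eta := fun n => K * exp (xe n) + 2 * eps n).
  assert (Heta : is_lim_seq eta 0).
  { replace (Finite 0) with (Finite (K * 0 + 2 * 0)) by (f_equal; ring).
    apply is_lim_seq_plus'; (apply is_lim_seq_mult'; [apply is_lim_seq_const|]); auto.
    now apply lim_exp_minf. }
  set (H := fun n x => (g1 (V n) * m n x - 2) ^ 2 / 2 + exp (om n x)).
  assert (Err : eventually (fun n => forall x, x1 n <= x <= xe n -> 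
     Rabs (k1 x + g1 (V n) * m n x * (1 - g1 (v n x) / g1 (V n))) <= eta n)).
  { ev_keep Win. ev_intros n [W1 [W2 [W3 [W4 W5]]]] x Hx.
    destruct (W5 x Hx) as [B1 [_ [_ [B4 _]]]].
    eapply Rle_trans; [apply Rabs_triang|]. unfold eta. apply Rplus_le_compat.
    - eapply Rle_trans; [apply (wt_d1 HW); lra|]. apply Rmult_le_compat_l; [auto|].
      apply exp_le; lra.
    - rewrite Rabs_pos_eq by (apply Rmult_le_pos; lra). apply Rmult_le_compat; lra. }
  (* The derivative of [H] is y' times an error of size at most [eta]. Comparing [H] with plus and
     minus [eta * y] bounds its change by [eta] times the increase of y, at most 2, independently of
     the length of the window. *)
  assert (Cons : eventually (fun n => forall x, x1 n <= x <= xe n -> Rabs (H n x - H n (x1 n)) <= 2 * eta n)).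
  { ev_keep Err. ev_keep Win. ev_keep Cpos. ev_intros n [P1 [P2 [P3 P4]]] [W1 [W2 [W3 [W4 W5]]]] Er x Hx.
    set (y := fun x => g1 (V n) * m n x).
    set (er := fun x => k1 x + g1 (V n) * m n x * (1 - g1 (v n x) / g1 (V n))).
    assert (HD : forall z, x1 n <= z <= xe n -> is_derive (H n) z (exp (om n z) * er z)).
    { intros z Hz. destruct (W5 z Hz) as [_ [_ [_ [_ [D1 D2]]]]]. unfold H. evar_last.
      - apply (is_derive_plus (fun x => (g1 (V n) * m n x - 2) ^ 2 / 2) (fun x => exp (om n x))).
        + apply (is_derive_comp (fun w => (w - 2) ^ 2 / 2) (fun x => g1 (V n) * m n x)).
          * instantiate (1 := g1 (V n) * m n z - 2). auto_derive; [auto|field].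
          * exact D1.
        + apply (is_derive_comp exp (om n)); [apply is_derive_Reals, derivable_pt_lim_exp|exact D2].
      - unfold plus, scal; simpl; unfold mult; simpl. unfold er. field. lra. }
    assert (yd : forall z, x1 n <= z <= xe n -> is_derive y z (exp (om n z))).
    { intros z Hz. apply W5; auto. }
    destruct (W5 x Hx) as [Bx _]. destruct (W5 (x1 n) ltac:(lra)) as [B1 _].
    fold (y x) in Bx. fold (y (x1 n)) in B1.
    assert (Q0 : 0 <= eta n) by (eapply Rle_trans; [apply Rabs_pos|apply (Er x Hx)]).
    assert (U : H n x - eta n * y x <= H n (x1 n) - eta n * y (x1 n)).
    { apply (decr_le (fun x => H n x - eta n * y x)
        (fun z => exp (om n z) * er z - eta n * exp (om n z))); [lra| |].
      - intros z Hz. apply (is_derive_minus (H n)); [apply HD; lra|].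
        apply (is_derive_scal y). apply yd; lra.
      - intros z Hz. specialize (Er z ltac:(lra)). fold (er z) in Er. apply Rabs_le_between in Er.
        generalize (exp_pos (om n z)). nra. }
    assert (Lo : H n (x1 n) + eta n * y (x1 n) <= H n x + eta n * y x).
    { apply (incr_le0 (fun x => H n x + eta n * y x)
        (fun z => exp (om n z) * er z + eta n * exp (om n z))); [lra| |].
      - intros z Hz. apply (is_derive_plus (H n)); [apply HD; lra|].
        apply (is_derive_scal y). apply yd; lra.
      - intros z Hz. specialize (Er z ltac:(lra)). fold (er z) in Er. apply Rabs_le_between in Er.
        generalize (exp_pos (om n z)). nra. }
    apply Rabs_le_between. nra. }
  assert (H1lim : is_lim_seq (fun n => H n (x1 n)) (a ^ 2 / 2)).
  { replace (a ^ 2 / 2) with ((2 - a - 2) ^ 2 / 2 + 0) by field. unfold H.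
    apply is_lim_seq_plus'.
    - apply (is_lim_seq_continuous (fun w => (w - 2) ^ 2 / 2)); [|exact Hy].
      apply derivable_continuous_pt.
      apply ex_derive_Reals_0. auto_derive. auto.
    - apply is_lim_seq_ext with (fun n => exp (A n (x1 n))); [intros n; now rewrite Om1|].
      now apply lim_exp_minf. }
  (* Otherwise om + (4/a) y grows at rate at least [a / 4] for the whole time [De n]. Where 2 - y >=
     a/2 the growth comes from om; where y is closer to 2, conservation of [H] makes exp (om) at
     least a^2/8, and the term (4/a) y' provides it. *)
  assert (Hit : eventually (fun n => g1 (V n) * m n (xe n) = 2)).
  { assert (E1 := lim_gt _ _ (3 / 8 * a ^ 2) H1lim ltac:(nra)).
    assert (E2 := lim_lt _ _ (Rmin (a / 4) (a ^ 2 / 32)) Heta ltac:(apply Rmin_glb_lt; nra)).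
    ev_use E1. ev_use E2. ev_keep Cons. ev_keep Err. ev_keep Win. ev_keep OmB. ev_keep Cpos. ev_intros n [P1 [P2 [P3 P4]]] OB [W1 [W2 [W3 [W4 W5]]]] Er Co E2 E1.
    destruct W3 as [W3|W3]; [auto|exfalso].
    assert (R1 := Rmin_l (a / 4) (a ^ 2 / 32)). assert (R2 := Rmin_r (a / 4) (a ^ 2 / 32)).
    assert (a4 : 0 < 4 / a) by (apply Rdiv_lt_0_compat; lra).
    assert (I := incr_ge (fun x => om n x + 4 / a * (g1 (V n) * m n x))
      (fun x => 2 + k1 x - g1 (v n x) * m n x + 4 / a * exp (om n x)) (x1 n) (xe n) (a / 4) W1).
    assert (I' : om n (x1 n) + 4 / a * (g1 (V n) * m n (x1 n)) + a / 4 * (xe n - x1 n) <=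
      om n (xe n) + 4 / a * (g1 (V n) * m n (xe n))).
    { apply I; clear I.
      - intros z Hz. destruct (W5 z Hz) as [_ [_ [_ [_ [D1 D2]]]]].
        apply (is_derive_plus (om n)); [exact D2|]. apply (is_derive_scal (fun x => g1 (V n) * m n x)). exact D1.
      - intros z Hz. destruct (W5 z Hz) as [Bz _].
        specialize (Er z Hz). specialize (Co z Hz). apply Rabs_le_between in Er. apply Rabs_le_between in Co.
        set (er := k1 z + g1 (V n) * m n z * (1 - g1 (v n z) / g1 (V n))) in *.
        replace (2 + k1 z - g1 (v n z) * m n z) with (2 - g1 (V n) * m n z + er) by (unfold er; field; lra).
        set (y := g1 (V n) * m n z) in *. 
        assert (HH : 5 / 16 * a ^ 2 <= (y - 2) ^ 2 / 2 + exp (om n z)).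
        { unfold H in Co. fold y in Co. unfold H in E1. lra. }
        assert (ep := exp_pos (om n z)).
        destruct (Rle_dec (a / 2) (2 - y)) as [Hc|Hc].
        + assert (0 < 4 / a * exp (om n z)) by (apply Rmult_lt_0_compat; lra). lra.
        + assert ((y - 2) ^ 2 <= a ^ 2 / 4) by nra.
          assert (Q3 : 4 / a * (a ^ 2 / 8) <= 4 / a * exp (om n z)) by (apply Rmult_le_compat_l; nra).
          replace (4 / a * (a ^ 2 / 8)) with (a / 2) in Q3 by (field; lra). lra. }
    destruct (W5 (x1 n) ltac:(lra)) as [B1 _]. destruct (W5 (xe n) ltac:(lra)) as [Be _].
    specialize (OB (xe n) ltac:(lra)).
    assert (om n (xe n) <= ln Cb). { rewrite <- (ln_exp (om n (xe n))). apply ln_le; [apply exp_pos|auto]. }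
    rewrite Om1 in I'. replace (xe n - x1 n) with (De n) in I' by (rewrite W3; ring).
    assert (a / 4 * De n = (2 + Rabs (ln Cb) + 8 / a) * (Rabs (A n (x1 n)) + 1)).
    { unfold De, Kc. field. lra. }
    assert (4 / a * (g1 (V n) * m n (xe n)) <= 8 / a).
    { replace (8 / a) with (4 / a * 2) by (field; lra). apply Rmult_le_compat_l; lra. }
    assert (0 <= 4 / a * (g1 (V n) * m n (x1 n))) by (apply Rmult_le_pos; lra).
    assert (0 < 8 / a) by (apply Rdiv_lt_0_compat; lra).
    generalize (Rabs_pos (A n (x1 n))) (Rle_abs (ln Cb)) (Rabs_pos (ln Cb)) (Rle_abs (- A n (x1 n))).
    rewrite Rabs_Ropp. intros Q1 Q2 Q3 Q4.
    assert (0 <= (Rabs (ln Cb) + 8 / a) * Rabs (A n (x1 n))) by (apply Rmult_le_pos; lra).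
    set (u1 := 8 / a) in *. set (u2 := 4 / a * (g1 (V n) * m n (xe n))) in *.
    set (u3 := 4 / a * (g1 (V n) * m n (x1 n))) in *. nra. }
  exists xe. 
  assert (Rat : is_lim_seq (fun n => g1 (v n (xe n)) / g1 (V n)) 1).
  { apply is_lim_seq_le_le_loc with (fun n => g1 (low n) / g1 (V n)) (fun _ => 1);
      [|auto|apply is_lim_seq_const].
    ev_keep Ae. ev_intros n [_ Q]. exact Q. }
  split; [|split; [|split]].
  - ev_keep Win. apply ev_all. tauto.
  - apply is_lim_seq_le_le_loc with (fun _ => 0) s; [|apply is_lim_seq_const|auto].
    ev_keep Cpos. ev_keep Win. ev_intros n [W1 [W2 [W3 [W4 W5]]]] [P1 [P2 [P3 P4]]].
    destruct (W5 (xe n) ltac:(lra)) as [_ [B2 _]]. fold (V n). unfold low in B2.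
    assert (Hc0 : 0 < chi (V n)) by (apply Rdiv_lt_0_compat; lra). split.
    + apply Rmult_le_pos; [lra|]. left. now apply Rinv_0_lt_compat.
    + apply Rmult_le_reg_r with (chi (V n)); [auto|].
      replace ((V n - v n (xe n)) / chi (V n) * chi (V n)) with (V n - v n (xe n)) by (field; lra). lra.
  - apply lim_ext_ev with (fun n => g1 (v n (xe n)) / g1 (V n) * 2).
    + replace (Finite 2) with (Finite (1 * 2)) by (f_equal; ring).
      apply is_lim_seq_mult'; [auto|apply is_lim_seq_const].
    + ev_keep Hit. ev_keep Cpos. ev_intros n [P1 [P2 [P3 P4]]] Hi.
      rewrite <- Hi. field. lra.
  - assert (Hel : is_lim_seq (fun n => exp (om n (xe n))) (a ^ 2 / 2)).
    { apply lim_ext_ev with (fun n => H n (x1 n) + (H n (xe n) - H n (x1 n))).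
      - replace (a ^ 2 / 2) with (a ^ 2 / 2 + 0) by ring. apply is_lim_seq_plus'; [auto|].
        apply lim_squeeze0 with (fun n => 2 * eta n).
        + replace (Finite 0) with (Finite (2 * 0)) by (f_equal; ring).
          apply is_lim_seq_mult'; [apply is_lim_seq_const|auto].
        + ev_keep Cons. ev_keep Win. ev_intros n [W1 _] Co. rewrite Rminus_0_r. apply Co. lra.
      - ev_keep Hit. ev_intros n Hi. unfold H. rewrite Hi. field. }
    assert (Hol : is_lim_seq (fun n => om n (xe n)) (ln (a ^ 2 / 2))).
    { apply is_lim_seq_ext with (fun n => ln (exp (om n (xe n)))); [intros; apply ln_exp|].
      apply lim_ln; [nra|auto]. }
    apply lim_ext_ev with (fun n => om n (xe n) + ln (g1 (v n (xe n)) / g1 (V n))).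
    + replace (ln (a ^ 2 / 2)) with (ln (a ^ 2 / 2) + ln 1) by (rewrite ln_1; ring).
      apply is_lim_seq_plus'; [auto|]. apply lim_ln; [lra|auto].
    + ev_keep Ae. ev_intros n [-> _]. reflexivity.
Qed.

End Entry.

(** * Liouville profiles and the radial Gronwall estimate *)

(** The profile with [b] left free, expanded into logarithms. [liouville2] is read off from -z'' -
    z'/s = e^z, so that [liouville1_deriv] is exactly the statement that the profile solves the
    equation. *)
Definition liouville (a b s : R) : R := ln (2 * a ^ 2 * b) + (a - 2) * ln s - 2 * ln (1 + b * exp (a * ln s)).
Definition liouville1 (a b s : R) : R :=
  (a - 2) / s - 2 * a * (b * exp (a * ln s)) / (s * (1 + b * exp (a * ln s))).
Definition liouville2 (a b s : R) : R := - (liouville1 a b s / s) - exp (liouville a b s).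

Lemma exp_liouville (a b s : R) : 0 < a -> 0 < b -> 0 < s ->
  exp (liouville a b s) = 2 * a ^ 2 * (b * exp (a * ln s)) / (s ^ 2 * (1 + b * exp (a * ln s)) ^ 2).
Proof.
  intros Ha Hb Hs. unfold liouville. assert (E := exp_pos (a * ln s)).
  assert (0 < b * exp (a * ln s)) by now apply Rmult_lt_0_compat.
  unfold Rminus. rewrite !exp_plus.
  rewrite exp_ln by (apply Rmult_lt_0_compat; [|auto]; nra).
  replace (- (2 * ln (1 + b * exp (a * ln s)))) with (- ln (1 + b * exp (a * ln s)) + - ln (1 + b * exp (a * ln s))) by ring.
  rewrite exp_plus, exp_Ropp, exp_ln by lra.
  replace ((a + - (2)) * ln s) with (a * ln s + (- ln s + - ln s)) by ring.
  rewrite !exp_plus, exp_Ropp, exp_ln by lra. field. split; lra.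
Qed.

Lemma liouville_deriv (a b s : R) : 0 < a -> 0 < b -> 0 < s -> is_derive (liouville a b) s (liouville1 a b s).
Proof.
  intros Ha Hb Hs. assert (E := exp_pos (a * ln s)).
  assert (0 < b * exp (a * ln s)) by now apply Rmult_lt_0_compat.
  unfold liouville, liouville1. auto_derive; [repeat split; auto; lra|field; split; lra].
Qed.

Lemma liouville1_deriv (a b s : R) : 0 < a -> 0 < b -> 0 < s -> is_derive (liouville1 a b) s (liouville2 a b s).
Proof.
  intros Ha Hb Hs. assert (E := exp_pos (a * ln s)).
  assert (0 < b * exp (a * ln s)) by now apply Rmult_lt_0_compat.
  unfold liouville2. rewrite exp_liouville by auto. unfold liouville1.
  auto_derive.
  - repeat split; auto; try lra. assert (0 < s * (1 + b * exp (a * ln s))) by (apply Rmult_lt_0_compat; lra). lra.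
  - field. split; lra.
Qed.

Lemma liouville_upper (a b al be s : R) : 0 < a <= 2 -> 0 < b -> 0 < al -> al <= s <= be ->
  liouville a b s <= ln (2 * a ^ 2 * b) + 2 * (Rabs (ln al) + Rabs (ln be)).
Proof.
  intros Ha Hb Hal Hs. unfold liouville. assert (E := exp_pos (a * ln s)).
  assert (0 < b * exp (a * ln s)) by now apply Rmult_lt_0_compat.
  assert (0 <= ln (1 + b * exp (a * ln s))) by (rewrite <- ln_1; apply ln_le; lra).
  assert (ln al <= ln s <= ln be) by (split; apply ln_le; lra).
  generalize (Rle_abs (ln be)) (Rle_abs (- ln al)). rewrite Rabs_Ropp. intros Q1 Q2.
  generalize (Rabs_pos (ln be)) (Rabs_pos (ln al)). intros. 
  assert (- (Rabs (ln al) + Rabs (ln be)) <= ln s) by lra. nra.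
Qed.

Lemma zprof_liouville (a s : R) : 0 < a -> 0 < s -> zprof a s = liouville a (Rpower (sqrt 2 / a) a) s.
Proof.
  intros Ha Hs. unfold zprof, liouville. set (b := Rpower (sqrt 2 / a) a).
  assert (Hb : 0 < b) by apply exp_pos.
  assert (Hp : 0 < Rpower s a) by apply exp_pos.
  assert (Hq : 0 < Rpower s (2 - a)) by apply exp_pos.
  assert (0 < b * Rpower s a) by now apply Rmult_lt_0_compat.
  assert (0 < (1 + b * Rpower s a) ^ 2) by (apply pow_lt; lra).
  rewrite ln_div.
  - rewrite (ln_mult (Rpower s (2 - a))) by auto.
    replace ((1 + b * Rpower s a) ^ 2) with ((1 + b * Rpower s a) * (1 + b * Rpower s a)) by ring.
    rewrite (ln_mult (1 + b * Rpower s a)) by lra.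
    unfold Rpower at 1. rewrite ln_exp. fold (Rpower s a). ring.
  - apply Rmult_lt_0_compat; nra.
  - now apply Rmult_lt_0_compat.
Qed.

Lemma zprof_derive (a s : R) : 0 < a -> 0 < s ->
  Derive (zprof a) s = liouville1 a (Rpower (sqrt 2 / a) a) s /\
  Derive_n (zprof a) 2 s = liouville2 a (Rpower (sqrt 2 / a) a) s.
Proof.
  intros Ha Hs. set (b := Rpower (sqrt 2 / a) a). assert (Hb : 0 < b) by apply exp_pos.
  assert (L : forall t, 0 < t -> locally t (fun w => 0 < w)).
  { intros t Ht. exists (mkposreal t Ht). intros w Hw.
    apply Rabs_def2 in Hw. unfold minus, plus, opp in Hw; simpl in Hw. lra. }
  assert (D1 : forall t, 0 < t -> Derive (zprof a) t = liouville1 a b t).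
  { intros t Ht. apply is_derive_unique. apply (is_derive_ext_loc (liouville a b)); [|now apply liouville_deriv].
    generalize (L t Ht). apply filter_imp. intros w Hw. symmetry. now apply zprof_liouville. }
  split; [now apply D1|]. simpl.
  apply is_derive_unique. apply (is_derive_ext_loc (liouville1 a b)); [|now apply liouville1_deriv].
  generalize (L s Hs). apply filter_imp. intros w Hw. symmetry. now apply D1.
Qed.

Lemma gron_fwd (E E1 : R -> R) (a b K d : R) : 0 < K -> 0 <= d -> a <= b ->
  (forall x, a <= x <= b -> is_derive E x (E1 x)) ->
  (forall x, a <= x <= b -> E1 x <= K * E x + d) ->
  E b <= (E a + d / K) * exp (K * (b - a)).
Proof.
  intros HK Hd Hab HD HE.
  assert (Q := decr_le (fun x => (E x + d / K) * exp (- K * (x - a)))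
    (fun x => (E1 x - K * (E x + d / K)) * exp (- K * (x - a))) a b Hab).
  assert (Q' : (E b + d / K) * exp (- K * (b - a)) <= (E a + d / K) * exp (- K * (a - a))).
  { apply Q.
    - intros x Hx. evar_last.
      + apply (is_derive_mult (fun x => E x + d / K) (fun x => exp (- K * (x - a))));
          [|  |intros; apply Rmult_comm].
        * apply (is_derive_plus E (fun _ => d / K)); [apply HD; auto|apply is_derive_const].
        * instantiate (1 := - K * exp (- K * (x - a))). auto_derive; [auto|unfold Rminus; ring].
      + unfold plus, mult, zero; simpl. ring.
    - intros x Hx. specialize (HE x Hx).
      replace (E1 x - K * (E x + d / K)) with (E1 x - (K * E x + d)) by (field; lra).
      generalize (exp_pos (- K * (x - a))). nra. }
  replace (- K * (a - a)) with 0 in Q' by ring. rewrite exp_0, Rmult_1_r in Q'.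
  replace (- K * (b - a)) with (- (K * (b - a))) in Q' by ring. rewrite exp_Ropp in Q'.
  apply Rmult_le_compat_r with (r := exp (K * (b - a))) in Q'; [|left; apply exp_pos].
  rewrite Rmult_assoc, Rinv_l, Rmult_1_r in Q' by (apply Rgt_not_eq, exp_pos).
  assert (0 <= d / K) by (apply Rmult_le_pos; [auto|left; now apply Rinv_0_lt_compat]). lra.
Qed.

Lemma gron_bwd (E E1 : R -> R) (a b K d : R) : 0 < K -> 0 <= d -> a <= b ->
  (forall x, a <= x <= b -> is_derive E x (E1 x)) ->
  (forall x, a <= x <= b -> - E1 x <= K * E x + d) ->
  E a <= (E b + d / K) * exp (K * (b - a)).
Proof.
  intros HK Hd Hab HD HE.
  assert (Q := gron_fwd (fun x => E (- x)) (fun x => - E1 (- x)) (- b) (- a) K d HK Hd ltac:(lra)).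
  cbv beta in Q. rewrite !Ropp_involutive in Q. replace (- a - - b) with (b - a) in Q by ring.
  apply Q.
  - intros x Hx. evar_last.
    + apply (is_derive_comp E (fun x => - x)); [apply HD; lra|].
      instantiate (1 := - (1)). auto_derive; [auto|ring].
    + unfold scal; simpl; unfold mult; simpl. ring.
  - intros x Hx. apply HE. lra.
Qed.

Section RadialGronwall.
Context (D D1 D2 : R -> R) (a b M e : R) (Ha : 0 < a) (Hab : a <= b) (HM : 0 <= M) (He : 0 <= e).
Hypothesis HD : forall s, a <= s <= b -> is_derive D s (D1 s).
Hypothesis HD1 : forall s, a <= s <= b -> is_derive D1 s (D2 s).
Hypothesis HE : forall s, a <= s <= b -> Rabs (D2 s + D1 s / s) <= M * Rabs (D s) + e.

(** The bounded expression contains 2 D1 (D2 + D1/s) and exceeds the derivative of the energy by 2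
    D1^2/s. The sign of this term separates the two Gronwall estimates. *)
Lemma radial_energy (s : R) : a <= s <= b ->
  is_derive (fun s => D s ^ 2 + D1 s ^ 2) s (2 * D s * D1 s + 2 * D1 s * D2 s) /\
  Rabs (2 * D s * D1 s + 2 * D1 s * (D2 s + D1 s / s)) <= (2 + M) * (D s ^ 2 + D1 s ^ 2) + e ^ 2.
Proof.
  intros Hs. split.
  - evar_last.
    + apply (is_derive_plus (fun s => D s ^ 2) (fun s => D1 s ^ 2)).
      * apply (is_derive_pow D 2). now apply HD.
      * apply (is_derive_pow D1 2). now apply HD1.
    + unfold plus; simpl. ring.
  - specialize (HE s Hs). set (w := D2 s + D1 s / s) in *.
    eapply Rle_trans; [apply Rabs_triang|].
    rewrite !Rabs_mult, (Rabs_pos_eq 2) by lra.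
    rewrite <- (pow2_abs (D s)), <- (pow2_abs (D1 s)).
    generalize (Rabs_pos (D s)) (Rabs_pos (D1 s)) (Rabs_pos w).
    set (x := Rabs (D s)) in *. set (y := Rabs (D1 s)) in *. intros Hx Hy Hw.
    assert (2 * y * Rabs w <= 2 * y * (M * x + e)) by (apply Rmult_le_compat_l; lra).
    assert (0 <= (x - y) ^ 2) by apply pow2_ge_0. assert (0 <= (y - e) ^ 2) by apply pow2_ge_0.
    assert (0 <= M * (x - y) ^ 2) by (apply Rmult_le_pos; auto). nra.
Qed.

(** Outwards the singular term damps the energy, so the constant does not depend on the left end
    [a]. The first bubble can therefore be started arbitrarily close to the centre. *)
Lemma radial_gron_fwd : 
  D b ^ 2 + D1 b ^ 2 <= (D a ^ 2 + D1 a ^ 2 + e ^ 2) * exp ((2 + M) * (b - a)).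
Proof.
  assert (He2 : 0 <= e ^ 2) by apply pow2_ge_0.
  eapply Rle_trans.
  - apply (gron_fwd (fun s => D s ^ 2 + D1 s ^ 2) (fun s => 2 * D s * D1 s + 2 * D1 s * D2 s) a b (2 + M) (e ^ 2));
      [lra|auto|auto| |].
    + intros s Hs. now apply radial_energy.
    + intros s Hs. destruct (radial_energy s Hs) as [_ Q]. apply Rabs_le_between in Q.
      assert (0 <= D1 s * (D1 s / s)).
      { replace (D1 s * (D1 s / s)) with (D1 s ^ 2 * / s) by (field; lra).
        apply Rmult_le_pos; [apply pow2_ge_0|left; apply Rinv_0_lt_compat; lra]. }
      lra.
  - apply Rmult_le_compat_r; [left; apply exp_pos|].
    assert (e ^ 2 / (2 + M) <= e ^ 2); [|lra].
    apply Rmult_le_reg_r with (2 + M); [lra|]. unfold Rdiv. rewrite Rmult_assoc, Rinv_l by lra. nra.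
Qed.

(** Inwards the singular term has the wrong sign and adds the rate [2 / a]. *)
Lemma radial_gron_bwd : 
  D a ^ 2 + D1 a ^ 2 <= (D b ^ 2 + D1 b ^ 2 + e ^ 2) * exp ((2 + M + 2 / a) * (b - a)).
Proof.
  assert (He2 : 0 <= e ^ 2) by apply pow2_ge_0. assert (Ha2 : 0 < 2 / a) by (apply Rdiv_lt_0_compat; lra).
  eapply Rle_trans.
  - apply (gron_bwd (fun s => D s ^ 2 + D1 s ^ 2) (fun s => 2 * D s * D1 s + 2 * D1 s * D2 s) a b (2 + M + 2 / a) (e ^ 2));
      [lra|auto|auto| |].
    + intros s Hs. now apply radial_energy.
    + intros s Hs. destruct (radial_energy s Hs) as [_ Q]. apply Rabs_le_between in Q.
      assert (D1 s * (D1 s / s) <= / a * D1 s ^ 2).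
      { replace (D1 s * (D1 s / s)) with (/ s * D1 s ^ 2) by (field; lra).
        apply Rmult_le_compat_r; [apply pow2_ge_0|]. apply Rinv_le_contravar; lra. }
      assert (0 <= / a * D s ^ 2) by (apply Rmult_le_pos; [left; apply Rinv_0_lt_compat; lra|apply pow2_ge_0]).
      unfold Rdiv in *. nra.
  - apply Rmult_le_compat_r; [left; apply exp_pos|].
    assert (e ^ 2 / (2 + M + 2 / a) <= e ^ 2); [|lra].
    apply Rmult_le_reg_r with (2 + M + 2 / a); [lra|]. unfold Rdiv at 1. rewrite Rmult_assoc, Rinv_l by lra. nra.
Qed.
End RadialGronwall.

Lemma exp_lip (M x y : R) : x <= M -> y <= M -> Rabs (exp x - exp y) <= exp M * Rabs (x - y).
Proof.
  assert (W : forall x y, x <= y -> y <= M -> Rabs (exp x - exp y) <= exp M * Rabs (x - y)).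
  { clear x y. intros x y Hxy Hy.
    assert (I := incr_le exp exp x y (exp M) Hxy).
    rewrite Rabs_left1, Rabs_left1 by (try lra; generalize (exp_le x y Hxy); lra).
    assert (exp y <= exp x + exp M * (y - x)); [|lra]. apply I.
    - intros. apply is_derive_Reals, derivable_pt_lim_exp.
    - intros. apply exp_le. lra. }
  intros Hx Hy. destruct (Rle_dec x y); [auto|].
  rewrite Rabs_minus_sym, (Rabs_minus_sym x). apply W; lra.
Qed.

(** * The radial solution: behaviour at the centre and passage to the logarithmic radius *)

Record hprop (h h1 : R -> R) (h0 K : R) : Prop := {
  hp_pos : forall r, 0 < r < 1 -> 0 < h r;
  hp_d : forall r, 0 < r < 1 -> is_derive h r (h1 r);
  hp_d1 : forall r, 0 < r < 1 -> Rabs (h1 r / h r) <= K;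
  hp_b : forall r, 0 < r < 1 -> Rabs (ln (h r)) <= K;
  hp_h0 : 0 < h0;
  hp_0 : forall eps, 0 < eps -> exists d, 0 < d /\ forall r, 0 < r < d -> Rabs (h r - h0) <= eps }.
Arguments hp_pos {h h1 h0 K}.
Arguments hp_d {h h1 h0 K}.
Arguments hp_d1 {h h1 h0 K}.
Arguments hp_b {h h1 h0 K}.
Arguments hp_h0 {h h1 h0 K}.
Arguments hp_0 {h h1 h0 K}.

(** Derivatives are two-sided on the open interval, and the conditions at the ends become limits:
    [rs_0] at the centre, and [rs_1] for the vanishing of [u] at r = 1. *)
Record rsol (f h : R -> R) (lam mu : R) (u u1 u2 : R -> R) : Prop := {
  rs_lam : 0 < lam;
  rs_u : forall r, 0 < r < 1 -> is_derive u r (u1 r);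
  rs_u1 : forall r, 0 < r < 1 -> is_derive u1 r (u2 r);
  rs_eq : forall r, 0 < r < 1 -> u2 r + u1 r / r = - (lam * h r * f (u r));
  rs_pos : forall r, 0 < r < 1 -> 0 < u r;
  rs_0 : forall eps, 0 < eps -> exists d, 0 < d /\ forall r, 0 < r < d ->
           Rabs (u r - mu) <= eps /\ Rabs (u1 r) <= eps;
  rs_1 : forall c r0, 0 < c -> r0 < 1 -> exists r, r0 < r < 1 /\ u r < c }.
Arguments rs_lam {f h lam mu u u1 u2}.
Arguments rs_u {f h lam mu u u1 u2}.
Arguments rs_u1 {f h lam mu u u1 u2}.
Arguments rs_eq {f h lam mu u u1 u2}.
Arguments rs_pos {f h lam mu u u1 u2}.
Arguments rs_0 {f h lam mu u u1 u2}.
Arguments rs_1 {f h lam mu u u1 u2}.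

Lemma weight_of_h (h h1 : R -> R) (h0 K : R) : hprop h h1 h0 K ->
  weight (fun x => ln (h (exp x))) (fun x => exp x * (h1 (exp x) / h (exp x))) K.
Proof.
  intros Hh. assert (W : forall x, x < 0 -> 0 < exp x < 1).
  { intros x Hx. split; [apply exp_pos|]. rewrite <- exp_0. now apply exp_increasing. }
  split.
  - intros x Hx. assert (P := hp_pos Hh _ (W x Hx)). evar_last.
    + apply (is_derive_comp ln (fun x => h (exp x))).
      * apply is_derive_Reals, derivable_pt_lim_ln. auto.
      * apply (is_derive_comp h exp); [apply (hp_d Hh); auto|].
        apply is_derive_Reals, derivable_pt_lim_exp.
    + unfold scal; simpl; unfold mult; simpl. field. lra.
  - intros x Hx. rewrite Rabs_mult, Rabs_pos_eq by (left; apply exp_pos).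
    rewrite Rmult_comm. apply Rmult_le_compat_r; [left; apply exp_pos|].
    apply (hp_d1 Hh). auto.
  - intros x Hx. apply (hp_b Hh). auto.
Qed.

Lemma rs_monotone0 (F F1 : R -> R) (L r : R) : 0 < r ->
  (forall x, 0 < x <= r -> is_derive F x (F1 x)) -> (forall x, 0 < x <= r -> 0 <= F1 x) ->
  (forall eps, 0 < eps -> exists d, 0 < d /\ forall x, 0 < x < d -> Rabs (F x - L) <= eps) ->
  L <= F r.
Proof.
  intros Hr HD HF HL. apply Rnot_lt_le. intros Hlt.
  destruct (HL ((L - F r) / 2) ltac:(lra)) as [d [Hd Hd']].
  set (x := Rmin (d / 2) r). assert (Hx : 0 < x <= r /\ x < d).
  { unfold x. split; [split|]; [apply Rmin_glb_lt; lra|apply Rmin_r|].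
    generalize (Rmin_l (d / 2) r). lra. }
  assert (F x <= F r).
  { apply (incr_le0 F F1); [lra|intros; apply HD; lra|intros; apply HF; lra]. }
  specialize (Hd' x ltac:(lra)). apply Rabs_le_between in Hd'. lra.
Qed.

Section Radial.
Context {f h : R -> R} {lam mu : R} {u u1 u2 : R -> R} (HR : rsol f h lam mu u u1 u2).
Context (hpos : forall r, 0 < r < 1 -> 0 < h r) (fpos : forall x, 0 <= x -> 0 <= f x).

Lemma rs_flux_deriv (r : R) : 0 < r < 1 ->
  is_derive (fun r => - (r * u1 r)) r (lam * h r * f (u r) * r).
Proof.
  intros Hr. evar_last.
  - apply (is_derive_opp (fun r => r * u1 r)).
    apply (is_derive_mult (fun r => r) u1); [apply is_derive_id|apply (rs_u1 HR); auto|].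
    intros; apply Rmult_comm.
  - unfold opp, plus, mult, one; simpl.
    generalize (rs_eq HR r Hr). intros E.
    replace (u2 r) with (- (lam * h r * f (u r)) - u1 r / r) by lra. field. lra.
Qed.

Lemma rs_flux_0 (eps : R) : 0 < eps -> exists d, 0 < d /\ forall r, 0 < r < d -> Rabs (- (r * u1 r) - 0) <= eps.
Proof.
  intros He. destruct (rs_0 HR eps He) as [d [Hd H]].
  exists (Rmin d 1). split; [apply Rmin_glb_lt; lra|]. intros r Hr.
  assert (M1 := Rmin_l d 1). assert (M2 := Rmin_r d 1).
  destruct (H r ltac:(lra)) as [_ Q]. rewrite Rminus_0_r, Rabs_Ropp, Rabs_mult, Rabs_pos_eq by lra.
  generalize (Rabs_pos (u1 r)). nra.
Qed.

Lemma rs_flux_nonneg (r : R) : 0 < r < 1 -> 0 <= - (r * u1 r).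
Proof.
  intros Hr. apply (rs_monotone0 (fun r => - (r * u1 r)) (fun r => lam * h r * f (u r) * r)); [lra| | |].
  - intros. apply rs_flux_deriv. lra.
  - intros x Hx. apply Rmult_le_pos; [|lra]. apply Rmult_le_pos.
    + left. apply Rmult_lt_0_compat; [apply (rs_lam HR)|apply hpos; lra].
    + apply fpos. left. apply (rs_pos HR). lra.
  - apply rs_flux_0.
Qed.

Lemma rs_le_mu (r : R) : 0 < r < 1 -> u r <= mu.
Proof.
  intros Hr. assert (- mu <= - u r); [|lra].
  apply (rs_monotone0 (fun r => - u r) (fun r => - u1 r)); [lra| | |].
  - intros x Hx. apply (is_derive_opp u). apply (rs_u HR). lra.
  - intros x Hx. assert (Q := rs_flux_nonneg x ltac:(lra)).
    apply Rmult_le_reg_l with x; [lra|]. lra.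
  - intros eps He. destruct (rs_0 HR eps He) as [d [Hd H]].
    exists d. split; [auto|]. intros x Hx. destruct (H x Hx) as [Q _].
    replace (- u x - - mu) with (- (u x - mu)) by ring. now rewrite Rabs_Ropp.
Qed.

(** Two integrations of (r u')' = - lam h f(u) r: first - r u' <= c r^2/2, then mu - u <= c
    r^2/4. *)
Lemma rs_quadratic (c r : R) : 0 < r < 1 ->
  (forall x, 0 < x <= r -> lam * h x * f (u x) <= c) -> mu - c * r ^ 2 / 4 <= u r.
Proof.
  intros Hr Hc.
  assert (F : forall x, 0 < x <= r -> - (c * x / 2) <= u1 x).
  { intros x Hx. assert (0 <= c * x ^ 2 / 2 - - (x * u1 x)).
    { apply (rs_monotone0 (fun x => c * x ^ 2 / 2 - - (x * u1 x)) (fun x => c * x - lam * h x * f (u x) * x)); [lra| | |].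
      - intros y Hy. apply (is_derive_minus (fun x => c * x ^ 2 / 2) (fun x => - (x * u1 x))).
        + auto_derive; [auto|field].
        + apply rs_flux_deriv. lra.
      - intros y Hy. specialize (Hc y ltac:(lra)). nra.
      - intros eps He. destruct (rs_flux_0 (eps / 2) ltac:(lra)) as [d [Hd H]].
        assert (HcP : 0 < Rabs c + 1) by (generalize (Rabs_pos c); lra).
        exists (Rmin d (Rmin 1 (eps / (Rabs c + 1)))). split.
        { apply Rmin_glb_lt; [lra|]. apply Rmin_glb_lt; [lra|]. now apply Rdiv_lt_0_compat. }
        intros y Hy. assert (M1 := Rmin_l d (Rmin 1 (eps / (Rabs c + 1)))).
        assert (M2 := Rmin_r d (Rmin 1 (eps / (Rabs c + 1)))).
        assert (M3 := Rmin_l 1 (eps / (Rabs c + 1))). assert (M4 := Rmin_r 1 (eps / (Rabs c + 1))).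
        specialize (H y ltac:(lra)). rewrite Rminus_0_r in H |- *.
        assert (Rabs (c * y ^ 2 / 2) <= eps / 2).
        { replace (c * y ^ 2 / 2) with (c * (y * y / 2)) by field. rewrite Rabs_mult.
          rewrite (Rabs_pos_eq (y * y / 2)) by nra.
          assert (y * (Rabs c + 1) <= eps).
          { apply Rle_trans with (eps / (Rabs c + 1) * (Rabs c + 1)); [|right; field; lra].
            apply Rmult_le_compat_r; lra. }
          generalize (Rabs_pos c). intros. assert (y * y <= y) by nra. nra. }
        unfold Rminus. eapply Rle_trans; [apply Rabs_triang|]. rewrite (Rabs_Ropp (- _)). lra. }
    apply Rmult_le_reg_l with x; [lra|]. lra. }
  assert (mu <= u r + c * r ^ 2 / 4); [|lra].
  apply (rs_monotone0 (fun r => u r + c * r ^ 2 / 4) (fun x => u1 x + c * x / 2)); [lra| | |].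
  - intros x Hx. apply (is_derive_plus u); [apply (rs_u HR); lra|]. auto_derive; [auto|field].
  - intros x Hx. specialize (F x Hx). lra.
  - intros eps He. destruct (rs_0 HR (eps / 2) ltac:(lra)) as [d [Hd H]].
    assert (HcP : 0 < Rabs c + 1) by (generalize (Rabs_pos c); lra).
    exists (Rmin d (Rmin 1 (eps / (Rabs c + 1)))). split.
    { apply Rmin_glb_lt; [lra|]. apply Rmin_glb_lt; [lra|]. now apply Rdiv_lt_0_compat. }
    intros y Hy. assert (M1 := Rmin_l d (Rmin 1 (eps / (Rabs c + 1)))).
    assert (M2 := Rmin_r d (Rmin 1 (eps / (Rabs c + 1)))).
    assert (M3 := Rmin_l 1 (eps / (Rabs c + 1))). assert (M4 := Rmin_r 1 (eps / (Rabs c + 1))).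
    destruct (H y ltac:(lra)) as [Q _].
    assert (Rabs (c * y ^ 2 / 4) <= eps / 2).
    { replace (c * y ^ 2 / 4) with (c * (y * y / 4)) by field. rewrite Rabs_mult.
      rewrite (Rabs_pos_eq (y * y / 4)) by nra.
      assert (y * (Rabs c + 1) <= eps).
      { apply Rle_trans with (eps / (Rabs c + 1) * (Rabs c + 1)); [|right; field; lra].
        apply Rmult_le_compat_r; lra. }
      generalize (Rabs_pos c). intros. assert (y * y <= y) by nra. nra. }
    replace (u y + c * y ^ 2 / 4 - mu) with ((u y - mu) + c * y ^ 2 / 4) by ring.
    eapply Rle_trans; [apply Rabs_triang|]. lra.
Qed.

Lemma lsol_of_rsol : 
  lsol f (fun x => ln (h (exp x))) (ln lam) (fun x => u (exp x)) (fun x => - (exp x * u1 (exp x))).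
Proof.
  assert (W : forall x, x < 0 -> 0 < exp x < 1).
  { intros x Hx. split; [apply exp_pos|]. rewrite <- exp_0. now apply exp_increasing. }
  split.
  - intros x Hx. evar_last.
    + apply (is_derive_comp u exp); [apply (rs_u HR); auto|].
      apply is_derive_Reals, derivable_pt_lim_exp.
    + unfold scal; simpl; unfold mult; simpl. ring.
  - intros x Hx. evar_last.
    + apply (is_derive_comp (fun r => - (r * u1 r)) exp); [apply rs_flux_deriv; auto|].
      apply is_derive_Reals, derivable_pt_lim_exp.
    + unfold scal; simpl; unfold mult; simpl.
      replace (ln lam + 2 * x + ln (h (exp x))) with (ln lam + (x + x) + ln (h (exp x))) by ring.
      rewrite !exp_plus, !exp_ln; [ring|apply hpos; auto|apply (rs_lam HR)].
  - intros x Hx. apply rs_flux_nonneg. auto.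
  - intros x Hx. left. apply (rs_pos HR). auto.
  - intros c y Hc Hy. destruct (rs_1 HR c (exp y) Hc) as [r [Hr1 Hr2]].
    { apply W. auto. }
    assert (0 < r) by (generalize (exp_pos y); lra).
    exists (ln r). rewrite exp_ln by auto. split; [|auto]. split.
    + rewrite <- (ln_exp y). apply ln_increasing; [apply exp_pos|lra].
    + rewrite <- ln_1. apply ln_increasing; lra.
Qed.
End Radial.

(** * Convergence to the profile *)

(** For a = 2 the factor singular at 0 disappears, and the profile starts at the centre with value
    ln (8 b) and slope 0. *)
Lemma liouville_two (b s : R) : 0 < b -> 0 < s ->
  liouville 2 b s = ln (8 * b) - 2 * ln (1 + b * s ^ 2) /\ liouville1 2 b s = - (4 * b * s / (1 + b * s ^ 2)).
Proof.
  intros Hb Hs. assert (E : exp (2 * ln s) = s ^ 2).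
  { replace (2 * ln s) with (ln s + ln s) by ring. rewrite exp_plus, exp_ln by auto. ring. }
  assert (0 < b * s ^ 2) by (apply Rmult_lt_0_compat; [auto|now apply pow_lt]).
  unfold liouville, liouville1. rewrite E. split.
  - replace (2 * 2 ^ 2 * b) with (8 * b) by ring. ring.
  - field. split; lra.
Qed.

Lemma liouville_two_upper (b s : R) : 0 < b -> 0 < s -> liouville 2 b s <= ln (8 * b).
Proof.
  intros Hb Hs. destruct (liouville_two b s Hb Hs) as [-> _].
  assert (0 < b * s ^ 2) by (apply Rmult_lt_0_compat; [auto|now apply pow_lt]).
  assert (0 <= ln (1 + b * s ^ 2)) by (rewrite <- ln_1; apply ln_le; lra). lra.
Qed.

Lemma liouville_two_0 (b eta : R) : 0 < b -> 0 < eta -> exists d, 0 < d /\ forall s, 0 < s < d ->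
  Rabs (liouville 2 b s - ln (8 * b)) <= eta /\ Rabs (liouville1 2 b s) <= eta.
Proof.
  intros Hb He. exists (Rmin 1 (eta / (4 * b))). split.
  { apply Rmin_glb_lt; [lra|]. apply Rdiv_lt_0_compat; lra. }
  intros s Hs. assert (M1 := Rmin_l 1 (eta / (4 * b))). assert (M2 := Rmin_r 1 (eta / (4 * b))).
  assert (S : 4 * b * s <= eta).
  { apply Rle_trans with (4 * b * (eta / (4 * b))); [apply Rmult_le_compat_l; lra|right; field; lra]. }
  destruct (liouville_two b s Hb ltac:(lra)) as [-> ->].
  assert (Q : 0 < b * s ^ 2) by (apply Rmult_lt_0_compat; [auto|apply pow_lt; lra]).
  assert (0 <= ln (1 + b * s ^ 2)) by (rewrite <- ln_1; apply ln_le; lra).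
  assert (ln (1 + b * s ^ 2) <= b * s ^ 2).
  { apply Rle_trans with (ln (exp (b * s ^ 2))); [|rewrite ln_exp; lra].
    apply ln_le; [lra|]. left. apply exp_ineq1. lra. }
  assert (b * s ^ 2 <= b * s). { apply Rmult_le_compat_l; [lra|]. nra. }
  split.
  - replace (_ - _) with (- (2 * ln (1 + b * s ^ 2))) by ring. rewrite Rabs_Ropp, Rabs_pos_eq; lra.
  - rewrite Rabs_Ropp, Rabs_pos_eq.
    + apply Rle_trans with (4 * b * s); [|auto]. unfold Rdiv. rewrite <- (Rmult_1_r (4 * b * s)) at 2.
      apply Rmult_le_compat_l; [nra|]. rewrite <- Rinv_1. apply Rinv_le_contravar; lra.
    + apply Rmult_le_pos; [nra|]. left. apply Rinv_0_lt_compat. lra.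
Qed.

Lemma sq_le_abs (x y e : R) : 0 <= e -> x ^ 2 + y ^ 2 <= e ^ 2 -> Rabs x <= e /\ Rabs y <= e.
Proof.
  intros He H. assert (0 <= x ^ 2) by apply pow2_ge_0. assert (0 <= y ^ 2) by apply pow2_ge_0.
  split; apply Rabs_le_between; nra.
Qed.

Section Bubble.
Context {g g1 g2 : R -> R} {t0 q kap : R} (HG : growth g g1 g2 t0 q kap).
Context {f : R -> R} {Lv : R} (HF : nonlin f g t0 Lv).
Context {h h1 : R -> R} {h0 K : R} (HH : hprop h h1 h0 K).
Context {lam mu : nat -> R} {u u1 u2 : nat -> R -> R}
  (HR : forall n, rsol f h (lam n) (mu n) (u n) (u1 n) (u2 n)).
Local Notation chi := (drop_scale g g1).

(** A displacement [C / g1 V] is only [C / g V] units of [chi], so g' keeps its value at both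
    extreme heights; monotonicity of g' makes this uniform in between. *)
Lemma ratio_window (V : nat -> R) (C : R) : 0 < C -> is_lim_seq V p_infty ->
  forall eps, 0 < eps -> eventually (fun n => forall w, Rabs (g1 (V n) * (w - V n)) <= C ->
    Lv <= w /\ Rabs (g1 w / g1 (V n) - 1) <= eps).
Proof.
  intros HC HV eps He. assert (Hg := lim_g HG V HV).
  assert (Sp : is_lim_seq (fun n => C / g (V n)) 0) by (apply lim_div_inf with C; [apply is_lim_seq_const|auto]).
  assert (Sm : is_lim_seq (fun n => - C / g (V n)) 0) by (apply lim_div_inf with (- C); [apply is_lim_seq_const|auto]).
  assert (Low := drop_infty HG V _ 0 HV Sp ltac:(lra)).
  assert (ef1 : ef kap 0 = 1) by (unfold ef; rewrite Ef_0; field).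
  destruct (slow_variation HG V _ 0 HV Sp ltac:(lra)) as [_ [_ SVp]].
  destruct (slow_variation HG V _ 0 HV Sm ltac:(lra)) as [_ [_ SVm]].
  rewrite ef1 in SVp, SVm.
  assert (E1 := lim_gt _ _ (1 - eps) SVp ltac:(lra)). assert (E2 := lim_lt _ _ (1 + eps) SVm ltac:(lra)).
  assert (E3 := proj1 (lim_inf _) Low Lv). assert (Cpos := g_pos_ev HG HF V 1 HV).
  ev_use E1. ev_use E2. ev_use E3. ev_use Cpos. ev_intros n [P1 [P2 [P3 P4]]] E3 E2 E1 w Hw. cbv beta in *. assert (HLv := nl_lev HF).
  replace (C / g (V n) * chi (V n)) with (C / g1 (V n)) in E1, E3 by (unfold drop_scale; field; lra).
  replace (- C / g (V n) * chi (V n)) with (- (C / g1 (V n))) in E2 by (unfold drop_scale; field; lra).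
  assert (W : V n - C / g1 (V n) <= w <= V n - - (C / g1 (V n))).
  { apply Rabs_le_between in Hw. replace w with (V n + g1 (V n) * (w - V n) / g1 (V n)) by (field; lra).
    assert (I : 0 < / g1 (V n)) by now apply Rinv_0_lt_compat. unfold Rdiv. split; nra. }
  split; [lra|].
  assert (g1 (V n - C / g1 (V n)) <= g1 w) by (apply (g1_mono HG); lra).
  assert (g1 w <= g1 (V n - - (C / g1 (V n)))) by (apply (g1_mono HG); lra).
  assert (g1 (V n - C / g1 (V n)) / g1 (V n) <= g1 w / g1 (V n)).
  { apply Rmult_le_compat_r; [left; now apply Rinv_0_lt_compat|auto]. }
  assert (g1 w / g1 (V n) <= g1 (V n - - (C / g1 (V n))) / g1 (V n)).
  { apply Rmult_le_compat_r; [left; now apply Rinv_0_lt_compat|auto]. }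
  apply Rabs_le_between. lra.
Qed.

Section Rescaled.
Context (V gm hb : nat -> R).
(** The reference height [V], the scale [gm] and the value [hb] of the weight are kept abstract: the
    scaling is used both at the centre, with [mu] and [h0], and at a concentration point. *)
Definition rescaled (n : nat) (s : R) : R := g1 (V n) * (u n (gm n * s) - V n).
Definition rescaled1 (n : nat) (s : R) : R := g1 (V n) * gm n * u1 n (gm n * s).
Definition rescaled2 (n : nat) (s : R) : R := g1 (V n) * gm n ^ 2 * u2 n (gm n * s).
Hypothesis HV : is_lim_seq V p_infty.
Hypothesis Hhb : is_lim_seq hb h0.
Hypothesis Hgm : is_lim_seq gm 0.
Hypothesis Hnorm : eventually (fun n => 0 < gm n /\
  lam n * hb n * exp (g (V n)) * g1 (V n) * gm n ^ 2 = 1).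

Lemma rescaled_deriv (n : nat) (s : R) : 0 < gm n * s < 1 ->
  is_derive (rescaled n) s (rescaled1 n s) /\ is_derive (rescaled1 n) s (rescaled2 n s).
Proof.
  intros Hs. unfold rescaled, rescaled1, rescaled2. split.
  - evar_last.
    + apply (is_derive_scal (fun s => u n (gm n * s) - V n)).
      apply (is_derive_minus (fun s => u n (gm n * s)) (fun _ => V n)); [|apply is_derive_const].
      apply (is_derive_comp (u n) (fun s => gm n * s)); [apply (rs_u (HR n)); auto|].
      instantiate (1 := gm n). auto_derive; [auto|ring].
    + unfold scal, minus, plus, opp, zero; simpl; unfold mult; simpl. ring.
  - evar_last.
    + apply (is_derive_scal (fun s => u1 n (gm n * s))).
      apply (is_derive_comp (u1 n) (fun s => gm n * s)); [apply (rs_u1 (HR n)); auto|].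
      instantiate (1 := gm n). auto_derive; [auto|ring].
    + unfold scal; simpl; unfold mult; simpl. ring.
Qed.

(** Two errors separate the rescaled equation from Liouville's: the quotient [h r / hb n], and g(u)
    - g(V) against its linearisation. [P] covers windows away from 0 as well as those reaching the
    centre. *)
Lemma ode_err (be C : R) (P : nat -> R -> Prop) : 0 < C ->
  eventually (fun n => forall s, P n s -> 0 < s <= be /\ Rabs (rescaled n s) <= C) ->
  forall eps, 0 < eps -> eventually (fun n => forall s, P n s ->
    0 < gm n * s < 1 /\ Rabs (rescaled n s) <= C /\ Rabs (rescaled2 n s + rescaled1 n s / s + exp (rescaled n s)) <= eps).
Proof.
  intros HC HP eps He.
  set (E0 := exp (C + C)). assert (HE0 : 0 < E0) by apply exp_pos.
  set (e1 := Rmin 1 (eps / (2 * E0 * C))). assert (He1 : 0 < e1).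
  { unfold e1. apply Rmin_glb_lt; [lra|]. apply Rdiv_lt_0_compat; [lra|]. apply Rmult_lt_0_compat; lra. }
  set (e3 := h0 * eps / (8 * E0)). assert (Hh0 := hp_h0 HH).
  assert (He3 : 0 < e3). { apply Rdiv_lt_0_compat; [|lra]. apply Rmult_lt_0_compat; lra. }
  destruct (hp_0 HH e3 He3) as [d [Hd Hd']].
  assert (RW := ratio_window V C HC HV e1 He1). assert (Cpos := g_pos_ev HG HF V 1 HV).
  assert (Q1 := proj1 (lim_eps _ _) Hhb e3 He3). assert (Q2 := lim_gt _ _ (h0 / 2) Hhb ltac:(lra)).
  assert (Gb : is_lim_seq (fun n => gm n * be) 0).
  { replace (Finite 0) with (Finite (0 * be)) by (f_equal; ring). apply is_lim_seq_mult'; [auto|apply is_lim_seq_const]. }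
  assert (Q3 := lim_lt _ _ (Rmin d 1) Gb ltac:(apply Rmin_glb_lt; lra)).
  ev_use RW. ev_use Cpos. ev_use Q1. ev_use Q2. ev_use Q3. ev_use HP. ev_keep Hnorm.
  ev_intros n [Gp No] HP Q3 Q2 Q1 [P1 [P2 [P3 P4]]] RW s Hs.
  destruct (HP s Hs) as [Hs1 Hz]. cbv beta in *.
  assert (M1 := Rmin_l d 1). assert (M2 := Rmin_r d 1).
  assert (gs : 0 < gm n * s <= gm n * be).
  { split; [apply Rmult_lt_0_compat; lra|]. apply Rmult_le_compat_l; lra. }
  split; [lra|]. split; [auto|].
  specialize (Hd' (gm n * s) ltac:(lra)).
  set (r := gm n * s) in *. set (U := u n r).
  assert (HLv := nl_lev HF).
  assert (Ez : rescaled n s = g1 (V n) * (U - V n)) by reflexivity.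
  destruct (RW U) as [UL Ur]; [rewrite <- Ez; auto|].
  set (z := rescaled n s) in *. apply Rabs_le_between in Hz.
  assert (Rat : (1 - e1) * g1 (V n) <= g1 U <= (1 + e1) * g1 (V n)).
  { apply Rabs_le_between in Ur. replace (g1 U) with (g1 U / g1 (V n) * g1 (V n)) by (field; lra).
    split; apply Rmult_le_compat_r; lra. }
  set (w := g U - g (V n)).
  (* Convexity of g: it lies above its tangent at [V n], and the excess is at most the relative
     variation of g' times [C]. *)
  assert (Hw : 0 <= w - z <= e1 * C).
  { unfold w. destruct (Rle_dec (V n) U) as [HU|HU].
    - assert (A1 := g_lower HG (V n) U ltac:(lra) HU). assert (A2 := g_upper HG (V n) U ltac:(lra) HU).
      split; [lra|].
      assert (g1 U * (U - V n) <= (1 + e1) * g1 (V n) * (U - V n)) by (apply Rmult_le_compat_r; lra).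
      assert (X : (1 + e1) * g1 (V n) * (U - V n) = z + e1 * z) by (rewrite Ez; ring).
      assert (e1 * z <= e1 * C) by (apply Rmult_le_compat_l; lra). lra.
    - assert (A1 := g_lower HG U (V n) ltac:(lra) ltac:(lra)). assert (A2 := g_upper HG U (V n) ltac:(lra) ltac:(lra)).
      split; [lra|].
      assert ((1 - e1) * g1 (V n) * (V n - U) <= g1 U * (V n - U)) by (apply Rmult_le_compat_r; lra).
      assert (X : (1 - e1) * g1 (V n) * (V n - U) = - z + e1 * z) by (rewrite Ez; ring).
      assert (e1 * (- z) <= e1 * C) by (apply Rmult_le_compat_l; lra). lra. }
  assert (e1a : e1 <= 1) by apply Rmin_l.
  assert (e1b : e1 * C * E0 <= eps / 2).
  { apply Rle_trans with (eps / (2 * E0 * C) * C * E0).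
    - apply Rmult_le_compat_r; [lra|]. apply Rmult_le_compat_r; [lra|]. apply Rmin_r.
    - right. field. split; lra. }
  assert (wb : w <= C + C) by nra.
  assert (Eq : rescaled2 n s + rescaled1 n s / s = - (h r / hb n * exp w)).
  { unfold rescaled2, rescaled1. fold r.
    replace (g1 (V n) * gm n ^ 2 * u2 n r + g1 (V n) * gm n * u1 n r / s) with
      (g1 (V n) * gm n ^ 2 * (u2 n r + u1 n r / r)) by (unfold r; field; split; lra).
    rewrite (rs_eq (HR n)) by lra. fold U.
    rewrite (nl_eq HF U) by lra. unfold w, Rminus. rewrite exp_plus, exp_Ropp.
    assert (ep := exp_pos (g (V n))).
    replace (g1 (V n) * gm n ^ 2 * - (lam n * h r * exp (g U))) with
      (- (h r / hb n * (exp (g U) * / exp (g (V n)))) * (lam n * hb n * exp (g (V n)) * g1 (V n) * gm n ^ 2))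
      by (field; lra).
    rewrite No. ring. }
  rewrite Eq. replace (- (h r / hb n * exp w) + exp z) with (- ((h r / hb n - 1) * exp w + (exp w - exp z))) by ring.
  rewrite Rabs_Ropp. eapply Rle_trans; [apply Rabs_triang|].
  assert (T1 : Rabs ((h r / hb n - 1) * exp w) <= eps / 2).
  { rewrite Rabs_mult, (Rabs_pos_eq (exp w)) by (left; apply exp_pos).
    apply Rle_trans with (4 * e3 / h0 * E0).
    - apply Rmult_le_compat; [apply Rabs_pos|left; apply exp_pos| |now apply exp_le].
      replace (h r / hb n - 1) with ((h r - h0 + (h0 - hb n)) / hb n) by (field; lra).
      unfold Rdiv. rewrite Rabs_mult, (Rabs_pos_eq (/ hb n)) by (left; apply Rinv_0_lt_compat; lra).
      apply Rle_trans with ((e3 + e3) * / (h0 / 2)); [|right; field; lra].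
      apply Rmult_le_compat; [apply Rabs_pos|left; apply Rinv_0_lt_compat; lra| |apply Rinv_le_contravar; lra].
      eapply Rle_trans; [apply Rabs_triang|]. rewrite (Rabs_minus_sym h0). lra.
    - right. unfold e3. field. split; lra. }
  assert (T2 : Rabs (exp w - exp z) <= eps / 2).
  { eapply Rle_trans; [apply (exp_lip (C + C)); lra|]. fold E0. rewrite (Rabs_pos_eq (w - z)) by lra.
    apply Rle_trans with (e1 * C * E0); [|auto]. rewrite Rmult_comm. apply Rmult_le_compat_r; lra. }
  lra.
Qed.

Lemma diff_eq (a b M s e : R) (N : nat) : 0 < a -> 0 < b -> 0 < s ->
  rescaled N s <= M -> liouville a b s <= M ->
  Rabs (rescaled2 N s + rescaled1 N s / s + exp (rescaled N s)) <= e ->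
  Rabs ((rescaled2 N s - liouville2 a b s) + (rescaled1 N s - liouville1 a b s) / s) <= exp M * Rabs (rescaled N s - liouville a b s) + e.
Proof.
  intros Ha Hb Hs H1 H2 H3.
  replace ((rescaled2 N s - liouville2 a b s) + (rescaled1 N s - liouville1 a b s) / s) with
    ((rescaled2 N s + rescaled1 N s / s + exp (rescaled N s)) + (exp (liouville a b s) - exp (rescaled N s))).
  2:{ unfold liouville2. field. lra. }
  eapply Rle_trans; [apply Rabs_triang|].
  assert (Q := exp_lip M (liouville a b s) (rescaled N s) H2 H1). rewrite (Rabs_minus_sym (liouville a b s)) in Q. lra.
Qed.

Lemma diff_second (a b M e e1 al s : R) (N : nat) : 0 < al -> al <= s ->
  Rabs ((rescaled2 N s - liouville2 a b s) + (rescaled1 N s - liouville1 a b s) / s) <= exp M * Rabs (rescaled N s - liouville a b s) + e ->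
  Rabs (rescaled N s - liouville a b s) <= e1 -> Rabs (rescaled1 N s - liouville1 a b s) <= e1 ->
  Rabs (rescaled2 N s - liouville2 a b s) <= e1 / al + exp M * e1 + e.
Proof.
  intros Hal Hs H1 H2 H3.
  replace (rescaled2 N s - liouville2 a b s) with (((rescaled2 N s - liouville2 a b s) + (rescaled1 N s - liouville1 a b s) / s) + - ((rescaled1 N s - liouville1 a b s) / s)) by ring.
  eapply Rle_trans; [apply Rabs_triang|]. rewrite Rabs_Ropp. unfold Rdiv at 2. rewrite Rabs_mult.
  rewrite (Rabs_pos_eq (/ s)) by (left; apply Rinv_0_lt_compat; lra).
  assert (Rabs (rescaled1 N s - liouville1 a b s) * / s <= e1 * / al).
  { apply Rmult_le_compat; [apply Rabs_pos|left; apply Rinv_0_lt_compat; lra|auto|apply Rinv_le_contravar; lra]. }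
  assert (exp M * Rabs (rescaled N s - liouville a b s) <= exp M * e1) by (apply Rmult_le_compat_l; [left; apply exp_pos|auto]).
  unfold Rdiv. lra.
Qed.

(** The rescaled solution and the profile have nearly the same Cauchy data at [s0 n]; Gronwall
    propagates this to the right and to the left, away from the singular point 0. Closeness of the
    second derivatives follows from the equations. *)
Lemma bubble_mid (a b al be si C : R) (s0 : nat -> R) :
  0 < a <= 2 -> 0 < b -> 0 < al < si -> si < be -> 0 < C -> is_lim_seq s0 si ->
  eventually (fun n => forall s, al <= s <= be -> Rabs (rescaled n s) <= C) ->
  is_lim_seq (fun n => rescaled n (s0 n)) (liouville a b si) ->
  is_lim_seq (fun n => rescaled1 n (s0 n)) (liouville1 a b si) ->
  forall eps, 0 < eps -> eventually (fun n => forall s, al <= s <= be ->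
    Rabs (rescaled n s - liouville a b s) <= eps /\ Rabs (rescaled1 n s - liouville1 a b s) <= eps /\ Rabs (rescaled2 n s - liouville2 a b s) <= eps).
Proof.
  intros Ha Hb Hal Hbe HC Hs0 Hzb Hz0 Hz1 eps He.
  set (M := Rmax C (ln (2 * a ^ 2 * b) + 2 * (Rabs (ln al) + Rabs (ln be)))).
  set (eM := exp M). assert (HeM : 0 < eM) by apply exp_pos.
  (* [KK] is the Gronwall factor in either direction, [e1] the closeness of values and slopes that
     suffices for the second derivatives, and [ee] the size of data and equation errors that
     produces [e1]. *)
  set (KK := exp ((2 + eM + 2 / al) * be)). assert (HKK : 0 < KK) by apply exp_pos.
  assert (Hal2 : 0 < 2 / al) by (apply Rdiv_lt_0_compat; lra).
  set (e1 := Rmin (eps / 4) (Rmin (eps * al / 4) (eps / (4 * eM)))).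
  assert (He1 : 0 < e1 /\ e1 <= eps / 4 /\ e1 <= eps * al / 4 /\ e1 <= eps / (4 * eM)).
  { unfold e1. split; [|split; [apply Rmin_l|split; (eapply Rle_trans; [apply Rmin_r|])]].
    - apply Rmin_glb_lt; [lra|]. apply Rmin_glb_lt; [nra|]. apply Rdiv_lt_0_compat; lra.
    - apply Rmin_l.
    - apply Rmin_r. }
  set (ee := Rmin (eps / 4) (e1 / (2 * (1 + KK)))).
  assert (Hee : 0 < ee /\ ee <= eps / 4 /\ ee <= e1 / (2 * (1 + KK))).
  { unfold ee. split; [apply Rmin_glb_lt; [lra|]|split; [apply Rmin_l|apply Rmin_r]]. apply Rdiv_lt_0_compat; lra. }
  assert (small : 3 * ee ^ 2 * KK <= e1 ^ 2).
  { assert (ee * (2 * (1 + KK)) <= e1).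
    { apply Rle_trans with (e1 / (2 * (1 + KK)) * (2 * (1 + KK))); [apply Rmult_le_compat_r; lra|right; field; lra]. }
    assert (ee ^ 2 * (2 * (1 + KK)) ^ 2 <= e1 ^ 2). { rewrite <- Rpow_mult_distr. apply pow_incr. nra. }
    assert (3 * KK <= (2 * (1 + KK)) ^ 2) by nra. assert (0 <= ee ^ 2) by apply pow2_ge_0. nra. }
  assert (OE := ode_err be C (fun n s => al <= s <= be) HC).
  assert (OE' : eventually (fun n => forall s, al <= s <= be ->
    0 < gm n * s < 1 /\ Rabs (rescaled n s) <= C /\ Rabs (rescaled2 n s + rescaled1 n s / s + exp (rescaled n s)) <= ee)).
  { apply OE; [|lra]. ev_use Hzb. ev_intros n Hz s Hs. split; [lra|auto]. }
  assert (D0 : is_lim_seq (fun n => rescaled n (s0 n) - liouville a b (s0 n)) 0).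
  { replace (Finite 0) with (Finite (liouville a b si - liouville a b si)) by (f_equal; ring).
    apply is_lim_seq_minus'; [auto|]. apply is_lim_seq_continuous; [|auto].
    eapply deriv_cont. apply liouville_deriv; lra. }
  assert (D1 : is_lim_seq (fun n => rescaled1 n (s0 n) - liouville1 a b (s0 n)) 0).
  { replace (Finite 0) with (Finite (liouville1 a b si - liouville1 a b si)) by (f_equal; ring).
    apply is_lim_seq_minus'; [auto|]. apply is_lim_seq_continuous; [|auto].
    eapply deriv_cont. apply liouville1_deriv; lra. }
  assert (E1 := proj1 (lim_eps _ _) D0 ee ltac:(lra)). assert (E2 := proj1 (lim_eps _ _) D1 ee ltac:(lra)).
  assert (E3 := lim_gt _ _ al Hs0 ltac:(lra)). assert (E4 := lim_lt _ _ be Hs0 ltac:(lra)).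
  ev_use E1. ev_use E2. ev_use E3. ev_use E4. ev_use OE'. clear OE. ev_intros n OE E4 E3 E2 E1. rewrite Rminus_0_r in E1, E2.
  set (D := fun s => rescaled n s - liouville a b s). set (DD := fun s => rescaled1 n s - liouville1 a b s).
  set (DDD := fun s => rescaled2 n s - liouville2 a b s).
  assert (HD : forall s, al <= s <= be -> is_derive D s (DD s)).
  { intros s Hs. apply (is_derive_minus (rescaled n)); [apply rescaled_deriv; apply OE; auto|apply liouville_deriv; lra]. }
  assert (HDD : forall s, al <= s <= be -> is_derive DD s (DDD s)).
  { intros s Hs. apply (is_derive_minus (rescaled1 n)); [apply rescaled_deriv; apply OE; auto|apply liouville1_deriv; lra]. }
  assert (HE : forall s, al <= s <= be -> Rabs (DDD s + DD s / s) <= eM * Rabs (D s) + ee).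
  { intros s Hs. destruct (OE s Hs) as [_ [B1 B2]]. apply Rabs_le_between in B1.
    assert (R1 : C <= M) by apply Rmax_l.
    assert (R2 : ln (2 * a ^ 2 * b) + 2 * (Rabs (ln al) + Rabs (ln be)) <= M) by apply Rmax_r.
    apply diff_eq; auto; try lra.
    eapply Rle_trans; [apply (liouville_upper a b al be); lra|auto]. }
  assert (I0 : D (s0 n) ^ 2 + DD (s0 n) ^ 2 + ee ^ 2 <= 3 * ee ^ 2).
  { assert (D (s0 n) ^ 2 <= ee ^ 2) by (rewrite <- pow2_abs; apply pow_incr; split; [apply Rabs_pos|exact E1]).
    assert (DD (s0 n) ^ 2 <= ee ^ 2) by (rewrite <- pow2_abs; apply pow_incr; split; [apply Rabs_pos|exact E2]). lra. }
  assert (I0' : 0 <= D (s0 n) ^ 2 + DD (s0 n) ^ 2 + ee ^ 2).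
  { generalize (pow2_ge_0 (D (s0 n))) (pow2_ge_0 (DD (s0 n))) (pow2_ge_0 ee). lra. }
  assert (Main : forall s, al <= s <= be -> Rabs (D s) <= e1 /\ Rabs (DD s) <= e1).
  { intros s Hs. apply sq_le_abs; [lra|]. eapply Rle_trans; [|exact small].
    destruct (Rle_dec (s0 n) s) as [Hle|Hle].
    - eapply Rle_trans; [apply (radial_gron_fwd D DD DDD (s0 n) s eM ee); try lra|].
      + intros; apply HD; lra.
      + intros; apply HDD; lra.
      + intros; apply HE; lra.
      + apply Rmult_le_compat; [auto|left; apply exp_pos|auto|].
        apply exp_le. apply Rmult_le_compat; lra.
    - eapply Rle_trans; [apply (radial_gron_bwd D DD DDD s (s0 n) eM ee); try lra|].
      + intros; apply HD; lra.
      + intros; apply HDD; lra.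
      + intros; apply HE; lra.
      + apply Rmult_le_compat; [auto|left; apply exp_pos|auto|].
        apply exp_le. assert (2 / s <= 2 / al).
        { apply Rmult_le_compat_l; [lra|]. apply Rinv_le_contravar; lra. }
        assert (0 < 2 / s) by (apply Rdiv_lt_0_compat; lra).
        apply Rmult_le_compat; lra. }
  intros s Hs. destruct (Main s Hs) as [M1 M2]. split; [unfold D in M1; lra|]. split; [unfold DD in M2; lra|].
  eapply Rle_trans; [apply (diff_second a b M ee e1 al); try lra; auto|].
  - apply HE; auto.
  - fold eM. assert (e1 / al <= eps / 4).
    { apply Rmult_le_reg_r with al; [lra|]. unfold Rdiv at 1. rewrite Rmult_assoc, Rinv_l by lra. lra. }
    assert (eM * e1 <= eps / 4).
    { apply Rle_trans with (eM * (eps / (4 * eM))); [apply Rmult_le_compat_l; lra|right; field; lra]. }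
    lra.
Qed.

(** The version reaching the centre. Data are compared at a point [s0] near 0 that depends on [n];
    this is harmless because the outward Gronwall factor does not depend on the starting point. *)
Lemma bubble_zero (b be C : R) : 0 < b -> 0 < be -> 0 < C ->
  eventually (fun n => forall s, 0 < s <= be -> Rabs (rescaled n s) <= C) ->
  is_lim_seq (fun n => g1 (V n) * (mu n - V n)) (ln (8 * b)) ->
  forall eps, 0 < eps -> eventually (fun n => forall s, 0 < s <= be ->
    Rabs (rescaled n s - liouville 2 b s) <= eps /\ Rabs (rescaled1 n s - liouville1 2 b s) <= eps /\ Rabs (rescaled2 n s - liouville2 2 b s) <= eps).
Proof.
  intros Hb Hbe HC Hzb Hz0 eps He.
  set (M := Rmax C (ln (8 * b))).
  set (eM := exp M). assert (HeM : 0 < eM) by apply exp_pos.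
  set (KK := exp ((2 + eM) * be)). assert (HKK : 0 < KK) by apply exp_pos.
  set (e1 := Rmin (eps / 4) (eps / (8 * eM))).
  assert (He1 : 0 < e1 /\ e1 <= eps / 4 /\ e1 <= eps / (8 * eM)).
  { unfold e1. split; [|split; [apply Rmin_l|apply Rmin_r]].
    apply Rmin_glb_lt; [lra|]. apply Rdiv_lt_0_compat; lra. }
  set (ee := Rmin (eps / 8) (e1 / (4 * (1 + KK)))).
  assert (Hee : 0 < ee /\ ee <= eps / 8 /\ ee <= e1 / (4 * (1 + KK))).
  { unfold ee. split; [apply Rmin_glb_lt; [lra|]|split; [apply Rmin_l|apply Rmin_r]]. apply Rdiv_lt_0_compat; lra. }
  assert (small : 10 * ee ^ 2 * KK <= e1 ^ 2).
  { assert (ee * (4 * (1 + KK)) <= e1).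
    { apply Rle_trans with (e1 / (4 * (1 + KK)) * (4 * (1 + KK))); [apply Rmult_le_compat_r; lra|right; field; lra]. }
    assert (ee ^ 2 * (4 * (1 + KK)) ^ 2 <= e1 ^ 2). { rewrite <- Rpow_mult_distr. apply pow_incr. nra. }
    assert (10 * KK <= (4 * (1 + KK)) ^ 2) by nra. assert (0 <= ee ^ 2) by apply pow2_ge_0. nra. }
  assert (OE' : eventually (fun n => forall s, 0 < s <= be ->
    0 < gm n * s < 1 /\ Rabs (rescaled n s) <= C /\ Rabs (rescaled2 n s + rescaled1 n s / s + exp (rescaled n s)) <= ee)).
  { apply (ode_err be C (fun n s => 0 < s <= be) HC); [|lra]. ev_use Hzb. ev_intros n Hz s Hs. split; [lra|auto]. }
  assert (E1 := proj1 (lim_eps _ _) Hz0 ee ltac:(lra)).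
  assert (Cpos := g_pos_ev HG HF V 1 HV).
  ev_use E1. ev_use OE'. ev_keep Hnorm. ev_use Cpos. ev_intros n [_ [_ [_ Gp]]] [gp _] OE E1.
  set (D := fun s => rescaled n s - liouville 2 b s). set (DD := fun s => rescaled1 n s - liouville1 2 b s).
  set (DDD := fun s => rescaled2 n s - liouville2 2 b s).
  assert (HD : forall s, 0 < s <= be -> is_derive D s (DD s)).
  { intros s Hs. apply (is_derive_minus (rescaled n)); [apply rescaled_deriv; apply OE; auto|apply liouville_deriv; lra]. }
  assert (HDD : forall s, 0 < s <= be -> is_derive DD s (DDD s)).
  { intros s Hs. apply (is_derive_minus (rescaled1 n)); [apply rescaled_deriv; apply OE; auto|apply liouville1_deriv; lra]. }
  assert (HE : forall s, 0 < s <= be -> Rabs (DDD s + DD s / s) <= eM * Rabs (D s) + ee).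
  { intros s Hs. destruct (OE s Hs) as [_ [B1 B2]]. apply Rabs_le_between in B1.
    assert (R1 : C <= M) by apply Rmax_l. assert (R2 : ln (8 * b) <= M) by apply Rmax_r.
    apply diff_eq; auto; try lra. eapply Rle_trans; [apply liouville_two_upper; lra|auto]. }
  (* The values differ at 0 by a fixed small amount, since the height [mu n] matches only in the
     limit; the slopes both vanish at 0, so their difference can be made as small as desired. *)
  assert (Init : forall eta, 0 < eta -> exists d, 0 < d /\ forall s, 0 < s < d -> Rabs (D s) <= 2 * ee /\ Rabs (DD s) <= eta).
  { intros eta Heta.
    destruct (liouville_two_0 b (Rmin (ee / 2) (eta / 2)) Hb ltac:(apply Rmin_glb_lt; lra)) as [d1 [Hd1 P1]].
    set (w := Rmin (ee / 2 / g1 (V n)) (eta / 2 / (g1 (V n) * gm n))).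
    assert (Hw : 0 < w). { apply Rmin_glb_lt; apply Rdiv_lt_0_compat; try lra. apply Rmult_lt_0_compat; lra. }
    destruct (rs_0 (HR n) w Hw) as [d2 [Hd2 P2]].
    exists (Rmin d1 (d2 / gm n)). split. { apply Rmin_glb_lt; [auto|]. now apply Rdiv_lt_0_compat. }
    intros s Hs. assert (M1 := Rmin_l d1 (d2 / gm n)). assert (M2 := Rmin_r d1 (d2 / gm n)).
    destruct (P1 s ltac:(lra)) as [Q1 Q2].
    assert (N1 := Rmin_l (ee / 2) (eta / 2)). assert (N2 := Rmin_r (ee / 2) (eta / 2)).
    assert (gs : 0 < gm n * s < d2).
    { split; [apply Rmult_lt_0_compat; lra|]. apply Rlt_le_trans with (gm n * (d2 / gm n)); [apply Rmult_lt_compat_l; lra|].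
      right. field. lra. }
    destruct (P2 (gm n * s) gs) as [Q3 Q4].
    assert (W1 : w <= ee / 2 / g1 (V n)) by apply Rmin_l.
    assert (W2 : w <= eta / 2 / (g1 (V n) * gm n)) by apply Rmin_r.
    split.
    - unfold D, rescaled. replace (g1 (V n) * (u n (gm n * s) - V n) - liouville 2 b s) with
       (g1 (V n) * (u n (gm n * s) - mu n) + ((g1 (V n) * (mu n - V n) - ln (8 * b)) + - (liouville 2 b s - ln (8 * b)))) by ring.
      eapply Rle_trans; [apply Rabs_triang|].
      eapply Rle_trans; [apply Rplus_le_compat_l; apply Rabs_triang|]. rewrite Rabs_Ropp.
      rewrite Rabs_mult, (Rabs_pos_eq (g1 (V n))) by lra.
      assert (g1 (V n) * Rabs (u n (gm n * s) - mu n) <= ee / 2).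
      { apply Rle_trans with (g1 (V n) * (ee / 2 / g1 (V n))); [apply Rmult_le_compat_l; lra|right; field; lra]. }
      lra.
    - unfold DD, rescaled1. unfold Rminus. eapply Rle_trans; [apply Rabs_triang|]. rewrite Rabs_Ropp.
      rewrite Rabs_mult, (Rabs_pos_eq (g1 (V n) * gm n)) by (apply Rmult_le_pos; lra).
      assert (g1 (V n) * gm n * Rabs (u1 n (gm n * s)) <= eta / 2).
      { apply Rle_trans with (g1 (V n) * gm n * (eta / 2 / (g1 (V n) * gm n))).
        - apply Rmult_le_compat_l; [apply Rmult_le_pos; lra|lra].
        - right; field; lra. }
      lra. }
  assert (Main : forall s, 0 < s <= be -> Rabs (D s) <= e1 /\ Rabs (DD s) <= e1).
  { intros s Hs. apply sq_le_abs; [lra|]. eapply Rle_trans; [|exact small].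
    destruct (Init ee ltac:(lra)) as [d [Hd Hd']].
    set (s0 := Rmin (d / 2) s). assert (Hs0 : 0 < s0 <= s /\ s0 < d).
    { unfold s0. split; [split|]; [apply Rmin_glb_lt; lra|apply Rmin_r|].
      generalize (Rmin_l (d / 2) s). lra. }
    destruct (Hd' s0 ltac:(lra)) as [Q1 Q2].
    assert (I1 : D s0 ^ 2 <= (2 * ee) ^ 2) by (rewrite <- pow2_abs; apply pow_incr; split; [apply Rabs_pos|exact Q1]).
    assert (I2 : DD s0 ^ 2 <= ee ^ 2) by (rewrite <- pow2_abs; apply pow_incr; split; [apply Rabs_pos|exact Q2]).
    assert (I3 := pow2_ge_0 (D s0)). assert (I4 := pow2_ge_0 (DD s0)). assert (I5 := pow2_ge_0 ee).
    eapply Rle_trans; [apply (radial_gron_fwd D DD DDD s0 s eM ee); try lra|].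
    - intros; apply HD; lra.
    - intros; apply HDD; lra.
    - intros; apply HE; lra.
    - apply Rmult_le_compat; [lra|left; apply exp_pos|nra|].
      apply exp_le. apply Rmult_le_compat; lra. }
  (* The second derivative involves DD/s, for which a small DD is not enough. Integrating (s DD)'
     from near 0 gives the missing factor [s]. *)
  assert (Flux : forall s, 0 < s <= be -> Rabs (DD s) <= s * (eM * e1 + ee)).
  { set (BB := eM * e1 + ee). assert (HBB : 0 < BB). { unfold BB. assert (0 < eM * e1) by (apply Rmult_lt_0_compat; lra). lra. }
    intros s Hs. apply Rmult_le_reg_l with s; [lra|].
    destruct (Init (s * BB / 2) ltac:(nra)) as [d [Hd Hd']].
    set (s0 := Rmin (d / 2) s). assert (Hs0 : 0 < s0 <= s /\ s0 < d).
    { unfold s0. split; [split|]; [apply Rmin_glb_lt; lra|apply Rmin_r|].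
      generalize (Rmin_l (d / 2) s). lra. }
    destruct (Hd' s0 ltac:(lra)) as [_ Q2].
    assert (FD : forall x, s0 <= x <= s -> is_derive (fun x => x * DD x) x (x * (DDD x + DD x / x))).
    { intros x Hx. evar_last.
      - apply (is_derive_mult (fun x => x) DD); [apply is_derive_id|apply HDD; lra|intros; apply Rmult_comm].
      - unfold plus, mult, one; simpl. field. lra. }
    assert (FB : forall x, s0 <= x <= s -> Rabs (x * (DDD x + DD x / x)) <= x * BB).
    { intros x Hx. rewrite Rabs_mult, (Rabs_pos_eq x) by lra. apply Rmult_le_compat_l; [lra|].
      eapply Rle_trans; [apply HE; lra|]. unfold BB. destruct (Main x ltac:(lra)) as [Q _].
      assert (eM * Rabs (D x) <= eM * e1) by (apply Rmult_le_compat_l; lra). lra. }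
    assert (U1 : s * DD s - BB * s ^ 2 / 2 <= s0 * DD s0 - BB * s0 ^ 2 / 2).
    { apply (decr_le (fun x => x * DD x - BB * x ^ 2 / 2) (fun x => x * (DDD x + DD x / x) - BB * x)); [lra| |].
      - intros x Hx. apply (is_derive_minus (fun x => x * DD x)); [apply FD; auto|]. auto_derive; [auto|field].
      - intros x Hx. specialize (FB x Hx). apply Rabs_le_between in FB. lra. }
    assert (U2 : s0 * DD s0 + BB * s0 ^ 2 / 2 <= s * DD s + BB * s ^ 2 / 2).
    { apply (incr_le0 (fun x => x * DD x + BB * x ^ 2 / 2) (fun x => x * (DDD x + DD x / x) + BB * x)); [lra| |].
      - intros x Hx. apply (is_derive_plus (fun x => x * DD x)); [apply FD; auto|]. auto_derive; [auto|field].
      - intros x Hx. specialize (FB x Hx). apply Rabs_le_between in FB. lra. }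
    assert (Q3 : Rabs (s0 * DD s0) <= s * (s * BB / 2)).
    { rewrite Rabs_mult, Rabs_pos_eq by lra. apply Rmult_le_compat; [lra|apply Rabs_pos|lra|auto]. }
    rewrite <- (Rabs_pos_eq s) at 1 by lra. rewrite <- Rabs_mult.
    apply Rabs_le_between in Q3. apply Rabs_le_between.
    assert (0 <= BB * s0 ^ 2 / 2). { assert (0 <= BB * s0 ^ 2) by (apply Rmult_le_pos; [lra|apply pow2_ge_0]). lra. }
    split; nra. }
  intros s Hs. destruct (Main s Hs) as [M1 M2]. split; [unfold D in M1; lra|]. split; [unfold DD in M2; lra|].
  assert (M3 := HE s Hs). fold (DDD s). assert (M4 := Flux s Hs).
  replace (DDD s) with ((DDD s + DD s / s) + - (DD s / s)) by ring.
  eapply Rle_trans; [apply Rabs_triang|]. rewrite Rabs_Ropp.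
  assert (Rabs (DD s / s) <= eM * e1 + ee).
  { unfold Rdiv. rewrite Rabs_mult, (Rabs_pos_eq (/ s)) by (left; apply Rinv_0_lt_compat; lra).
    apply Rmult_le_reg_r with s; [lra|]. rewrite Rmult_assoc, Rinv_l by lra. lra. }
  assert (eM * Rabs (D s) <= eM * e1) by (apply Rmult_le_compat_l; lra).
  assert (eM * e1 <= eps / 8).
  { apply Rle_trans with (eM * (eps / (8 * eM))); [apply Rmult_le_compat_l; lra|right; field; lra]. }
  lra.
Qed.

End Rescaled.
End Bubble.

(** * Concentration points *)

Section Concentration.
Context {g g1 g2 : R -> R} {t0 q kap : R} (HG : growth g g1 g2 t0 q kap).
Context {f : R -> R} {Lv : R} (HF : nonlin f g t0 Lv).
Context {h h1 : R -> R} {h0 K : R} (HH : hprop h h1 h0 K).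
Context {lam mu : nat -> R} {u u1 u2 : nat -> R -> R}
  (HR : forall n, rsol f h (lam n) (mu n) (u n) (u1 n) (u2 n)).
Context (Hmu : is_lim_seq mu p_infty).
Local Notation chi := (drop_scale g g1).
Local Notation vv := (fun n x => u n (exp x)).
Local Notation mm := (fun n x => - (exp x * u1 n (exp x))).
Local Notation A := (@Afun g g1 (fun x => ln (h (exp x))) (fun n => ln (lam n)) vv).

Lemma fpos_nl (x : R) : 0 <= x -> 0 <= f x.
Proof. apply (nl_pos HF). Qed.

Lemma sol_log (n : nat) : lsol f (fun x => ln (h (exp x))) (ln (lam n)) (vv n) (mm n).
Proof. exact (lsol_of_rsol (HR n) (hp_pos HH) fpos_nl). Qed.

Lemma exp_neg_01 (x : R) : x < 0 -> 0 < exp x < 1.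
Proof. intros Hx. split; [apply exp_pos|]. rewrite <- exp_0. now apply exp_increasing. Qed.

Lemma drop_ratio (V w : nat -> R) (s : R) : is_lim_seq V p_infty -> kap * s < 1 ->
  is_lim_seq (fun n => (V n - w n) / chi (V n)) s ->
  is_lim_seq w p_infty /\
  is_lim_seq (fun n => chi (w n) / chi (V n)) (1 - kap * s) /\
  is_lim_seq (fun n => g (w n) / g (V n)) (Ef kap s) /\
  is_lim_seq (fun n => g1 (w n) / g1 (V n)) (ef kap s).
Proof.
  intros HV Hs Hw. assert (Cpos := g_pos_ev HG HF V 1 HV).
  assert (Eq : eventually (fun n => V n - (V n - w n) / chi (V n) * chi (V n) = w n)).
  { ev_use Cpos. ev_intros n [P1 [P2 [P3 P4]]].
    assert (0 < chi (V n)) by (apply Rdiv_lt_0_compat; lra). field. lra. }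
  destruct (slow_variation HG V _ s HV Hw Hs) as [S1 [S2 S3]].
  assert (S0 := drop_infty HG V _ s HV Hw Hs).
  split; [|split; [|split]].
  - apply lim_ext_ev with (1 := S0). exact Eq.
  - apply lim_ext_ev with (1 := S1). ev_use Eq. ev_intros n ->. reflexivity.
  - apply lim_ext_ev with (1 := S2). ev_use Eq. ev_intros n ->. reflexivity.
  - apply lim_ext_ev with (1 := S3). ev_use Eq. ev_intros n ->. reflexivity.
Qed.

(** At a distance of order 1/g'(V), the increment of g is caught by convexity between g'(V)(w - V)
    and g'(w)(w - V), and the two slopes agree in the limit. *)
Lemma small_move (V w : nat -> R) (z : R) : is_lim_seq V p_infty ->
  is_lim_seq (fun n => g1 (V n) * (w n - V n)) z ->
  is_lim_seq (fun n => (V n - w n) / chi (V n)) 0 /\ is_lim_seq w p_infty /\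
  is_lim_seq (fun n => g1 (w n) / g1 (V n)) 1 /\ is_lim_seq (fun n => g (w n) - g (V n)) z.
Proof.
  intros HV Hz. assert (Cpos := g_pos_ev HG HF V 1 HV).
  assert (S : is_lim_seq (fun n => (V n - w n) / chi (V n)) 0).
  { apply lim_ext_ev with (fun n => (-1 * (g1 (V n) * (w n - V n))) / g (V n)).
    - apply lim_div_inf with (-1 * z); [|now apply (lim_g HG)].
      apply is_lim_seq_mult'; [apply is_lim_seq_const|auto].
    - ev_use Cpos. ev_intros n [P1 [P2 [P3 P4]]]. unfold drop_scale. field. lra. }
  destruct (drop_ratio V w 0 HV ltac:(lra) S) as [Q1 [_ [_ Q4]]].
  assert (ef1 : ef kap 0 = 1) by (unfold ef; rewrite Ef_0; field). rewrite ef1 in Q4.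
  split; [auto|]. split; [auto|]. split; [auto|].
  apply is_lim_seq_le_le_loc with (fun n => g1 (V n) * (w n - V n))
    (fun n => g1 (w n) / g1 (V n) * (g1 (V n) * (w n - V n))); [|auto|].
  - assert (Cw := g_pos_ev HG HF w 1 Q1). ev_use Cpos. ev_use Cw. ev_intros n [_ [_ [R3 R4]]] [P1 [P2 [P3 P4]]].
    replace (g1 (w n) / g1 (V n) * (g1 (V n) * (w n - V n))) with (g1 (w n) * (w n - V n)) by (field; lra).
    destruct (Rle_dec (V n) (w n)) as [H|H].
    + generalize (g_lower HG (V n) (w n) P3 H) (g_upper HG (V n) (w n) P3 H). lra.
    + generalize (g_lower HG (w n) (V n) R3 ltac:(lra)) (g_upper HG (w n) (V n) R3 ltac:(lra)). lra.
  - replace z with (1 * z) by ring. now apply is_lim_seq_mult'.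
Qed.

(* x n is the logarithm of a concentration radius with profile parameter a; s is the normalised height
   already lost there. *)
Definition concentrated (a s : R) (x : nat -> R) : Prop :=
  eventually (fun n => x n < 0) /\
  is_lim_seq (fun n => g1 (vv n (x n)) * mm n (x n)) 2 /\
  is_lim_seq (fun n => A n (x n)) (ln (a ^ 2 / 2)) /\
  is_lim_seq (fun n => (mu n - vv n (x n)) / chi (mu n)) s.

Section Point.
Context (a s : R) (x : nat -> R) (Ha : 0 < a <= 2) (Hs : kap * s < 1) (HC : concentrated a s x).
Definition pt_height (n : nat) : R := u n (exp (x n)).
(** This is gamma of the theorem: exp (A) = lam r^2 h f'(u) at r = exp (x), so gamma = r exp (-
    A/2). *)
Definition pt_scale (n : nat) : R := exp (x n - A n (x n) / 2).
Definition pt_z := @rescaled g1 u pt_height pt_scale.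
Definition pt_z1 := @rescaled1 g1 u1 pt_height pt_scale.
Definition pt_z2 := @rescaled2 g1 u2 pt_height pt_scale.

Lemma Vx_infty : is_lim_seq pt_height p_infty.
Proof. exact (proj1 (drop_ratio mu pt_height s Hmu Hs (proj2 (proj2 (proj2 HC))))). Qed.

Lemma x_minf : is_lim_seq x m_infty.
Proof.
  destruct HC as [H1 [H2 [H3 H4]]].
  apply (crude_minf HG HF (weight_of_h _ _ _ _ HH) sol_log (Rmax 3 (ln (a ^ 2 / 2) + 1))); auto.
  - exact Vx_infty.
  - assert (E := lim_lt _ _ 3 H2 ltac:(lra)). ev_use E. ev_intros n E.
    generalize (Rmax_l 3 (ln (a ^ 2 / 2) + 1)). lra.
  - assert (E := lim_lt _ _ (ln (a ^ 2 / 2) + 1) H3 ltac:(lra)). ev_use E. ev_intros n E.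
    generalize (Rmax_r 3 (ln (a ^ 2 / 2) + 1)). lra.
Qed.

Lemma gmx_0 : is_lim_seq pt_scale 0.
Proof.
  apply lim_exp_minf. apply lim_minf. intros M.
  assert (E := proj1 (lim_minf _) x_minf (M + (ln (a ^ 2 / 2) - 1) / 2)).
  assert (E2 := lim_gt _ _ (ln (a ^ 2 / 2) - 1) (proj1 (proj2 (proj2 HC))) ltac:(lra)).
  ev_use E. ev_use E2. ev_intros ?; lra.
Qed.

Lemma gmx_norm : eventually (fun n => 0 < pt_scale n /\
  lam n * h (exp (x n)) * exp (g (pt_height n)) * g1 (pt_height n) * pt_scale n ^ 2 = 1).
Proof.
  destruct HC as [H1 _]. assert (Cpos := g_pos_ev HG HF pt_height 1 Vx_infty).
  ev_use Cpos. ev_use H1. ev_intros n H1 [P1 [P2 [P3 P4]]].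
  split; [apply exp_pos|].
  assert (0 < h (exp (x n))) by (apply (hp_pos HH), exp_neg_01; auto).
  assert (L := rs_lam (HR n)).
  rewrite <- (exp_ln (lam n)) at 1 by auto. rewrite <- (exp_ln (h (exp (x n)))) at 1 by auto.
  rewrite <- (exp_ln (g1 (pt_height n))) at 1 by auto.
  unfold pt_scale. replace (exp (x n - A n (x n) / 2) ^ 2) with (exp (x n - A n (x n) / 2) * exp (x n - A n (x n) / 2)) by ring.
  rewrite <- !exp_plus. rewrite <- exp_0. f_equal. unfold Afun. fold (pt_height n). field.
Qed.

Lemma hx_lim : is_lim_seq (fun n => h (exp (x n))) h0.
Proof.
  apply lim_eps. intros eps He. destruct (hp_0 HH eps He) as [d [Hd H]].
  assert (E := lim_lt _ _ d (lim_exp_minf _ x_minf) Hd). ev_use E. ev_intros n E.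
  apply H. split; [apply exp_pos|auto].
Qed.

(** To the right this is [crude]. To the left m is at most its value at [x n], and g' m tends to 2
    there, so the rescaled rise is below [3 * T]. *)
Lemma conc_window (T : R) : 0 <= T -> exists C, 0 < C /\ eventually (fun n => x n + T < 0 /\
  forall y, x n - T <= y <= x n + T -> Rabs (g1 (pt_height n) * (u n (exp y) - pt_height n)) <= C).
Proof.
  intros HT. destruct HC as [H1 [H2 [H3 H4]]].
  destruct (crude HG HF (weight_of_h _ _ _ _ HH) sol_log (Rmax 3 (ln (a ^ 2 / 2) + 1)) T HT) as [C3 HC3].
  specialize (HC3 x H1 Vx_infty).
  assert (E1 := lim_lt _ _ 3 H2 ltac:(lra)).
  assert (E2 := lim_lt _ _ (ln (a ^ 2 / 2) + 1) H3 ltac:(lra)).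
  assert (R1 := Rmax_l 3 (ln (a ^ 2 / 2) + 1)). assert (R2 := Rmax_r 3 (ln (a ^ 2 / 2) + 1)).
  assert (W := HC3 ltac:(ev_keep E1; apply ev_all; intros; lra) ltac:(ev_keep E2; apply ev_all; intros; lra)).
  exists (Rmax (Rabs C3 + 1) (3 * T)). split.
  { eapply Rlt_le_trans; [|apply Rmax_l]. generalize (Rabs_pos C3). lra. }
  assert (M1 := Rmax_l (Rabs C3 + 1) (3 * T)). assert (M2 := Rmax_r (Rabs C3 + 1) (3 * T)).
  assert (Cpos := g_pos_ev HG HF pt_height 1 Vx_infty).
  ev_use E1. ev_use W. ev_use Cpos. ev_intros n [P1 [P2 [P3 P4]]] [W1 W2] E1.
  split; [auto|]. intros y Hy. fold (pt_height n) in *. destruct (Rle_dec (x n) y) as [Hxy|Hxy].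
  - destruct (W2 y ltac:(lra)) as [[B1 B2] _].
    assert (g1 (pt_height n) * (pt_height n - C3 / g1 (pt_height n)) <= g1 (pt_height n) * u n (exp y)) by (apply Rmult_le_compat_l; lra).
    replace (g1 (pt_height n) * (pt_height n - C3 / g1 (pt_height n))) with (g1 (pt_height n) * pt_height n - C3) in H by (field; lra).
    assert (g1 (pt_height n) * u n (exp y) <= g1 (pt_height n) * pt_height n) by (apply Rmult_le_compat_l; lra).
    generalize (Rle_abs C3). intros. apply Rabs_le_between. lra.
  - assert (I := incr_le (vv n) (fun z => - mm n z) y (x n) 0 ltac:(lra)).
    assert (I2 := incr_ge (vv n) (fun z => - mm n z) y (x n) (- mm n (x n)) ltac:(lra)).
    assert (D : forall z, y <= z <= x n -> is_derive (vv n) z (- mm n z)).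
    { intros z Hz. apply (ls_v (sol_log n)). lra. }
    specialize (I D). specialize (I2 D).
    assert (J1 : vv n (x n) <= vv n y + 0 * (x n - y)).
    { apply I. intros z Hz. generalize (ls_m0 (sol_log n) z ltac:(lra)). lra. }
    assert (J2 : vv n y + - mm n (x n) * (x n - y) <= vv n (x n)).
    { apply I2. intros z Hz. apply Ropp_le_contravar. apply (m_incr HF sol_log); lra. }
    cbv beta in J1, J2. fold (pt_height n) in J1, J2.
    set (mx := - (exp (x n) * u1 n (exp (x n)))) in *.
    assert (J3 : 0 <= mx) by (apply (ls_m0 (sol_log n)); lra).
    assert (g1 (pt_height n) * (u n (exp y) - pt_height n) <= g1 (pt_height n) * (mx * T)).
    { apply Rmult_le_compat_l; [lra|]. nra. }
    assert (0 <= g1 (pt_height n) * (u n (exp y) - pt_height n)) by (apply Rmult_le_pos; lra).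
    rewrite Rabs_pos_eq by auto. assert (g1 (pt_height n) * mx * T <= 3 * T) by (apply Rmult_le_compat_r; lra). lra.
Qed.

Lemma gmx_exp (n : nat) (r : R) : 0 < r -> pt_scale n * r = exp (x n + (ln r - A n (x n) / 2)).
Proof.
  intros Hr. unfold pt_scale. rewrite <- (exp_ln r) at 1 by auto. rewrite <- exp_plus. f_equal. ring.
Qed.

Lemma zx_bound (al be : R) : 0 < al <= be -> exists C, 0 < C /\
  eventually (fun n => forall r, al <= r <= be -> Rabs (pt_z n r) <= C).
Proof.
  intros Hab. set (B := Rabs (ln (a ^ 2 / 2)) + 1).
  destruct (conc_window (Rabs (ln al) + Rabs (ln be) + B)) as [C [HC0 HC1]].
  { unfold B. generalize (Rabs_pos (ln al)) (Rabs_pos (ln be)) (Rabs_pos (ln (a ^ 2 / 2))). lra. }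
  exists C. split; [auto|]. destruct HC as [H1 [H2 [H3 H4]]].
  assert (E := proj1 (lim_eps _ _) H3 1 ltac:(lra)). ev_use E. ev_use HC1. ev_intros n [_ W] E r Hr. unfold pt_z, rescaled. rewrite gmx_exp by lra. apply W.
  assert (ln al <= ln r <= ln be) by (split; apply ln_le; lra).
  apply Rabs_le_between in E.
  assert (Rabs (A n (x n) / 2) <= B).
  { unfold B. unfold Rdiv. rewrite Rabs_mult, (Rabs_pos_eq (/ 2)) by lra.
    replace (A n (x n)) with ((A n (x n) - ln (a ^ 2 / 2)) + ln (a ^ 2 / 2)) by ring.
    assert (Q := Rabs_triang (A n (x n) - ln (a ^ 2 / 2)) (ln (a ^ 2 / 2))).
    assert (Rabs (A n (x n) - ln (a ^ 2 / 2)) <= 1) by (apply Rabs_le_between; lra).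
    generalize (Rabs_pos (ln (a ^ 2 / 2))). lra. }
  apply Rabs_le_between in H0.
  generalize (Rle_abs (ln be)) (Rle_abs (- ln al)) (Rabs_pos (ln al)) (Rabs_pos (ln be)). rewrite Rabs_Ropp. intros.
  lra.
Qed.

Definition bx : R := Rpower (sqrt 2 / a) a.

Lemma bx_pos : 0 < bx.
Proof. apply exp_pos. Qed.

(** The origin of b_k: the quotient of the concentration radius by gamma tends to a/sqrt 2, where
    the rescaled solution is 0 and -s z' tends to 2. The value of [bx] makes the profile satisfy
    both conditions. *)
Lemma centre_value : liouville a bx (a / sqrt 2) = 0 /\ liouville1 a bx (a / sqrt 2) = - 2 / (a / sqrt 2).
Proof.
  assert (S2 : 0 < sqrt 2) by (apply sqrt_lt_R0; lra).
  assert (Hsi : 0 < a / sqrt 2) by (apply Rdiv_lt_0_compat; lra).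
  assert (E : bx * exp (a * ln (a / sqrt 2)) = 1).
  { unfold bx, Rpower. rewrite <- exp_plus, <- exp_0. f_equal.
    rewrite !ln_div by lra. ring. }
  unfold liouville1, liouville. rewrite E. split.
  - rewrite ln_mult; [|nra|apply bx_pos].
    unfold bx at 1, Rpower. rewrite ln_exp.
    replace (2 * ln (1 + 1)) with (ln 2 + ln 2) by (replace (1 + 1) with 2 by ring; ring).
    rewrite !ln_div by lra. replace (2 * a ^ 2) with (2 * (a * a)) by ring.
    rewrite !ln_mult by nra.
    assert (Q : ln (sqrt 2) = ln 2 / 2).
    { rewrite <- (sqrt_sqrt 2) at 2 by lra. rewrite ln_mult by auto. field. }
    rewrite Q. field.
  - field. split; lra.
Qed.

(** The matching point is exp (A/2), the rescaled concentration radius; [al'] and [be'] enlarge the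
    window so that its limit [si] lies inside. *)
Lemma bubble_conv (al be : R) : 0 < al <= be -> forall eps, 0 < eps -> eventually (fun n =>
  forall r, al <= r <= be -> Rabs (pt_z n r - liouville a bx r) <= eps /\ Rabs (pt_z1 n r - liouville1 a bx r) <= eps /\
    Rabs (pt_z2 n r - liouville2 a bx r) <= eps).
Proof.
  intros Hab eps He.
  assert (S2 : 0 < sqrt 2) by (apply sqrt_lt_R0; lra).
  set (si := a / sqrt 2). assert (Hsi : 0 < si) by (apply Rdiv_lt_0_compat; lra).
  set (al' := Rmin al (si / 2)). set (be' := Rmax be (2 * si)).
  assert (Hal : 0 < al' /\ al' <= al /\ al' <= si / 2).
  { unfold al'. split; [apply Rmin_glb_lt; lra|split; [apply Rmin_l|apply Rmin_r]]. }
  assert (Hbe : be <= be' /\ 2 * si <= be') by (split; [apply Rmax_l|apply Rmax_r]).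
  destruct (zx_bound al' be' ltac:(lra)) as [C [HC0 HC1]].
  assert (HC' := HC). destruct HC' as [H1 [H2 [H3 H4]]].
  set (s0 := fun n => exp (A n (x n) / 2)).
  assert (Es : exp (ln (a ^ 2 / 2) / 2) = si).
  { replace (a ^ 2 / 2) with (si * si).
    - rewrite ln_mult by auto. replace ((ln si + ln si) / 2) with (ln si) by field. now apply exp_ln.
    - unfold si. replace (a / sqrt 2 * (a / sqrt 2)) with (a ^ 2 / (sqrt 2 * sqrt 2)) by (field; lra).
      rewrite sqrt_sqrt by lra. reflexivity. }
  assert (Hs0 : is_lim_seq s0 si).
  { rewrite <- Es. apply lim_exp. apply is_lim_seq_div'; [auto|apply is_lim_seq_const|lra]. }
  assert (Gs : forall n, pt_scale n * s0 n = exp (x n)).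
  { intros n. unfold pt_scale, s0. rewrite <- exp_plus. f_equal. ring. }
  destruct centre_value as [CV1 CV2]. fold si in CV1, CV2.
  assert (Conv := bubble_mid HG HF HH HR pt_height pt_scale (fun n => h (exp (x n))) Vx_infty hx_lim gmx_0 gmx_norm
    a bx al' be' si C s0 Ha bx_pos ltac:(lra) ltac:(lra) HC0 Hs0 HC1).
  assert (W : eventually (fun n => forall r, al' <= r <= be' ->
    Rabs (pt_z n r - liouville a bx r) <= eps /\ Rabs (pt_z1 n r - liouville1 a bx r) <= eps /\ Rabs (pt_z2 n r - liouville2 a bx r) <= eps)).
  { apply Conv; auto.
    - rewrite CV1. apply is_lim_seq_ext with (fun _ => 0); [|apply is_lim_seq_const].
      intros n. unfold rescaled. rewrite Gs. unfold pt_height. ring.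
    - rewrite CV2. apply is_lim_seq_ext with (fun n => - (g1 (vv n (x n)) * mm n (x n)) / s0 n).
      + intros n. unfold rescaled1. rewrite Gs. cbv beta. fold (pt_height n).
        assert (0 < s0 n) by apply exp_pos. rewrite <- (Gs n) at 1. field. lra.
      + apply is_lim_seq_div'; [|auto|lra]. change (Finite (- 2)) with (Rbar_opp 2). now apply is_lim_seq_opp in H2. }
  ev_use W. ev_intros n W r Hr. apply W. lra.
Qed.

End Point.
End Concentration.

(** * The first concentration point *)

Lemma lim_INR_inf (J : nat -> nat) : (forall M, eventually (fun n => (M <= J n)%nat)) ->
  is_lim_seq (fun n => INR (J n) + 1) p_infty.
Proof.
  intros HJ. apply lim_inf. intros M. destruct (nfloor_ex (Rabs M) (Rabs_pos M)) as [N [_ HN]].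
  assert (E := HJ N). ev_use E. ev_intros n E. apply le_INR in E. generalize (Rle_abs M). lra.
Qed.

Lemma lim_ln_inf (w : nat -> R) : is_lim_seq w p_infty -> is_lim_seq (fun n => ln (w n)) p_infty.
Proof.
  intros Hw. apply lim_inf. intros M. assert (E := proj1 (lim_inf _) Hw (exp M)). ev_use E.
  ev_intros n E. rewrite <- (ln_exp M). apply ln_increasing; [apply exp_pos|auto].
Qed.

Lemma lim_exp_inf (w : nat -> R) : is_lim_seq w p_infty -> is_lim_seq (fun n => exp (w n)) p_infty.
Proof.
  intros Hw. apply lim_inf_le with w; [auto|]. assert (E := proj1 (lim_inf _) Hw 0). ev_use E.
  ev_intros n E. generalize (exp_ineq1 (w n) ltac:(lra)). lra.
Qed.

(** From this form, -s z' increases from 2 - a at 0 to 2 + a at infinity: the values of y on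
    entering and on leaving the bubble, whose difference is the mass 2a. *)
Lemma flux_liouville (a b s : R) : 0 < b -> 0 < s ->
  s * liouville1 a b s = - (2 + a) + 2 * a / (1 + b * exp (a * ln s)).
Proof.
  intros Hb Hs. assert (0 < b * exp (a * ln s)) by (apply Rmult_lt_0_compat; [auto|apply exp_pos]).
  unfold liouville1. field. split; lra.
Qed.

Lemma flux_liouville_inf (a b : R) (s : nat -> R) : 0 < a -> 0 < b -> is_lim_seq s p_infty ->
  is_lim_seq (fun n => s n * liouville1 a b (s n)) (- (2 + a)).
Proof.
  intros Ha Hb Hs. apply lim_ext_ev with (fun n => - (2 + a) + 2 * a / (1 + b * exp (a * ln (s n)))).
  - replace (Finite (- (2 + a))) with (Finite (- (2 + a) + 0)) by (f_equal; ring).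
    apply is_lim_seq_plus'; [apply is_lim_seq_const|].
    apply lim_div_inf with (2 * a); [apply is_lim_seq_const|].
    assert (L1 := lim_ln_inf _ Hs).
    assert (L2 : is_lim_seq (fun n => a * ln (s n)) p_infty).
    { eapply is_lim_seq_mult; [apply is_lim_seq_const|exact L1|]. now apply is_Rbar_mult_sym, is_Rbar_mult_p_infty_pos. }
    apply lim_exp_inf in L2.
    assert (L3 : is_lim_seq (fun n => b * exp (a * ln (s n))) p_infty).
    { eapply is_lim_seq_mult; [apply is_lim_seq_const|exact L2|]. now apply is_Rbar_mult_sym, is_Rbar_mult_p_infty_pos. }
    apply lim_inf_le with (1 := L3). ev_intros ?; lra.
  - assert (E := proj1 (lim_inf _) Hs 0). ev_use E. ev_intros n E. symmetry. now apply flux_liouville.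
Qed.

Lemma flux_liouville_0 (a b : R) (s : nat -> R) : 0 < a -> 0 < b -> is_lim_seq s p_infty ->
  is_lim_seq (fun n => / s n * liouville1 a b (/ s n)) (a - 2).
Proof.
  intros Ha Hb Hs. apply lim_ext_ev with (fun n => - (2 + a) + 2 * a / (1 + b * exp (- (a * ln (s n))))).
  - replace (Finite (a - 2)) with (Finite (- (2 + a) + 2 * a / (1 + b * 0))) by (f_equal; field).
    apply is_lim_seq_plus'; [apply is_lim_seq_const|].
    apply is_lim_seq_div'; [apply is_lim_seq_const| |lra].
    apply is_lim_seq_plus'; [apply is_lim_seq_const|]. apply is_lim_seq_mult'; [apply is_lim_seq_const|].
    apply lim_exp_minf. change m_infty with (Rbar_opp p_infty). apply -> is_lim_seq_opp.
    eapply is_lim_seq_mult; [apply is_lim_seq_const|exact (lim_ln_inf _ Hs)|].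
    now apply is_Rbar_mult_sym, is_Rbar_mult_p_infty_pos.
  - assert (E := proj1 (lim_inf _) Hs 0). ev_use E. ev_intros n E. symmetry.
    rewrite flux_liouville by (auto; now apply Rinv_0_lt_compat). rewrite ln_Rinv by auto.
    replace (a * - ln (s n)) with (- (a * ln (s n))) by ring. reflexivity.
Qed.

(** The left side is the limit of [A] at rescaled radius [s]. Its decay like - a log s is what lets
    the neck start with [A] tending to minus infinity. *)
Lemma liouville_far (a b s : R) : 0 < a -> 0 < b -> 0 < s ->
  2 * ln s + liouville a b s <= ln (2 * a ^ 2 * b) - 2 * ln b - a * ln s.
Proof.
  intros Ha Hb Hs. unfold liouville.
  assert (0 < b * exp (a * ln s)) by (apply Rmult_lt_0_compat; [auto|apply exp_pos]).
  assert (Q : ln (b * exp (a * ln s)) <= ln (1 + b * exp (a * ln s))) by (apply ln_le; lra).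
  rewrite ln_mult, ln_exp in Q by (auto; apply exp_pos). lra.
Qed.

Section Induction.
Context {g g1 g2 : R -> R} {t0 q kap : R} (HG : growth g g1 g2 t0 q kap).
Context {f : R -> R} {Lv : R} (HF : nonlin f g t0 Lv).
Context {h h1 : R -> R} {h0 K : R} (HH : hprop h h1 h0 K).
Context {lam mu : nat -> R} {u u1 u2 : nat -> R -> R}
  (HR : forall n, rsol f h (lam n) (mu n) (u n) (u1 n) (u2 n)).
Context (Hmu : is_lim_seq mu p_infty).
Local Notation chi := (drop_scale g g1).
Local Notation vv := (fun n x => u n (exp x)).
Local Notation mm := (fun n x => - (exp x * u1 n (exp x))).
Local Notation A := (@Afun g g1 (fun x => ln (h (exp x))) (fun n => ln (lam n)) vv).
Local Notation concentrated := (@concentrated g g1 h lam mu u u1).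
Local Notation Vx := (@pt_height u).
Local Notation gmx := (@pt_scale g g1 h lam u).
Local Notation zx := (@pt_z g g1 h lam u).
Local Notation zx1 := (@pt_z1 g g1 h lam u u1).
Local Notation zx2 := (@pt_z2 g g1 h lam u u2).

(** The solution is first rescaled at the centre, with height [mu]; the limit profile has value 0
    there, so b = 1/8. The concentration point is read off from this profile, and the solution is
    rescaled again at it, where b becomes 1/2. *)
Lemma first_point : exists x, concentrated 2 0 x /\ forall be, 0 < be ->
  (exists C, 0 < C /\ eventually (fun n => forall r, 0 < r <= be -> Rabs (zx x n r) <= C)) /\
  forall eps, 0 < eps -> eventually (fun n => forall r, 0 < r <= be ->
    Rabs (zx x n r - liouville 2 (bx 2) r) <= eps /\ Rabs (zx1 x n r - liouville1 2 (bx 2) r) <= eps /\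
    Rabs (zx2 x n r - liouville2 2 (bx 2) r) <= eps).
Proof.
  assert (Hh0 := hp_h0 HH).
  set (gm := fun n => exp (- (ln (lam n) + ln h0 + g (mu n) + ln (g1 (mu n))) / 2)).
  assert (Cpos := g_pos_ev HG HF mu 1 Hmu).
  assert (Norm : eventually (fun n => 0 < gm n /\ lam n * h0 * exp (g (mu n)) * g1 (mu n) * gm n ^ 2 = 1)).
  { ev_keep Cpos. ev_intros n [P1 [P2 [P3 P4]]]. split; [apply exp_pos|].
    rewrite <- (exp_ln (lam n)) at 1 by apply (rs_lam (HR n)).
    rewrite <- (exp_ln h0) at 1 by auto. rewrite <- (exp_ln (g1 (mu n))) at 1 by auto.
    unfold gm. replace (exp (- (ln (lam n) + ln h0 + g (mu n) + ln (g1 (mu n))) / 2) ^ 2) with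
      (exp (- (ln (lam n) + ln h0 + g (mu n) + ln (g1 (mu n))) / 2) * exp (- (ln (lam n) + ln h0 + g (mu n) + ln (g1 (mu n))) / 2)) by ring.
    rewrite <- !exp_plus, <- exp_0. f_equal. field. }
  assert (Quad : forall n, Lv <= mu n -> forall r, 0 < r < 1 -> mu n - lam n * exp K * exp (g (mu n)) * r ^ 2 / 4 <= u n r <= mu n).
  { intros n HL r Hr. split; [|apply (rs_le_mu (HR n) (hp_pos HH) (fpos_nl HF)); auto].
    apply (rs_quadratic (HR n)); auto. intros y Hy.
    assert (L := rs_lam (HR n)). assert (Hp := hp_pos HH y ltac:(lra)).
    assert (h y <= exp K).
    { rewrite <- (exp_ln (h y)) by auto. apply exp_le. generalize (hp_b HH y ltac:(lra)).
      intros Q. apply Rabs_le_between in Q. lra. }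
    apply Rmult_le_compat; [apply Rmult_le_pos; lra| | |].
    - apply (fpos_nl HF). left. apply (rs_pos (HR n)). lra.
    - apply Rmult_le_compat_l; lra.
    - apply (nl_le HF); [left; apply (rs_pos (HR n)); lra| |auto].
      apply (rs_le_mu (HR n) (hp_pos HH) (fpos_nl HF)). lra. }
  assert (Bound : forall be, 0 < be -> let C := exp K * be ^ 2 / (4 * h0) in 
    0 < C /\ eventually (fun n => gm n * be < 1 /\ forall r, 0 < r <= be -> Rabs (@rescaled g1 u mu gm n r) <= C)).
  { intros be Hbe C. assert (HC : 0 < C).
    { unfold C. apply Rdiv_lt_0_compat; [|lra]. apply Rmult_lt_0_compat; [apply exp_pos|now apply pow_lt]. }
    split; [auto|].
    assert (P0 : 0 < g1 Lv) by (apply (gr_g1pos HG), (nl_lev HF)).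
    assert (E := proj1 (lim_inf _) Hmu (C / g1 Lv + 1)).
    ev_use E. ev_keep Cpos. ev_keep Norm. ev_intros n [gp No] [P1 [P2 [P3 P4]]] E.
    assert (G2 : g1 Lv <= g1 (mu n)) by (apply (g1_mono HG); [apply (nl_lev HF)|lra]).
    assert (Low : forall r, 0 < r < 1 -> r <= gm n * be -> mu n - C / g1 (mu n) <= u n r).
    { intros r Hr Hrb. destruct (Quad n ltac:(lra) r Hr) as [Q _]. eapply Rle_trans; [|exact Q].
      assert (r ^ 2 <= (gm n * be) ^ 2) by (apply pow_incr; lra).
      assert (Z : lam n * exp K * exp (g (mu n)) * (gm n * be) ^ 2 / 4 = C / g1 (mu n)).
      { unfold C. replace (lam n * exp K * exp (g (mu n)) * (gm n * be) ^ 2 / 4) with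
          (lam n * h0 * exp (g (mu n)) * g1 (mu n) * gm n ^ 2 * (exp K * be ^ 2 / (4 * h0)) / g1 (mu n)) by (field; lra).
        rewrite No. field. lra. }
      assert (lam n * exp K * exp (g (mu n)) * r ^ 2 <= lam n * exp K * exp (g (mu n)) * (gm n * be) ^ 2).
      { apply Rmult_le_compat_l; [|auto]. left. repeat apply Rmult_lt_0_compat; try apply exp_pos.
        apply (rs_lam (HR n)). }
      lra. }
    assert (C / g1 (mu n) <= C / g1 Lv).
    { apply Rmult_le_compat_l; [lra|]. apply Rinv_le_contravar; lra. }
    (* If the scaled ball covered the whole unit ball, the quadratic lower bound would keep [u]
       above 1 up to the boundary. As [be] is arbitrary, this also yields that [gm] tends to 0. *)
    assert (In : gm n * be < 1).
    { apply Rnot_le_lt. intros Hge.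
      destruct (rs_1 (HR n) 1 0 ltac:(lra) ltac:(lra)) as [r [Hr1 Hr2]].
      specialize (Low r ltac:(lra) ltac:(lra)). lra. }
    split; [auto|]. intros r Hr.
    assert (gr : 0 < gm n * r <= gm n * be).
    { split; [apply Rmult_lt_0_compat; lra|apply Rmult_le_compat_l; lra]. }
    specialize (Low (gm n * r) ltac:(lra) ltac:(lra)).
    destruct (Quad n ltac:(lra) (gm n * r) ltac:(lra)) as [_ Up].
    unfold rescaled. rewrite Rabs_left1.
    - apply Rle_trans with (g1 (mu n) * (C / g1 (mu n))); [|right; field; lra].
      rewrite <- Ropp_mult_distr_r_reverse. apply Rmult_le_compat_l; lra.
    - assert (g1 (mu n) * (u n (gm n * r) - mu n) <= g1 (mu n) * 0) by (apply Rmult_le_compat_l; lra). lra. }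
  assert (Gm0 : is_lim_seq gm 0).
  { apply lim_eps. intros eps He. destruct (Bound (/ eps) ltac:(now apply Rinv_0_lt_compat)) as [_ B].
    ev_use B. ev_keep Norm. ev_intros n [gp _] [B _].
    rewrite Rminus_0_r, Rabs_pos_eq by lra.
    apply Rmult_lt_compat_r with (r := eps) in B; [|auto]. rewrite Rmult_assoc, Rinv_l in B by lra. lra. }
  (* The radius where b r^2 = 1 for b = 1/8: there -r z' = 2 and r^2 e^z = 8/4 = 2 = a^2/2, the two
     conditions for concentration with a = 2. *)
  set (r8 := sqrt 8). assert (Hr8 : 0 < r8) by (apply sqrt_lt_R0; lra).
  assert (Hr8' : r8 * r8 = 8) by (apply sqrt_sqrt; lra).
  destruct (Bound r8 Hr8) as [HC8 Bd8].
  assert (Bd8' : eventually (fun n => forall r, 0 < r <= r8 -> Rabs (@rescaled g1 u mu gm n r) <= exp K * r8 ^ 2 / (4 * h0))).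
  { ev_keep Bd8. apply ev_all. tauto. }
  assert (Conv := bubble_zero HG HF HH HR mu gm (fun _ => h0) Hmu (is_lim_seq_const h0) Gm0 Norm
    (1 / 8) r8 _ ltac:(lra) Hr8 HC8 Bd8').
  assert (Conv' : forall eps, 0 < eps -> eventually (fun n => forall r, 0 < r <= r8 ->
    Rabs (@rescaled g1 u mu gm n r - liouville 2 (1 / 8) r) <= eps /\ Rabs (@rescaled1 g1 u1 mu gm n r - liouville1 2 (1 / 8) r) <= eps)).
  { intros eps He. assert (W := Conv).
    assert (W' := W ltac:(replace (8 * (1 / 8)) with 1 by field; rewrite ln_1;
      apply is_lim_seq_ext with (fun _ => 0); [intros; ring|apply is_lim_seq_const]) eps He).
    ev_use W'. ev_intros n W' r Hr. specialize (W' r Hr). tauto. }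
  clear Conv.
  destruct (liouville_two (1 / 8) r8 ltac:(lra) Hr8) as [PV1 PV2].
  replace (8 * (1 / 8)) with 1 in PV1 by field. replace (1 / 8 * r8 ^ 2) with 1 in PV1, PV2 by (simpl; lra).
  rewrite ln_1 in PV1. replace (1 + 1) with 2 in PV1, PV2 by ring.
  assert (Z0 : is_lim_seq (fun n => @rescaled g1 u mu gm n r8) (- (2 * ln 2))).
  { apply lim_eps. intros eps He. assert (W := Conv' eps He). ev_use W. ev_intros n W.
    destruct (W r8 ltac:(lra)) as [W1 _]. rewrite PV1 in W1. replace (- (2 * ln 2)) with (0 - 2 * ln 2) by ring. exact W1. }
  assert (Z1 : is_lim_seq (fun n => @rescaled1 g1 u1 mu gm n r8) (- (r8 / 4))).
  { apply lim_eps. intros eps He. assert (W := Conv' eps He). ev_use W. ev_intros n W.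
    destruct (W r8 ltac:(lra)) as [_ W1]. rewrite PV2 in W1.
    replace (4 * (1 / 8) * r8 / 2) with (r8 / 4) in W1 by field. exact W1. }
  set (x := fun n => ln (gm n * r8)).
  assert (gp : forall n, 0 < gm n) by (intros; apply exp_pos).
  assert (Ex : forall n, exp (x n) = gm n * r8).
  { intros n. unfold x. apply exp_ln. now apply Rmult_lt_0_compat. }
  assert (Zw : is_lim_seq (fun n => g1 (mu n) * (Vx x n - mu n)) (- (2 * ln 2))).
  { apply is_lim_seq_ext with (2 := Z0). intros n. unfold rescaled, pt_height. now rewrite Ex. }
  destruct (small_move HG HF mu (Vx x) _ Hmu Zw) as [SM1 [SM2 [SM3 SM4]]].
  assert (Hxneg : eventually (fun n => x n < 0)).
  { ev_keep Bd8. ev_intros n [B _]. unfold x. rewrite <- ln_1. apply ln_increasing; [|auto].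
    now apply Rmult_lt_0_compat. }
  assert (Hxh : is_lim_seq (fun n => h (exp (x n))) h0).
  { apply lim_eps. intros eps He. destruct (hp_0 HH eps He) as [d [Hd Hd']].
    assert (G8 : is_lim_seq (fun n => gm n * r8) 0).
    { replace (Finite 0) with (Finite (0 * r8)) by (f_equal; ring). apply is_lim_seq_mult'; [auto|apply is_lim_seq_const]. }
    assert (E := lim_lt _ _ d G8 Hd). ev_use E. ev_intros n E. apply Hd'. rewrite Ex.
    split; [now apply Rmult_lt_0_compat|auto]. }
  assert (HCx : concentrated 2 0 x).
  { split; [auto|]. split; [|split; [|exact SM1]].
    - apply lim_ext_ev with (fun n => g1 (Vx x n) / g1 (mu n) * (- r8 * @rescaled1 g1 u1 mu gm n r8)).
      + replace (Finite 2) with (Finite (1 * (- r8 * - (r8 / 4)))) by (f_equal; lra).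
        apply is_lim_seq_mult'; [auto|]. apply is_lim_seq_mult'; [apply is_lim_seq_const|auto].
      + ev_keep Cpos. ev_intros n [P1 [P2 [P3 P4]]]. unfold rescaled1, pt_height. rewrite Ex. field. lra.
    - apply lim_ext_ev with (fun n => ln 8 + ln (h (exp (x n)) / h0) + (g (Vx x n) - g (mu n)) + ln (g1 (Vx x n) / g1 (mu n))).
      + replace (ln (2 ^ 2 / 2)) with (ln 8 + ln (h0 / h0) + - (2 * ln 2) + ln 1).
        * apply is_lim_seq_plus'; [apply is_lim_seq_plus'; [apply is_lim_seq_plus'; [apply is_lim_seq_const|]|]|]; auto.
          -- apply lim_ln; [apply Rdiv_lt_0_compat; lra|]. apply is_lim_seq_div'; [auto|apply is_lim_seq_const|lra].
          -- apply lim_ln; [lra|auto].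
        * replace (h0 / h0) with 1 by (field; lra). rewrite ln_1.
          replace 8 with (2 * 2 * 2) by ring. rewrite !ln_mult by lra. replace (2 ^ 2 / 2) with 2 by field. ring.
      + assert (SM3' := lim_gt _ _ 0 SM3 ltac:(lra)). ev_use SM3'.
        ev_keep Hxneg. ev_keep Cpos. ev_intros n [P1 [P2 [P3 P4]]] Hx SM3'.
        assert (0 < h (exp (x n))) by (apply (hp_pos HH), exp_neg_01; auto).
        assert (0 < g1 (Vx x n)).
        { replace (g1 (Vx x n)) with (g1 (Vx x n) / g1 (mu n) * g1 (mu n)) by (field; lra). now apply Rmult_lt_0_compat. }
        unfold Afun. fold (Vx x n). rewrite !ln_div by auto.
        assert (X : 2 * x n = ln 8 - (ln (lam n) + ln h0 + g (mu n) + ln (g1 (mu n)))).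
        { unfold x. rewrite ln_mult by auto. unfold gm. rewrite ln_exp. rewrite <- Hr8', ln_mult by auto. field. }
        rewrite X. ring. }
  (* To the left of [x n] the height lies between its value at the point and [mu n], whose rescaled
     distance tends to 2 log 2; to the right the window bound applies. *)
  assert (Zero : forall be, 0 < be ->
    exists C, 0 < C /\ eventually (fun n => forall r, 0 < r <= be -> Rabs (zx x n r) <= C)).
  { intros be Hbe.
    assert (k0 : kap * 0 < 1) by lra.
    assert (GV : is_lim_seq (fun n => g1 (Vx x n) * (mu n - Vx x n)) (2 * ln 2)).
    { apply lim_ext_ev with (fun n => g1 (Vx x n) / g1 (mu n) * (-1 * (g1 (mu n) * (Vx x n - mu n)))).
      - replace (2 * ln 2) with (1 * (-1 * - (2 * ln 2))) by ring. apply is_lim_seq_mult'; [auto|].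
        apply is_lim_seq_mult'; [apply is_lim_seq_const|auto].
      - ev_keep Cpos. ev_intros n [P1 [P2 [P3 P4]]]. field. lra. }
    set (T := Rabs (ln be) + 1).
    destruct (conc_window HG HF HH HR Hmu 2 0 x k0 HCx T) as [C [HC0 HC1]].
    { unfold T. generalize (Rabs_pos (ln be)). lra. }
    exists (Rmax C (2 * ln 2 + 1)). split. { eapply Rlt_le_trans; [exact HC0|apply Rmax_l]. }
    assert (M1 := Rmax_l C (2 * ln 2 + 1)). assert (M2 := Rmax_r C (2 * ln 2 + 1)).
    assert (E1 := lim_lt _ _ (2 * ln 2 + 1) GV ltac:(lra)).
    assert (E2 := lim_gt _ _ 0 (proj1 (proj2 (proj2 HCx)))).
    assert (l2 : 0 < ln (2 ^ 2 / 2)). { replace (2 ^ 2 / 2) with 2 by field. rewrite <- ln_1. apply ln_increasing; lra. }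
    specialize (E2 l2). cbv beta in E2.
    assert (CposV := g_pos_ev HG HF (Vx x) 1 SM2).
    ev_use HC1. ev_use E1. ev_use E2. ev_keep Cpos. ev_keep Hxneg. ev_use CposV. ev_intros n [_ [_ [_ Q4]]] Hx [P1 [P2 [P3 P4]]] E2 E1 [W1 W2] r Hr.
    unfold pt_z, rescaled. rewrite gmx_exp by lra.
    set (y := x n + (ln r - A n (x n) / 2)).
    assert (Hlr : ln r <= Rabs (ln be)).
    { eapply Rle_trans; [apply ln_le; [|apply Hr]; lra|apply Rle_abs]. }
    assert (Hy : y <= x n + T) by (unfold y, T; lra).
    destruct (Rle_dec (x n) y) as [Hxy|Hxy].
    - eapply Rle_trans; [|exact M1]. apply W2. assert (0 <= T) by (unfold T; generalize (Rabs_pos (ln be)); lra). lra.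
    - assert (Vx x n <= u n (exp y)).
      { apply (v_decr (sol_log HF HH HR) n y (x n)); lra. }
      assert (u n (exp y) <= mu n).
      { apply (rs_le_mu (HR n) (hp_pos HH) (fpos_nl HF)). apply exp_neg_01. lra. }
      assert (0 <= g1 (Vx x n) * (u n (exp y) - Vx x n)) by (apply Rmult_le_pos; lra).
      rewrite Rabs_pos_eq by auto.
      assert (g1 (Vx x n) * (u n (exp y) - Vx x n) <= g1 (Vx x n) * (mu n - Vx x n)) by (apply Rmult_le_compat_l; lra).
      lra. }
  exists x. split; [auto|]. intros be Hbe. destruct (Zero be Hbe) as [C [HC0 HC1]].
  split; [exists C; auto|].
  assert (k0 : kap * 0 < 1) by lra.
  assert (Eb : bx 2 = 1 / 2).
  { unfold bx. assert (S2 : 0 < sqrt 2) by (apply sqrt_lt_R0; lra).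
    replace 2 with (1 + 1) at 3 by ring. rewrite Rpower_plus, Rpower_1 by (apply Rdiv_lt_0_compat; lra).
    replace (sqrt 2 / 2 * (sqrt 2 / 2)) with (sqrt 2 * sqrt 2 / 4) by field. rewrite sqrt_sqrt by lra. field. }
  rewrite Eb.
  apply (bubble_zero HG HF HH HR (Vx x) (gmx x) (fun n => h (exp (x n))) SM2 Hxh
    (gmx_0 HG HF HH HR Hmu 2 0 x k0 HCx) (gmx_norm HG HF HH HR Hmu 2 0 x k0 HCx) (1 / 2) be C); auto; [lra|].
  replace (ln (8 * (1 / 2))) with (1 * (-1 * - (2 * ln 2))).
  - apply lim_ext_ev with (fun n => g1 (Vx x n) / g1 (mu n) * (-1 * (g1 (mu n) * (Vx x n - mu n)))).
    + apply is_lim_seq_mult'; [auto|]. apply is_lim_seq_mult'; [apply is_lim_seq_const|auto].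
    + ev_keep Cpos. ev_intros n [P1 [P2 [P3 P4]]]. field. lra.
  - replace (8 * (1 / 2)) with (2 * 2) by field. rewrite ln_mult by lra. ring.
Qed.

End Induction.

(** * Bubble windows and induction *)

Section Exit.
Context {g g1 g2 : R -> R} {t0 q kap : R} (HG : growth g g1 g2 t0 q kap).
Context {f : R -> R} {Lv : R} (HF : nonlin f g t0 Lv).
Context {h h1 : R -> R} {h0 K : R} (HH : hprop h h1 h0 K).
Context {lam mu : nat -> R} {u u1 u2 : nat -> R -> R}
  (HR : forall n, rsol f h (lam n) (mu n) (u n) (u1 n) (u2 n)).
Context (Hmu : is_lim_seq mu p_infty).
Local Notation chi := (drop_scale g g1).
Local Notation vv := (fun n x => u n (exp x)).
Local Notation mm := (fun n x => - (exp x * u1 n (exp x))).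
Local Notation A := (@Afun g g1 (fun x => ln (h (exp x))) (fun n => ln (lam n)) vv).
Local Notation concentrated := (@concentrated g g1 h lam mu u u1).
Local Notation Vx := (@pt_height u).
Local Notation gmx := (@pt_scale g g1 h lam u).
Local Notation zx := (@pt_z g g1 h lam u).
Local Notation zx1 := (@pt_z1 g g1 h lam u u1).
Local Notation zx2 := (@pt_z2 g g1 h lam u u2).

Definition close3 (a : R) (x : nat -> R) (n : nat) (r eps : R) : Prop :=
  Rabs (zx x n r - liouville a (bx a) r) <= eps /\ Rabs (zx1 x n r - liouville1 a (bx a) r) <= eps /\
  Rabs (zx2 x n r - liouville2 a (bx a) r) <= eps.

(* The bubble window [rhob, rho]; the first one starts at the centre ([first = true]). *)
Record window (first : bool) (a s : R) (x rho rhob : nat -> R) : Prop := {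
  wi_01 : eventually (fun n => 0 < rho n < 1 /\ 0 <= rhob n <= rho n);
  wi_0 : is_lim_seq rho 0;
  wi_b : is_lim_seq (fun n => rhob n / gmx x n) 0;
  wi_inf : is_lim_seq (fun n => rho n / gmx x n) p_infty;
  wi_rho : is_lim_seq (fun n => (mu n - u n (rho n)) / chi (mu n)) s;
  wi_rhob : if first then forall n, rhob n = 0 else
    eventually (fun n => 0 < rhob n) /\
    is_lim_seq (fun n => (mu n - u n (rhob n)) / chi (mu n)) s /\
    is_lim_seq (fun n => g1 (Vx x n) * - (rhob n * u1 n (rhob n))) (2 - a);
  wi_close : forall eps, 0 < eps -> eventually (fun n => forall r,
    rhob n / gmx x n <= r <= rho n / gmx x n -> 0 < r -> close3 a x n r eps);
  wi_flux : is_lim_seq (fun n => g1 (Vx x n) * - (rho n * u1 n (rho n))) (2 + a);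
  wi_ratio : forall eps, 0 < eps -> eventually (fun n => forall r, rhob n <= r <= rho n -> 0 < r ->
    Lv <= u n r /\ Rabs (g1 (u n r) / g1 (Vx x n) - 1) <= eps);
  wi_A : is_lim_seq (fun n => A n (ln (rho n))) m_infty;
  wi_Ag : is_lim_seq (fun n => A n (ln (rho n)) / g (u n (rho n))) 0 }.
#[global] Arguments wi_01 {first a s x rho rhob}.
#[global] Arguments wi_0 {first a s x rho rhob}.
#[global] Arguments wi_b {first a s x rho rhob}.
#[global] Arguments wi_inf {first a s x rho rhob}.
#[global] Arguments wi_rho {first a s x rho rhob}.
#[global] Arguments wi_rhob {first a s x rho rhob}.
#[global] Arguments wi_close {first a s x rho rhob}.
#[global] Arguments wi_flux {first a s x rho rhob}.
#[global] Arguments wi_ratio {first a s x rho rhob}.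
#[global] Arguments wi_A {first a s x rho rhob}.
#[global] Arguments wi_Ag {first a s x rho rhob}.

(** Convergence on every fixed window [lo j, j + 1] is made into convergence on one growing window
    by letting [j = J n] increase so slowly that all the estimates collected in [P] still hold. *)
Lemma window_exists (first : bool) (a s : R) (x : nat -> R) :
  0 < a <= 2 -> kap * s < 1 -> concentrated a s x ->
  (forall j : nat, let lo := if first then 0 else / (INR j + 1) in
    (exists C, 0 < C /\ eventually (fun n => forall r, 0 < r -> lo <= r <= INR j + 1 -> Rabs (zx x n r) <= C)) /\
    forall eps, 0 < eps -> eventually (fun n => forall r, 0 < r -> lo <= r <= INR j + 1 -> close3 a x n r eps)) ->
  exists rho rhob, window first a s x rho rhob.
Proof.
  intros Ha Hs HC Hyp.
  assert (HV := Vx_infty HG HF Hmu a s x Hs HC).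
  assert (Hgm := gmx_0 HG HF HH HR Hmu a s x Hs HC).
  assert (Hx := x_minf HG HF HH HR Hmu a s x Hs HC).
  assert (Hh := hx_lim HG HF HH HR Hmu a s x Hs HC).
  assert (Hb := bx_pos a).
  assert (Cpos := g_pos_ev HG HF (Vx x) 1 HV).
  assert (Hh0 := hp_h0 HH).
  assert (gp : forall n, 0 < gmx x n) by (intros; apply exp_pos).
  set (lo := fun j : nat => if first then 0 else / (INR j + 1)).
  assert (jp : forall j, 1 <= INR j + 1) by (intros j; generalize (pos_INR j); lra).
  assert (lo0 : forall j, 0 <= lo j <= INR j + 1).
  { intros j. specialize (jp j). unfold lo. destruct first; [lra|]. split.
    - left. apply Rinv_0_lt_compat. lra.
    - apply Rle_trans with 1; [|lra]. rewrite <- Rinv_1. apply Rinv_le_contravar; lra. }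
  set (e := fun j : nat => / (INR j + 1)).
  assert (ep : forall j, 0 < e j) by (intros j; apply Rinv_0_lt_compat; specialize (jp j); lra).
  (* The limit of [A] at the outer edge of the window, for [j] fixed. *)
  set (B := fun j : nat => 2 * ln (INR j + 1) + liouville a (bx a) (INR j + 1)).
  (* The square in [e j ^ 2] survives multiplication by radii up to [1 / e j], which the flux
     requires. The bounds by [g (Vx x n) * e j] make the change of height negligible against [chi],
     and [A] at the outer edge negligible against g. *)
  set (P := fun j n => 
    gmx x n * (INR j + 1) <= e j /\ gmx x n * (INR j + 1) < 1 /\
    (forall r, 0 < r -> lo j <= r <= INR j + 1 -> close3 a x n r (e j ^ 2) /\
       Rabs (zx x n r) <= g (Vx x n) * e j /\
       Lv <= u n (gmx x n * r) /\ Rabs (g1 (u n (gmx x n * r)) / g1 (Vx x n) - 1) <= e j) /\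
    Rabs (A n (ln (gmx x n * (INR j + 1))) - B j) <= 1 /\
    Rabs (B j) + 1 <= g (Vx x n) * e j).
  assert (EvP : forall j, eventually (P j)).
  { intros j. specialize (jp j). specialize (ep j).
    destruct (Hyp j) as [[C [HC0 HC1]] Hcl]. fold (lo j) in HC1, Hcl.
    specialize (Hcl (e j ^ 2) ltac:(now apply pow_lt)) as Hclose.
    assert (RW := ratio_window HG HF (Vx x) C HC0 HV (e j) ep).
    assert (Gg := lim_g HG (Vx x) HV).
    assert (G1 := proj1 (lim_inf _) Gg ((C + (Rabs (B j) + 1)) / e j)).
    assert (Gj : is_lim_seq (fun n => gmx x n * (INR j + 1)) 0).
    { replace (Finite 0) with (Finite (0 * (INR j + 1))) by (f_equal; ring). apply is_lim_seq_mult'; [auto|apply is_lim_seq_const]. }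
    assert (L1 := lim_lt _ _ (e j) Gj ep). assert (L2 := lim_lt _ _ 1 Gj ltac:(lra)).
    assert (AL : is_lim_seq (fun n => A n (ln (gmx x n * (INR j + 1)))) (B j)).
    { assert (Zl : is_lim_seq (fun n => g1 (Vx x n) * (u n (gmx x n * (INR j + 1)) - Vx x n)) (liouville a (bx a) (INR j + 1))).
      { apply lim_eps. intros eps He. specialize (Hcl eps He). ev_use Hcl. ev_intros n Q.
        destruct (Q (INR j + 1) ltac:(lra)) as [Q1 _]; [specialize (lo0 j); lra|]. exact Q1. }
      destruct (small_move HG HF (Vx x) _ _ HV Zl) as [_ [S2 [S3 S4]]].
      assert (Hhj : is_lim_seq (fun n => h (gmx x n * (INR j + 1))) h0).
      { apply lim_eps. intros eps He. destruct (hp_0 HH eps He) as [d [Hd Hd']].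
        assert (E := lim_lt _ _ d Gj Hd). ev_use E. ev_intros n E. apply Hd'.
        split; [apply Rmult_lt_0_compat; [auto|lra]|auto]. }
      apply lim_ext_ev with (fun n => 2 * ln (INR j + 1) + ln (h (gmx x n * (INR j + 1)) / h (exp (x n))) +
        (g (u n (gmx x n * (INR j + 1))) - g (Vx x n)) + ln (g1 (u n (gmx x n * (INR j + 1))) / g1 (Vx x n))).
      - replace (B j) with (2 * ln (INR j + 1) + ln (h0 / h0) + liouville a (bx a) (INR j + 1) + ln 1).
        + apply is_lim_seq_plus'; [apply is_lim_seq_plus'; [apply is_lim_seq_plus'; [apply is_lim_seq_const|]|]|]; auto.
          * apply lim_ln; [apply Rdiv_lt_0_compat; lra|]. apply is_lim_seq_div'; [auto|auto|lra].
          * apply lim_ln; [lra|auto].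
        + replace (h0 / h0) with 1 by (field; lra). rewrite ln_1. unfold B. ring.
      - assert (S3' := lim_gt _ _ 0 S3 ltac:(lra)). destruct HC as [Hxn _]. ev_use Hxn.
        ev_use S3'. ev_keep L2. ev_keep Cpos. ev_intros n [P1 [P2 [P3 P4]]] L2n S3' Hxn.
        assert (Hr : 0 < gmx x n * (INR j + 1)) by (apply Rmult_lt_0_compat; [auto|lra]).
        assert (Hp1 : 0 < h (gmx x n * (INR j + 1))) by (apply (hp_pos HH); lra).
        assert (Hp2 : 0 < h (exp (x n))) by (apply (hp_pos HH), exp_neg_01; auto).
        assert (Gp : 0 < g1 (u n (gmx x n * (INR j + 1)))).
        { replace (g1 (u n (gmx x n * (INR j + 1)))) with (g1 (u n (gmx x n * (INR j + 1))) / g1 (Vx x n) * g1 (Vx x n)) by (field; lra).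
          now apply Rmult_lt_0_compat. }
        rewrite !ln_div by auto.
        assert (Eln : ln (gmx x n * (INR j + 1)) = x n - A n (x n) / 2 + ln (INR j + 1)).
        { rewrite ln_mult by (auto; lra). unfold pt_scale. now rewrite ln_exp. }
        unfold Afun at 1. rewrite exp_ln by auto. rewrite Eln. unfold Afun. fold (Vx x n). field. }
    assert (AL' := proj1 (lim_eps _ _) AL 1 ltac:(lra)).
    ev_use HC1. ev_use Hclose. ev_use RW. ev_use G1. ev_use L1. ev_use L2. ev_use AL'. ev_keep Cpos.
    ev_intros n [P1 [P2 [P3 P4]]] AL' L2 L1 G1 RW Hcl' HC1.
    assert (Q : C + (Rabs (B j) + 1) <= g (Vx x n) * e j).
    { apply Rle_trans with ((C + (Rabs (B j) + 1)) / e j * e j); [right; field; lra|apply Rmult_le_compat_r; lra]. }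
    generalize (Rabs_pos (B j)). intros.
    unfold P. split; [lra|]. split; [auto|]. split; [|split; [auto|lra]].
    intros r Hr Hr'. split; [auto|]. specialize (HC1 r Hr Hr'). split; [lra|]. apply RW. exact HC1. }
  destruct (ev_diag P EvP) as [J [HJ1 HJ2]].
  assert (JI := lim_INR_inf J HJ1).
  assert (eJ : is_lim_seq (fun n => e (J n)) 0) by now apply lim_inv_inf.
  set (rho := fun n => gmx x n * (INR (J n) + 1)). set (rhob := fun n => gmx x n * lo (J n)).
  assert (Eb : forall n, rhob n / gmx x n = lo (J n)) by (intros n; unfold rhob; field; apply Rgt_not_eq, gp).
  assert (Er : forall n, rho n / gmx x n = INR (J n) + 1) by (intros n; unfold rho; field; apply Rgt_not_eq, gp).
  assert (loJ : is_lim_seq (fun n => lo (J n)) 0).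
  { unfold lo. destruct first; [apply is_lim_seq_const|exact eJ]. }
  assert (E01 : eventually (fun n => 0 < rho n < 1 /\ 0 <= rhob n <= rho n)).
  { ev_keep HJ2. ev_intros n [Q1 [Q2 _]]. specialize (gp n). specialize (jp (J n)). specialize (lo0 (J n)).
    unfold rho, rhob. split; [split; [apply Rmult_lt_0_compat; lra|auto]|]. split; [apply Rmult_le_pos; lra|].
    apply Rmult_le_compat_l; lra. }
  assert (hc := HC). destruct hc as [H1 [H2 [H3 H4]]].
  destruct (drop_ratio HG HF mu (Vx x) s Hmu Hs H4) as [_ [DR1 [DR2 DR3]]].
  assert (Cmu := g_pos_ev HG HF mu 1 Hmu).
  assert (Height : forall sq : nat -> R, eventually (fun n => 0 < sq n /\ lo (J n) <= sq n <= INR (J n) + 1) ->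
    is_lim_seq (fun n => (mu n - u n (gmx x n * sq n)) / chi (mu n)) s).
  { intros sq Hsq.
    assert (S0 : is_lim_seq (fun n => (Vx x n - u n (gmx x n * sq n)) / chi (Vx x n)) 0).
    { apply lim_squeeze0 with (fun n => e (J n)); [auto|].
      ev_keep HJ2. ev_use Hsq. ev_keep Cpos. ev_intros n [P1 [P2 [P3 P4]]] Hsq [_ [_ [Q _]]].
      destruct (Q (sq n) ltac:(tauto) ltac:(tauto)) as [_ [Q2 _]].
      rewrite Rminus_0_r. replace ((Vx x n - u n (gmx x n * sq n)) / chi (Vx x n)) with (- (zx x n (sq n) / g (Vx x n))).
      - rewrite Rabs_Ropp. unfold Rdiv. rewrite Rabs_mult, (Rabs_pos_eq (/ g (Vx x n))) by (left; apply Rinv_0_lt_compat; lra).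
        apply Rmult_le_reg_r with (g (Vx x n)); [lra|]. rewrite Rmult_assoc, Rinv_l by lra. lra.
      - unfold pt_z, rescaled, drop_scale. field. split; lra. }
    apply lim_ext_ev with (fun n => (mu n - Vx x n) / chi (mu n) +
       (Vx x n - u n (gmx x n * sq n)) / chi (Vx x n) * (chi (Vx x n) / chi (mu n))).
    - replace (Finite s) with (Finite (s + 0 * (1 - kap * s))) by (f_equal; ring).
      apply is_lim_seq_plus'; [exact H4|]. now apply is_lim_seq_mult'.
    - ev_keep Cmu. ev_keep Cpos. ev_intros n [P1 [P2 [P3 P4]]] [R1 [R2 [R3 R4]]].
      assert (0 < chi (mu n)) by (apply Rdiv_lt_0_compat; lra).
      assert (0 < chi (Vx x n)) by (apply Rdiv_lt_0_compat; lra). field. split; lra. }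
  assert (Flux : forall (sq : nat -> R) (lim : R), eventually (fun n => 0 < sq n /\ lo (J n) <= sq n <= INR (J n) + 1) ->
    is_lim_seq (fun n => sq n * liouville1 a (bx a) (sq n)) (- lim) ->
    is_lim_seq (fun n => g1 (Vx x n) * - (gmx x n * sq n * u1 n (gmx x n * sq n))) lim).
  { intros sq lim Hsq Hlim.
    apply is_lim_seq_ext with (fun n => - (sq n * zx1 x n (sq n))).
    { intros n. unfold pt_z1, rescaled1. ring. }
    replace (Finite lim) with (Rbar_opp (Finite (- lim))) by (simpl; f_equal; ring). apply -> is_lim_seq_opp.
    apply is_lim_seq_ext with (fun n => sq n * liouville1 a (bx a) (sq n) + sq n * (zx1 x n (sq n) - liouville1 a (bx a) (sq n))).
    { intros n. ring. }
    replace (Finite (- lim)) with (Finite (- lim + 0)) by (f_equal; ring). apply is_lim_seq_plus'; [auto|].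
    apply lim_squeeze0 with (fun n => e (J n)); [auto|].
    ev_keep HJ2. ev_use Hsq. ev_intros n Hsq [_ [_ [Q _]]].
    destruct (Q (sq n) ltac:(tauto) ltac:(tauto)) as [[_ [Q2 _]] _].
    rewrite Rminus_0_r, Rabs_mult, Rabs_pos_eq by lra.
    apply Rle_trans with ((INR (J n) + 1) * e (J n) ^ 2).
    - apply Rmult_le_compat; [lra|apply Rabs_pos|tauto|auto].
    - right. unfold e. field. specialize (jp (J n)). lra. }
  assert (Sq1 : eventually (fun n => 0 < INR (J n) + 1 /\ lo (J n) <= INR (J n) + 1 <= INR (J n) + 1)).
  { ev_intros n. specialize (jp (J n)). specialize (lo0 (J n)). lra. }
  assert (HRho := Height (fun n => INR (J n) + 1) Sq1).
  destruct (drop_ratio HG HF mu (fun n => u n (rho n)) s Hmu Hs HRho) as [Hur [_ [DRr _]]].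
  assert (B_minf : is_lim_seq (fun n => B (J n)) m_infty).
  { assert (L : is_lim_seq (fun n => a * ln (INR (J n) + 1)) p_infty).
    { eapply is_lim_seq_mult; [apply is_lim_seq_const|exact (lim_ln_inf _ JI)|].
      apply is_Rbar_mult_sym, is_Rbar_mult_p_infty_pos. simpl. lra. }
    apply lim_minf. intros M.
    assert (E := proj1 (lim_inf _) L (ln (2 * a ^ 2 * bx a) - 2 * ln (bx a) - M)). ev_use E. ev_intros n E. assert (Q := liouville_far a (bx a) (INR (J n) + 1) ltac:(lra) Hb ltac:(specialize (jp (J n)); lra)).
    unfold B. lra. }
  exists rho, rhob. split.
  - exact E01.
  - apply is_lim_seq_le_le_loc with (fun _ => 0) (fun n => e (J n)); [|apply is_lim_seq_const|auto].
    ev_keep E01. ev_keep HJ2. ev_intros n [Q1 _] [Q2 _]. unfold rho in *. lra.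
  - apply is_lim_seq_ext with (2 := loJ). intros n. now rewrite Eb.
  - apply is_lim_seq_ext with (2 := JI). intros n. now rewrite Er.
  - exact HRho.
  - destruct first.
    + intros n. unfold rhob, lo. ring.
    + assert (Sq0 : eventually (fun n => 0 < lo (J n) /\ lo (J n) <= lo (J n) <= INR (J n) + 1)).
      { ev_intros n. specialize (lo0 (J n)). split; [|lra]. unfold lo. apply ep. }
      split; [|split].
      * ev_intros n. unfold rhob. apply Rmult_lt_0_compat; [apply gp|]. unfold lo. apply ep.
      * exact (Height (fun n => lo (J n)) Sq0).
      * apply (Flux (fun n => lo (J n)) (2 - a) Sq0). replace (- (2 - a)) with (a - 2) by ring.
        unfold lo. apply (flux_liouville_0 a (bx a) (fun n => INR (J n) + 1)); auto. lra.
  - intros eps He. assert (E := lim_lt _ _ (Rmin 1 eps) eJ ltac:(apply Rmin_glb_lt; lra)).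
    ev_use E. ev_keep HJ2. ev_intros n [_ [_ [Q _]]] E r Hr Hr0. rewrite Eb, Er in Hr.
    destruct (Q r Hr0 Hr) as [[C1 [C2 C3]] _].
    assert (e (J n) ^ 2 <= eps).
    { assert (M1 := Rmin_l 1 eps). assert (M2 := Rmin_r 1 eps). specialize (ep (J n)). nra. }
    split; [lra|split; lra].
  - apply (Flux (fun n => INR (J n) + 1) (2 + a) Sq1). apply flux_liouville_inf; auto. lra.
  - intros eps He. assert (E := lim_lt _ _ eps eJ He).
    ev_use E. ev_keep HJ2. ev_intros n [_ [_ [Q _]]] E r Hr Hr0.
    assert (gn := gp n). 
    assert (Hr1 : lo (J n) <= r / gmx x n <= INR (J n) + 1).
    { unfold rho, rhob in Hr. split.
      - apply Rmult_le_reg_r with (gmx x n); [auto|]. unfold Rdiv. rewrite Rmult_assoc, Rinv_l by lra. lra.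
      - apply Rmult_le_reg_r with (gmx x n); [auto|]. unfold Rdiv. rewrite Rmult_assoc, Rinv_l by lra. lra. }
    destruct (Q (r / gmx x n) ltac:(now apply Rdiv_lt_0_compat) Hr1) as [_ [_ [Q3 Q4]]].
    replace (gmx x n * (r / gmx x n)) with r in Q3, Q4 by (field; lra). split; [auto|lra].
  - apply lim_minf. intros M. assert (E := proj1 (lim_minf _) B_minf (M - 1)). ev_use E. ev_keep HJ2.
    ev_intros n [_ [_ [_ [Q _]]]] E. apply Rabs_le_between in Q. unfold rho. lra.
  - apply lim_ext_ev with (fun n => A n (ln (rho n)) / g (Vx x n) * / ((g (u n (rho n)) / g (mu n)) / (g (Vx x n) / g (mu n)))).
    + replace (Finite 0) with (Finite (0 * / (Ef kap s / Ef kap s))) by (f_equal; ring).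
      assert (Ep := Ef_pos kap s).
      apply is_lim_seq_mult'.
      * apply lim_squeeze0 with (fun n => e (J n)); [auto|].
        ev_keep HJ2. ev_keep Cpos. ev_intros n [P1 [P2 [P3 P4]]] [_ [_ [_ [Q1 Q2]]]].
        rewrite Rminus_0_r. unfold Rdiv. rewrite Rabs_mult, (Rabs_pos_eq (/ g (Vx x n))) by (left; apply Rinv_0_lt_compat; lra).
        apply Rmult_le_reg_r with (g (Vx x n)); [lra|]. rewrite Rmult_assoc, Rinv_l by lra.
        fold (rho n) in Q1. 
        replace (A n (ln (rho n))) with ((A n (ln (rho n)) - B (J n)) + B (J n)) by ring.
        rewrite Rmult_1_r. eapply Rle_trans; [apply Rabs_triang|]. lra.
      * assert (L : is_lim_seq (fun n => g (u n (rho n)) / g (mu n) / (g (Vx x n) / g (mu n))) (Ef kap s / Ef kap s)).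
        { apply is_lim_seq_div'; auto. lra. }
        apply (is_lim_seq_inv _ (Ef kap s / Ef kap s)) in L; [exact L|].
        intros E. injection E. replace (Ef kap s / Ef kap s) with 1 by (field; lra). lra.
    + assert (Cur := g_pos_ev HG HF (fun n => u n (rho n)) 1 Hur).
      ev_use Cur. ev_keep Cmu. ev_keep Cpos. ev_intros n [P1 _] [P2 _] [P3 _]. field. repeat split; lra.
Qed.

(** [transition] starts at the outer edge with Y = 2 + a and ends with y near 2 - a', where [entry]
    takes over. The drop [t] is in units of chi at the current height, which is (1 - kap s) chi(mu)
    to leading order; hence the composed drop. *)
Lemma next_point (first : bool) (a s t : R) (x rho rhob : nat -> R) :
  0 < a <= 2 -> kap * s < 1 -> 0 < t -> kap * t < 1 -> 2 / (2 + a) * t - 1 + Ef kap t = 0 ->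
  concentrated a s x -> window first a s x rho rhob ->
  exists x', concentrated (2 - (2 + a) * ef kap t) (s + t * (1 - kap * s)) x'.
Proof.
  intros Ha Hs Ht Hkt Hz HC HW. assert (Hk := kap_range HG).
  assert (hc := HC). destruct hc as [H1 [H2 [H3 H4]]].
  destruct (drop_ratio HG HF mu (Vx x) s Hmu Hs H4) as [_ [DV1 [_ DV3]]].
  assert (Hrho := wi_rho HW).
  destruct (drop_ratio HG HF mu (fun n => u n (rho n)) s Hmu Hs Hrho) as [W0 [W1 [_ W3]]].
  assert (E01 := wi_01 HW).
  set (x0 := fun n => ln (rho n)).
  assert (E0 : eventually (fun n => exp (x0 n) = rho n)).
  { ev_keep E01. ev_intros n Q. unfold x0. apply exp_ln. lra. }
  assert (HV0 : is_lim_seq (fun n => vv n (x0 n)) p_infty).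
  { apply lim_ext_ev with (1 := W0). ev_keep E0. ev_intros n ->. reflexivity. }
  assert (efs := ef_pos kap s Hs).
  assert (Cmu := g_pos_ev HG HF mu 1 Hmu).
  assert (CV := g_pos_ev HG HF (Vx x) 1 (Vx_infty HG HF Hmu a s x Hs HC)).
  destruct (transition HG HF (weight_of_h _ _ _ _ HH) (sol_log HF HH HR) (2 + a) t x0) as [x1 [T1 [T2 [T3 [T4 T5]]]]];
    [lra|auto|auto|auto| |exact HV0| | | |].
  - ev_keep E01. ev_intros n Q. unfold x0. rewrite <- ln_1. apply ln_increasing; lra.
  - apply lim_ext_ev with (fun n => (g1 (u n (rho n)) / g1 (mu n)) / (g1 (Vx x n) / g1 (mu n)) * (g1 (Vx x n) * - (rho n * u1 n (rho n)))).
    + replace (Finite (2 + a)) with (Finite (ef kap s / ef kap s * (2 + a))) by (f_equal; field; lra).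
      apply is_lim_seq_mult'; [|exact (wi_flux HW)]. apply is_lim_seq_div'; auto. lra.
    + ev_keep E0. ev_keep Cmu. ev_keep CV. ev_intros n [_ [_ [_ P1]]] [_ [_ [_ P2]]] ->. field. lra.
  - exact (wi_A HW).
  - apply lim_ext_ev with (1 := wi_Ag HW). ev_keep E0. ev_intros n ->. reflexivity.
  - assert (HV1 : is_lim_seq (fun n => vv n (x1 n)) p_infty /\
      is_lim_seq (fun n => chi (vv n (x1 n)) / chi (vv n (x0 n))) (1 - kap * t)).
    { destruct (drop_ratio HG HF (fun n => vv n (x0 n)) (fun n => vv n (x1 n)) t HV0 Hkt T2) as [Q1 [Q2 _]]. split; auto. }
    destruct HV1 as [HV1 HV2].
    assert (Sl := Ffun_slope kap (2 + a) t Hk ltac:(lra) Ht Hkt Hz).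
    assert (eft := ef_pos kap t Hkt).
    destruct (entry HG HF (weight_of_h _ _ _ _ HH) (sol_log HF HH HR) (2 - (2 + a) * ef kap t) x1) as [x2 [U1 [U2 [U3 U4]]]]; auto.
    + assert (0 < (2 + a) * ef kap t) by (apply Rmult_lt_0_compat; lra). lra.
    + replace (2 - (2 - (2 + a) * ef kap t)) with ((2 + a) * ef kap t) by ring. exact T3.
    + exists x2. split; [exact U1|]. split; [exact U3|]. split; [exact U4|].
      assert (C0 := g_pos_ev HG HF _ 1 HV0). assert (C1 := g_pos_ev HG HF _ 1 HV1).
      apply lim_ext_ev with (fun n => (mu n - u n (rho n)) / chi (mu n) +
        (chi (u n (rho n)) / chi (mu n)) * ((vv n (x0 n) - vv n (x1 n)) / chi (vv n (x0 n)) +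
          (vv n (x1 n) - vv n (x2 n)) / chi (vv n (x1 n)) * (chi (vv n (x1 n)) / chi (vv n (x0 n))))).
      * replace (Finite (s + t * (1 - kap * s))) with (Finite (s + (1 - kap * s) * (t + 0 * (1 - kap * t)))) by (f_equal; ring).
        apply is_lim_seq_plus'; [auto|]. apply is_lim_seq_mult'; [auto|]. apply is_lim_seq_plus'; [auto|].
        now apply is_lim_seq_mult'.
      * ev_use C0. ev_use C1. ev_keep Cmu. ev_keep E0. ev_intros n E0n [P1 [_ [_ P2]]] [P3 [_ [_ P4]]] [P5 [_ [_ P6]]].
        cbv beta in *. rewrite <- E0n.
        assert (0 < chi (mu n)) by (apply Rdiv_lt_0_compat; lra).
        assert (0 < chi (u n (exp (x0 n)))) by (apply Rdiv_lt_0_compat; lra).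
        assert (0 < chi (u n (exp (x1 n)))) by (apply Rdiv_lt_0_compat; lra).
        field. repeat split; lra.
Qed.

End Exit.

(** * Regularity up to the boundary, integrals, and the limiting sequences *)

Lemma deriv_within_cont (D : R -> Prop) (F : R -> R) (x l : R) :
  is_deriv_within D F x l -> cont_within D F x.
Proof.
  intros H eps He. destruct (H 1 ltac:(lra)) as [d [Hd Hd']].
  assert (P : 0 < Rabs l + 1) by (generalize (Rabs_pos l); lra).
  exists (Rmin d (eps / (Rabs l + 1))). split.
  { apply Rmin_glb_lt; [auto|]. now apply Rdiv_lt_0_compat. }
  intros y Hy Hyx. assert (M1 := Rmin_l d (eps / (Rabs l + 1))). assert (M2 := Rmin_r d (eps / (Rabs l + 1))).
  destruct (Req_dec y x) as [->|Hne]. { rewrite Rminus_diag, Rabs_R0. auto. }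
  specialize (Hd' y Hy Hne ltac:(lra)).
  replace (F y - F x) with ((F y - F x) / (y - x) * (y - x)) by (field; lra).
  rewrite Rabs_mult.
  assert (Rabs ((F y - F x) / (y - x)) <= Rabs l + 1).
  { replace ((F y - F x) / (y - x)) with (((F y - F x) / (y - x) - l) + l) by ring.
    eapply Rle_trans; [apply Rabs_triang|]. lra. }
  apply Rle_lt_trans with ((Rabs l + 1) * Rabs (y - x)).
  - apply Rmult_le_compat_r; [apply Rabs_pos|auto].
  - apply Rlt_le_trans with ((Rabs l + 1) * (eps / (Rabs l + 1))); [apply Rmult_lt_compat_l; lra|right; field; lra].
Qed.

Lemma deriv_within_interior (D : R -> Prop) (F : R -> R) (x l d : R) :
  0 < d -> (forall y, Rabs (y - x) < d -> D y) -> is_deriv_within D F x l -> is_derive F x l.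
Proof.
  intros Hd HD H. apply is_derive_Reals. intros eps He. destruct (H eps He) as [d' [Hd' H']].
  assert (P : 0 < Rmin d d') by now apply Rmin_glb_lt.
  exists (mkposreal _ P). intros z Hz0 Hz. simpl in Hz.
  assert (M1 := Rmin_l d d'). assert (M2 := Rmin_r d d').
  specialize (H' (x + z)). replace (x + z - x) with z in H' by ring. apply H'; [|lra|lra].
  apply HD. replace (x + z - x) with z by ring. lra.
Qed.

Lemma deriv_within_Rle (F : R -> R) (t0 x l : R) :
  t0 < x -> is_deriv_within (Rle t0) F x l -> is_derive F x l.
Proof.
  intros Hx. apply deriv_within_interior with (x - t0); [lra|]. intros y Hy. apply Rabs_def2 in Hy. lra.
Qed.

Lemma deriv_within_I01 (F : R -> R) (x l : R) :
  0 < x < 1 -> is_deriv_within I01 F x l -> is_derive F x l.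
Proof.
  intros Hx. apply deriv_within_interior with (Rmin x (1 - x)); [apply Rmin_glb_lt; lra|].
  intros y Hy. apply Rabs_def2 in Hy. generalize (Rmin_l x (1 - x)) (Rmin_r x (1 - x)). unfold I01. lra.
Qed.

(** Projection onto [a, b]: composing with it turns continuity relative to the interval into
    continuity on the line, for use in the extreme value theorem and in integrals that start at r =
    0. *)
Definition clamp (a b x : R) : R := Rmax a (Rmin x b).

Lemma clamp_in (a b x : R) : a <= b -> a <= clamp a b x <= b.
Proof.
  intros Hab. unfold clamp. split; [apply Rmax_l|]. apply Rmax_lub; [auto|apply Rmin_r].
Qed.

Lemma clamp_id (a b x : R) : a <= x <= b -> clamp a b x = x.
Proof. intros Hx. unfold clamp. rewrite Rmin_left, Rmax_right; lra. Qed.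

Lemma clamp_lip (a b x y : R) : a <= b -> Rabs (clamp a b y - clamp a b x) <= Rabs (y - x).
Proof.
  intros Hab. unfold clamp, Rmax, Rmin.
  repeat destruct Rle_dec; unfold Rabs; repeat destruct Rcase_abs; lra.
Qed.

Lemma cont_clamp (D : R -> Prop) (F : R -> R) (a b : R) : a <= b ->
  (forall x, a <= x <= b -> D x) -> (forall x, a <= x <= b -> cont_within D F x) ->
  forall x, continuity_pt (fun x => F (clamp a b x)) x.
Proof.
  intros Hab HD HF x eps He.
  destruct (HF _ (clamp_in a b x Hab) eps He) as [d [Hd H]].
  exists d. split; [auto|]. intros y [_ Hy]. simpl in Hy |- *. unfold R_dist in *.
  apply H; [apply HD, clamp_in; auto|]. eapply Rle_lt_trans; [apply clamp_lip; auto|auto].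
Qed.

Lemma within_max (D : R -> Prop) (F : R -> R) (a b : R) : a <= b ->
  (forall x, a <= x <= b -> D x) -> (forall x, a <= x <= b -> cont_within D F x) ->
  exists y, a <= y <= b /\ forall x, a <= x <= b -> F x <= F y.
Proof.
  intros Hab HD HF.
  destruct (continuity_ab_maj (fun x => F (clamp a b x)) a b Hab) as [y [Hy1 Hy2]].
  { intros. now apply (cont_clamp D). }
  exists y. split; [auto|]. intros x Hx. specialize (Hy1 x Hx). now rewrite !clamp_id in Hy1.
Qed.

Lemma within_min (D : R -> Prop) (F : R -> R) (a b : R) : a <= b ->
  (forall x, a <= x <= b -> D x) -> (forall x, a <= x <= b -> cont_within D F x) ->
  exists y, a <= y <= b /\ forall x, a <= x <= b -> F y <= F x.
Proof.
  intros Hab HD HF. destruct (within_max D (fun x => - F x) a b Hab HD) as [y [Hy1 Hy2]].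
  - intros x Hx eps He. destruct (HF x Hx eps He) as [d [Hd H]]. exists d. split; [auto|].
    intros y Hy Hyx. replace (- F y - - F x) with (- (F y - F x)) by ring. rewrite Rabs_Ropp. auto.
  - exists y. split; [auto|]. intros x Hx. specialize (Hy2 x Hx). lra.
Qed.

Lemma hprop_of_C1 (h h1 : R -> R) : C1_with I01 h h1 -> (forall r, I01 r -> 0 < h r) ->
  exists K, hprop h h1 (h 0) K.
Proof.
  intros [Hd Hc] Hp.
  assert (Hh : forall x, 0 <= x <= 1 -> cont_within I01 h x) by (intros x Hx; eapply deriv_within_cont, Hd; exact Hx).
  destruct (within_max I01 h 0 1) as [xM [HM1 HM2]]; [lra|auto|auto|].
  destruct (within_min I01 h 0 1) as [xm [Hm1 Hm2]]; [lra|auto|auto|].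
  destruct (within_max I01 h1 0 1) as [yM [HN1 HN2]]; [lra|auto|auto|].
  destruct (within_min I01 h1 0 1) as [ym [Hn1 Hn2]]; [lra|auto|auto|].
  assert (P := Hp xm Hm1).
  set (N := Rabs (h1 yM) + Rabs (h1 ym)).
  assert (HN : 0 <= N) by (unfold N; generalize (Rabs_pos (h1 yM)) (Rabs_pos (h1 ym)); lra).
  assert (HNh : 0 <= N / h xm) by (apply Rmult_le_pos; [auto|left; now apply Rinv_0_lt_compat]).
  exists (N / h xm + Rabs (ln (h xM)) + Rabs (ln (h xm))).
  assert (Q1 := Rabs_pos (ln (h xM))). assert (Q2 := Rabs_pos (ln (h xm))).
  split.
  - intros r Hr. apply Hp. unfold I01. lra.
  - intros r Hr. apply deriv_within_I01; [auto|]. apply Hd. unfold I01. lra.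
  - intros r Hr. assert (Pr := Hp r ltac:(unfold I01; lra)).
    specialize (Hm2 r ltac:(lra)). specialize (HN2 r ltac:(lra)). specialize (Hn2 r ltac:(lra)).
    apply Rle_trans with (N / h xm); [|lra]. unfold Rdiv. rewrite Rabs_mult, (Rabs_pos_eq (/ h r)) by (left; now apply Rinv_0_lt_compat).
    apply Rmult_le_compat; [apply Rabs_pos|left; now apply Rinv_0_lt_compat| |now apply Rinv_le_contravar].
    unfold N. generalize (Rle_abs (h1 yM)) (Rabs_pos (h1 yM)) (Rabs_pos (h1 ym)) (Rle_abs (- h1 ym)).
    rewrite Rabs_Ropp. intros. apply Rabs_le_between. lra.
  - intros r Hr. specialize (Hm2 r ltac:(lra)). specialize (HM2 r ltac:(lra)).
    assert (L1 : ln (h xm) <= ln (h r)) by (apply ln_le; lra).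
    assert (L2 : ln (h r) <= ln (h xM)) by (apply ln_le; lra).
    generalize (Rle_abs (ln (h xM))) (Rle_abs (- ln (h xm))). rewrite Rabs_Ropp. intros.
    apply Rabs_le_between. lra.
  - apply Hp. unfold I01. lra.
  - intros eps He. destruct (Hh 0 ltac:(lra) eps He) as [d [Hdp H]].
    exists (Rmin d 1). split; [apply Rmin_glb_lt; lra|]. intros r Hr.
    generalize (Rmin_l d 1) (Rmin_r d 1). intros. left. apply H; [unfold I01; lra|].
    rewrite Rminus_0_r, Rabs_pos_eq; lra.
Qed.

(** The level is taken so high that exp (g) exceeds the maximum of [f] on [0, t0 + 1]; beyond t0 + 1
    the monotonicity of g is enough. *)
Lemma nonlin_of_C1 (f f1 g1 g2 : R -> R) (t0 q kap : R) : 0 <= t0 ->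
  C1_with (Rle 0) f f1 -> (forall t, 0 <= t -> 0 <= f t) -> (forall t, t0 <= t -> 0 < f t) ->
  growth (fun s => ln (f s)) g1 g2 t0 q kap ->
  exists Lv, nonlin f (fun s => ln (f s)) t0 Lv.
Proof.
  intros Ht0 [Hd Hc] Hnn Hp HG.
  destruct (within_max (Rle 0) f 0 (t0 + 1)) as [xM [HM1 HM2]]; [lra|intros; lra| |].
  { intros x Hx. eapply deriv_within_cont, Hd. lra. }
  destruct (g_infty HG (ln (f xM + 1))) as [T [HT1 HT2]].
  assert (PM := Hnn xM ltac:(lra)).
  exists T. split; [lra|auto| |].
  - intros x y Hx Hxy Hy. rewrite exp_ln by (apply Hp; lra).
    destruct (Rle_dec x (t0 + 1)) as [H|H].
    + apply Rle_trans with (f xM); [apply HM2; lra|]. specialize (HT2 y Hy).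
      apply exp_le in HT2. rewrite !exp_ln in HT2; [lra|apply Hp; lra|lra].
    + assert (Q := g_mono HG x y ltac:(lra) Hxy). cbv beta in Q. apply exp_le in Q.
      rewrite !exp_ln in Q; [auto|apply Hp; lra|apply Hp; lra].
  - intros x Hx. rewrite exp_ln; [reflexivity|apply Hp; lra].
Qed.

Lemma rsol_of_C2 (f h : R -> R) (lam mu : R) (u u1 u2 : R -> R) :
  0 < lam -> C2_with I01 u u1 u2 ->
  (forall r, 0 < r < 1 -> - u2 r - u1 r / r = lam * h r * f (u r)) ->
  (forall r, 0 < r < 1 -> 0 < u r) -> u 0 = mu -> u1 0 = 0 -> u 1 = 0 ->
  rsol f h lam mu u u1 u2.
Proof.
  intros Hl [Hu [Hu1 _]] Hode Hpos H0 H10 H1.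
  assert (C0 : forall x, I01 x -> cont_within I01 u x) by (intros x Hx; eapply deriv_within_cont, Hu; exact Hx).
  assert (C1 : forall x, I01 x -> cont_within I01 u1 x) by (intros x Hx; eapply deriv_within_cont, Hu1; exact Hx).
  split; auto.
  - intros r Hr. apply deriv_within_I01; [auto|]. apply Hu. unfold I01; lra.
  - intros r Hr. apply deriv_within_I01; [auto|]. apply Hu1. unfold I01; lra.
  - intros r Hr. specialize (Hode r Hr). lra.
  - intros eps He.
    destruct (C0 0 ltac:(unfold I01; lra) eps He) as [d1 [Hd1 D1]].
    destruct (C1 0 ltac:(unfold I01; lra) eps He) as [d2 [Hd2 D2]].
    exists (Rmin 1 (Rmin d1 d2)). split; [repeat apply Rmin_glb_lt; lra|].
    intros r Hr. generalize (Rmin_l 1 (Rmin d1 d2)) (Rmin_r 1 (Rmin d1 d2)) (Rmin_l d1 d2) (Rmin_r d1 d2). intros.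
    assert (Ir : I01 r) by (unfold I01; lra).
    specialize (D1 r Ir). specialize (D2 r Ir). rewrite Rminus_0_r, Rabs_pos_eq in D1, D2 by lra.
    rewrite H0 in D1. rewrite H10, Rminus_0_r in D2. split; left; [apply D1|apply D2]; lra.
  - intros c r0 Hc Hr0. destruct (C0 1 ltac:(unfold I01; lra) c Hc) as [d [Hd D]].
    set (r := Rmax (1 - d / 2) (Rmax (1 / 2) ((r0 + 1) / 2))).
    assert (B1 := Rmax_l (1 - d / 2) (Rmax (1 / 2) ((r0 + 1) / 2))).
    assert (B2 := Rmax_r (1 - d / 2) (Rmax (1 / 2) ((r0 + 1) / 2))).
    assert (B3 := Rmax_l (1 / 2) ((r0 + 1) / 2)). assert (B4 := Rmax_r (1 / 2) ((r0 + 1) / 2)). fold r in B1, B2.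
    assert (r < 1) by (unfold r; repeat apply Rmax_lub_lt; lra).
    exists r. split; [lra|]. specialize (D r ltac:(unfold I01; lra)).
    rewrite H1, Rabs_left in D by lra. specialize (D ltac:(lra)). apply Rabs_def2 in D. lra.
Qed.

Section Integrals.
Context (f h : R -> R) (lam mu : R) (u u1 u2 : R -> R) (HR : rsol f h lam mu u u1 u2).
Context (Hch : forall x, 0 <= x <= 1 -> cont_within I01 h x).
Context (Hcu : forall x, 0 <= x <= 1 -> cont_within I01 u x).
Context (Hcu1 : forall x, 0 <= x <= 1 -> cont_within I01 u1 x).
Context (H0 : u 0 = mu) (Hmu : 0 < mu) (H10 : u1 0 = 0).

Lemma integrand_cont (F : R -> R) (r : R) : (forall y, 0 < y -> continuity_pt F y) -> 0 <= r < 1 ->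
  continuous (fun r => lam * h (clamp 0 1 r) * F (u (clamp 0 1 r)) * r) r.
Proof.
  intros HF Hr. apply continuity_pt_filterlim.
  apply continuity_pt_mult; [|apply continuity_pt_id]. apply continuity_pt_mult.
  - apply continuity_pt_mult; [apply continuity_pt_const; now intros ? ?|].
    apply (cont_clamp I01 h 0 1); auto; lra.
  - apply (continuity_pt_comp (fun r => u (clamp 0 1 r)) F).
    + apply (cont_clamp I01 u 0 1); auto; lra.
    + apply HF. rewrite clamp_id by lra.
      destruct (Req_dec r 0) as [->|Hne]; [rewrite H0; auto|]. apply (rs_pos HR). lra.
Qed.

Lemma integrand_ex (F : R -> R) (al be : R) : (forall y, 0 < y -> continuity_pt F y) ->
  0 <= al < 1 -> 0 <= be < 1 -> ex_RInt (fun r => lam * h r * F (u r) * r) al be.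
Proof.
  intros HF Hal Hbe.
  assert (M1 : 0 <= Rmin al be) by (apply Rmin_glb; lra).
  assert (M2 : Rmax al be < 1) by (apply Rmax_lub_lt; lra).
  apply (ex_RInt_ext (fun r => lam * h (clamp 0 1 r) * F (u (clamp 0 1 r)) * r)).
  - intros r Hr. rewrite clamp_id; [reflexivity|lra].
  - apply (@ex_RInt_continuous R_CompleteNormedModule). intros r Hr. apply integrand_cont; [auto|lra].
Qed.

Lemma flux_integral (al be : R) : (forall y, 0 < y -> continuity_pt f y) ->
  0 <= al < 1 -> 0 <= be < 1 ->
  RInt (fun r => lam * h r * f (u r) * r) al be = - (be * u1 be) - - (al * u1 al).
Proof.
  intros HF Hal Hbe.
  assert (M1 : 0 <= Rmin al be) by (apply Rmin_glb; lra).
  assert (M2 : Rmax al be < 1) by (apply Rmax_lub_lt; lra).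
  apply is_RInt_unique.
  apply (is_RInt_ext (fun r => lam * h (clamp 0 1 r) * f (u (clamp 0 1 r)) * r)).
  { intros r Hr. rewrite clamp_id; [reflexivity|lra]. }
  assert (E : forall r, 0 <= r < 1 -> - (r * u1 r) = - (r * u1 (clamp 0 1 r))) by (intros r Hr; rewrite clamp_id; lra).
  rewrite !E by lra.
  apply (is_RInt_derive (fun r => - (r * u1 (clamp 0 1 r))) (fun r => lam * h (clamp 0 1 r) * f (u (clamp 0 1 r)) * r)).
  (* The point r = 0 needs its own argument: the difference quotient of -r u' is -u', which tends to
     -u'(0) = 0, the value of the integrand there. *)
  - intros r Hr. destruct (Req_dec r 0) as [->|Hne].
    + rewrite Rmult_0_r. apply is_derive_Reals. intros eps He.
      assert (C := cont_clamp I01 u1 0 1 ltac:(lra) ltac:(auto) Hcu1 0 eps He).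
      destruct C as [d [Hd C]]. exists (mkposreal d Hd). intros z Hz Hzd. simpl in Hzd.
      rewrite Rplus_0_l. replace ((- (z * u1 (clamp 0 1 z)) - - (0 * u1 (clamp 0 1 0))) / z - 0) with (- u1 (clamp 0 1 z)) by (field; auto).
      rewrite Rabs_Ropp. specialize (C z). simpl in C. unfold R_dist in C.
      rewrite (clamp_id 0 1 0) in C by lra. rewrite H10, !Rminus_0_r in C.
      apply C. split; [split; [exact I|auto]|auto].
    + assert (Hr1 : 0 < r < 1) by lra.
      apply (is_derive_ext_loc (fun r => - (r * u1 r))).
      * exists (mkposreal (Rmin r (1 - r)) ltac:(apply Rmin_glb_lt; lra)). intros y Hy.
        apply Rabs_def2 in Hy. unfold minus, plus, opp in Hy; simpl in Hy.
        generalize (Rmin_l r (1 - r)) (Rmin_r r (1 - r)). intros. rewrite clamp_id; lra.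
      * rewrite clamp_id by lra. apply (rs_flux_deriv HR). auto.
  - intros r Hr. apply integrand_cont; [auto|lra].
Qed.
End Integrals.

(** Both recursions in one set of variables: [sg k] is the accumulated drop and [t k] the next one.
    If q = 1 they are log (1/eta_k) and log (eta_k/eta_{k+1}); if q > 1 then 1 - kap sg = delta_k, 1
    - kap t = delta_{k+1}/delta_k and P = 1/kap. The range of [a k] is inherited from
    [Ffun_slope]. *)
Lemma seq_facts (q P kap : R) (a delta eta : nat -> R) :
  1 <= q < 2 -> kap = 1 - / q -> (1 < q -> kap * P = 1) -> seq_spec q P a delta eta ->
  exists sg t : nat -> R, forall k, (1 <= k)%nat ->
    0 < a k <= 2 /\ kap * sg k < 1 /\ 0 < t k /\ kap * t k < 1 /\
    2 / (2 + a k) * t k - 1 + Ef kap (t k) = 0 /\ a (S k) = 2 - (2 + a k) * ef kap (t k) /\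
    sg (S k) = sg k + t k * (1 - kap * sg k) /\ delta k = 1 - kap * sg k /\
    (q = 1 -> sg k = ln (/ eta k)) /\ (k = 1%nat -> sg k = 0 /\ a k = 2).
Proof.
  intros Hq Hkap HP [Ha1 [Hd1 [He1 [Hq1 Hq2]]]].
  assert (Hk : 0 <= kap < 1).
  { rewrite Hkap. assert (0 < / q) by (apply Rinv_0_lt_compat; lra).
    assert (/ q <= / 1) by (apply Rinv_le_contravar; lra). lra. }
  assert (Core : forall t, (forall k, (1 <= k)%nat -> 0 < t k /\ kap * t k < 1 /\
     2 / (2 + a k) * t k - 1 + Ef kap (t k) = 0 /\ a (S k) = 2 - (2 + a k) * ef kap (t k)) ->
     forall k, (1 <= k)%nat -> 0 < a k <= 2).
  { intros t Ht k Hk1. induction Hk1 as [|k Hk1 IH]; [lra|].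
    destruct (Ht k Hk1) as [T1 [T2 [T3 T4]]].
    assert (Sl := Ffun_slope kap (2 + a k) (t k) Hk ltac:(lra) T1 T2 T3).
    assert (0 < (2 + a k) * ef kap (t k)) by (apply Rmult_lt_0_compat; [lra|now apply ef_pos]). lra. }
  destruct (Req_dec q 1) as [E1|E1].
  - assert (K0 : kap = 0) by (rewrite Hkap, E1; field).
    specialize (Hq2 E1).
    assert (HE : forall s, Ef kap s = exp (- s)).
    { intros s. unfold Ef, Lf. destruct (Req_EM_T kap 0); [auto|lra]. }
    assert (He : forall s, ef kap s = exp (- s)).
    { intros s. unfold ef. rewrite HE, K0. field. }
    assert (Hep : forall k, (1 <= k)%nat -> 0 < eta k).
    { intros k Hk1. destruct (Hq2 k Hk1) as [Q _]. lra. }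
    assert (Ht : forall k, (1 <= k)%nat -> exp (- ln (eta k / eta (S k))) = eta (S k) / eta k).
    { intros k Hk1. assert (P1 := Hep k Hk1). assert (P2 := Hep (S k) ltac:(lia)).
      rewrite exp_Ropp, exp_ln by now apply Rdiv_lt_0_compat. field. lra. }
    assert (Tk : forall k, (1 <= k)%nat -> 0 < ln (eta k / eta (S k)) /\ kap * ln (eta k / eta (S k)) < 1 /\
     2 / (2 + a k) * ln (eta k / eta (S k)) - 1 + Ef kap (ln (eta k / eta (S k))) = 0 /\
     a (S k) = 2 - (2 + a k) * ef kap (ln (eta k / eta (S k)))).
    { intros k Hk1. assert (P1 := Hep k Hk1). assert (P2 := Hep (S k) ltac:(lia)).
      destruct (Hq2 k Hk1) as [Q1 [Q2 [Q3 Q4]]]. rewrite HE, He, Ht by auto. split; [|split; [rewrite K0; lra|split; lra]].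
      rewrite <- ln_1. apply ln_increasing; [lra|].
      apply Rmult_lt_reg_r with (eta (S k)); [auto|]. replace (eta k / eta (S k) * eta (S k)) with (eta k) by (field; lra). lra. }
    exists (fun k => ln (/ eta k)), (fun k => ln (eta k / eta (S k))).
    intros k Hk1. assert (P1 := Hep k Hk1). assert (P2 := Hep (S k) ltac:(lia)).
    destruct (Tk k Hk1) as [T1 [T2 [T3 T4]]].
    split; [apply (Core _ Tk); auto|]. split; [rewrite K0; lra|]. split; [auto|]. split; [auto|]. split; [auto|]. split; [auto|].
    split; [|split; [|split; [auto|]]].
    + rewrite K0, ln_div, !ln_Rinv by auto. ring.
    + destruct (Hq2 k Hk1) as [_ [_ [_ Q]]]. rewrite Q, K0. ring.
    + intros ->. rewrite He1, Rinv_1, ln_1. auto.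
  - specialize (HP ltac:(lra)). specialize (Hq1 ltac:(lra)).
    assert (K0 : 0 < kap).
    { rewrite Hkap. assert (/ q < / 1) by (apply Rinv_lt_contravar; lra). lra. }
    assert (EP : P = / kap). { apply Rmult_eq_reg_l with kap; [|lra]. rewrite HP, Rinv_r; lra. }
    set (X := fun k => delta (S k) / delta k).
    assert (HX : forall k, (1 <= k)%nat -> 0 < X k < 1).
    { intros k Hk1. destruct (Hq1 k Hk1) as [Q _]. unfold X. split; [apply Rdiv_lt_0_compat; lra|].
      apply Rmult_lt_reg_r with (delta k); [lra|]. replace (delta (S k) / delta k * delta k) with (delta (S k)) by (field; lra). lra. }
    set (t := fun k => (1 - X k) / kap).
    assert (kt : forall k, 1 - kap * t k = X k) by (intros k; unfold t; field; lra).
    assert (HE : forall k, Ef kap (t k) = Rpower (X k) P).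
    { intros k. unfold Ef, Lf. destruct (Req_EM_T kap 0); [lra|]. rewrite kt, EP. unfold Rpower. f_equal. field. lra. }
    assert (He : forall k, (1 <= k)%nat -> ef kap (t k) = Rpower (X k) (P - 1)).
    { intros k Hk1. unfold ef. rewrite HE, kt. destruct (HX k Hk1) as [X1 X2].
      unfold Rminus. rewrite Rpower_plus, Rpower_Ropp, Rpower_1 by auto. reflexivity. }
    assert (Tk : forall k, (1 <= k)%nat -> 0 < t k /\ kap * t k < 1 /\
     2 / (2 + a k) * t k - 1 + Ef kap (t k) = 0 /\ a (S k) = 2 - (2 + a k) * ef kap (t k)).
    { intros k Hk1. destruct (Hq1 k Hk1) as [Q1 [Q2 [Q3 Q4]]]. fold (X k) in Q2, Q3. destruct (HX k Hk1) as [X1 X2].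
      split; [unfold t; apply Rdiv_lt_0_compat; lra|]. split; [specialize (kt k); lra|]. rewrite HE, He by auto.
      split; [|lra]. rewrite <- Q2. f_equal. f_equal. unfold t. rewrite EP. unfold Rdiv. ring. }
    assert (dp : forall k, (1 <= k)%nat -> 0 < delta k). { intros k Hk1. destruct (Hq1 k Hk1) as [Q _]. lra. }
    exists (fun k => (1 - delta k) / kap), t. intros k Hk1. destruct (Tk k Hk1) as [T1 [T2 [T3 T4]]].
    assert (D := dp k Hk1).
    split; [apply (Core _ Tk); auto|]. split; [replace (kap * ((1 - delta k) / kap)) with (1 - delta k) by (field; lra); lra|].
    split; [auto|]. split; [auto|]. split; [auto|]. split; [auto|]. split; [|split; [|split]].
    + unfold t, X. field. lra.
    + field. lra.
    + intros; lra.
    + intros ->. rewrite Hd1. split; [field; lra|auto].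
Qed.

(** * The limits of the theorem *)

Section Conclusions.
Context {g g1 g2 : R -> R} {t0 q kap : R} (HG : growth g g1 g2 t0 q kap).
Context {f f1 : R -> R} {Lv : R} (HF : nonlin f g t0 Lv).
Context (HF1 : forall y, Lv <= y -> f1 y = g1 y * exp (g y)).
Context (Hfc : forall y, 0 < y -> continuity_pt f y) (Hf1c : forall y, 0 < y -> continuity_pt f1 y).
Context {h h1 : R -> R} {h0 K : R} (HH : hprop h h1 h0 K).
Context {lam mu : nat -> R} {u u1 u2 : nat -> R -> R}
  (HR : forall n, rsol f h (lam n) (mu n) (u n) (u1 n) (u2 n)).
Context (Hmu : is_lim_seq mu p_infty) (Hmup : forall n, 0 < mu n).
Context (Hch : forall x, 0 <= x <= 1 -> cont_within I01 h x).
Context (Hcu : forall n x, 0 <= x <= 1 -> cont_within I01 (u n) x).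
Context (Hcu1 : forall n x, 0 <= x <= 1 -> cont_within I01 (u1 n) x).
Context (H0 : forall n, u n 0 = mu n) (H10 : forall n, u1 n 0 = 0).
Local Notation chi := (drop_scale g g1).
Local Notation vv := (fun n x => u n (exp x)).
Local Notation A := (@Afun g g1 (fun x => ln (h (exp x))) (fun n => ln (lam n)) vv).
Local Notation concentrated := (@concentrated g g1 h lam mu u u1).
Local Notation window := (@window g g1 Lv h lam mu u u1 u2).
Local Notation Vx := (@pt_height u).
Local Notation gmx := (@pt_scale g g1 h lam u).

Lemma all_bubbles (a sg t : nat -> R) :
  (forall k, (1 <= k)%nat -> 0 < a k <= 2 /\ kap * sg k < 1 /\ 0 < t k /\ kap * t k < 1 /\
    2 / (2 + a k) * t k - 1 + Ef kap (t k) = 0 /\ a (S k) = 2 - (2 + a k) * ef kap (t k) /\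
    sg (S k) = sg k + t k * (1 - kap * sg k)) ->
  a 1%nat = 2 -> sg 1%nat = 0 ->
  forall k, (1 <= k)%nat -> exists x rho rhob,
    concentrated (a k) (sg k) x /\ window (Nat.eqb k 1) (a k) (sg k) x rho rhob.
Proof.
  intros Hseq Ha1 Hs1 k Hk. induction Hk as [|k Hk IH].
  - destruct (Hseq 1%nat ltac:(lia)) as [S1 [S2 _]].
    destruct (first_point HG HF HH HR Hmu) as [x [Hx1 Hx2]].
    destruct (window_exists HG HF HH HR Hmu true (a 1%nat) (sg 1%nat) x) as [rho [rhob HW]]; auto.
    + now rewrite Ha1, Hs1.
    + intros j. assert (jp : 0 < INR j + 1) by (generalize (pos_INR j); lra).
      destruct (Hx2 (INR j + 1) jp) as [[C [HC0 HC1]] Hcl]. rewrite Ha1. split.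
      * exists C. split; [auto|]. ev_use HC1. ev_intros n Q r Hr Hr'. apply Q. lra.
      * intros eps He. specialize (Hcl eps He). ev_use Hcl. ev_intros n Q r Hr Hr'. apply Q. lra.
    + exists x, rho, rhob. split; [now rewrite Ha1, Hs1|exact HW].
  - destruct IH as [x [rho [rhob [HC HW]]]].
    destruct (Hseq k Hk) as [S1 [S2 [S3 [S4 [S5 [S6 S7]]]]]].
    destruct (Hseq (S k) ltac:(lia)) as [R1 [R2 _]].
    destruct (next_point HG HF HH HR Hmu _ (a k) (sg k) (t k) x rho rhob S1 S2 S3 S4 S5 HC HW) as [x' HC'].
    rewrite <- S6, <- S7 in HC'.
    destruct (window_exists HG HF HH HR Hmu false (a (S k)) (sg (S k)) x' R1 R2 HC') as [rho' [rhob' HW']].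
    + intros j lo. assert (jp : 1 <= INR j + 1) by (generalize (pos_INR j); lra).
      assert (Hlo : 0 < lo <= INR j + 1).
      { unfold lo. split; [apply Rinv_0_lt_compat; lra|]. apply Rle_trans with 1; [|lra].
        rewrite <- Rinv_1. apply Rinv_le_contravar; lra. }
      split.
      * destruct (zx_bound HG HF HH HR Hmu (a (S k)) (sg (S k)) x' R2 HC' lo (INR j + 1) Hlo) as [C [HC0 HC1]].
        exists C. split; [auto|]. ev_use HC1. ev_intros n Q r Hr Hr'. apply Q. lra.
      * intros eps He. assert (Hcl := bubble_conv HG HF HH HR Hmu (a (S k)) (sg (S k)) x' R1 R2 HC' lo (INR j + 1) Hlo eps He).
        ev_use Hcl. ev_intros n Q r Hr Hr'. apply Q. lra.
    + replace (Nat.eqb (S k) 1) with false by (symmetry; apply PeanoNat.Nat.eqb_neq; lia).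
      now exists x', rho', rhob'.
Qed.

(** One unit of drop is chi(mu), asymptotically kap mu; this turns accumulated drops into the ratios
    delta_k. *)
Lemma height_ratio (w : nat -> R) (s : R) :
  is_lim_seq (fun n => (mu n - w n) / chi (mu n)) s -> is_lim_seq (fun n => w n / mu n) (1 - kap * s).
Proof.
  intros Hw. assert (Cmu := g_pos_ev HG HF mu 1 Hmu).
  apply lim_ext_ev with (fun n => 1 - chi (mu n) / mu n * ((mu n - w n) / chi (mu n))).
  - apply is_lim_seq_minus'; [apply is_lim_seq_const|]. apply is_lim_seq_mult'; [now apply (chi_over HG)|auto].
  - ev_use Cmu. ev_intros n [P1 [P2 [P3 P4]]].
    assert (0 < chi (mu n)) by (apply Rdiv_lt_0_compat; lra). specialize (Hmup n). field. split; lra.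
Qed.

Section OneBubble.
Context (first : bool) (a s : R) (x rho rhob : nat -> R) (Ha : 0 < a <= 2) (Hs : kap * s < 1).
Context (HC : concentrated a s x) (HW : window first a s x rho rhob) (Hfirst : first = true -> s = 0 /\ a = 2).

Lemma energy_lim : is_lim_seq (fun n => lam n * exp (x n) ^ 2 * h (exp (x n)) * f1 (u n (exp (x n)))) (a ^ 2 / 2).
Proof.
  assert (HC' := HC). destruct HC' as [H1 [H2 [H3 H4]]].
  assert (Cpos := g_pos_ev HG HF (Vx x) 1 (Vx_infty HG HF Hmu a s x Hs HC)).
  apply lim_ext_ev with (fun n => exp (A n (x n))).
  - replace (a ^ 2 / 2) with (exp (ln (a ^ 2 / 2))) by (apply exp_ln; nra). now apply lim_exp.
  - ev_use H1. ev_use Cpos. ev_intros n [P1 [P2 [P3 P4]]] Hx.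
    assert (0 < h (exp (x n))) by (apply (hp_pos HH), exp_neg_01; auto).
    assert (L := rs_lam (HR n)). fold (Vx x n). rewrite HF1 by lra.
    unfold Afun. fold (Vx x n). replace (2 * x n) with (x n + x n) by ring.
    rewrite !exp_plus, !exp_ln by auto. ring.
Qed.

Lemma gam_gmx : eventually (fun n => gam (lam n) h f1 (u n) (exp (x n)) = gmx x n).
Proof.
  assert (N := gmx_norm HG HF HH HR Hmu a s x Hs HC).
  assert (Cpos := g_pos_ev HG HF (Vx x) 1 (Vx_infty HG HF Hmu a s x Hs HC)).
  ev_use N. ev_use Cpos. ev_intros n [P1 [P2 [P3 P4]]] [gp N].
  unfold gam. fold (Vx x n). rewrite HF1 by lra.
  replace (lam n * h (exp (x n)) * (g1 (Vx x n) * exp (g (Vx x n)))) with (/ gmx x n * / gmx x n).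
  - rewrite sqrt_square by (left; now apply Rinv_0_lt_compat). apply Rinv_inv.
  - apply Rmult_eq_reg_r with (gmx x n ^ 2); [|apply Rgt_not_eq; now apply pow_lt].
    replace (/ gmx x n * / gmx x n * gmx x n ^ 2) with 1 by (field; lra). rewrite <- N. ring.
Qed.

Lemma rhob_height : is_lim_seq (fun n => (mu n - u n (rhob n)) / chi (mu n)) s.
Proof.
  assert (W := wi_rhob HW). destruct first.
  - rewrite (proj1 (Hfirst eq_refl)). apply is_lim_seq_ext with (fun _ => 0); [|apply is_lim_seq_const].
    intros n. rewrite W, H0. unfold Rdiv. ring.
  - apply W.
Qed.

Lemma rhob_flux : is_lim_seq (fun n => g1 (Vx x n) * - (rhob n * u1 n (rhob n))) (2 - a).
Proof.
  assert (W := wi_rhob HW). destruct first.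
  - rewrite (proj2 (Hfirst eq_refl)). apply is_lim_seq_ext with (fun _ => 0).
    + intros n. rewrite W. ring.
    + replace (2 - 2) with 0 by ring. apply is_lim_seq_const.
  - apply W.
Qed.

Lemma profile_conv (eps : R) : 0 < eps -> eventually (fun n =>
  forall r, rhob n / gmx x n <= r <= rho n / gmx x n -> 0 < r ->
    Rabs (zn g1 (u n) (exp (x n)) (gmx x n) r - zprof a r) <= eps /\
    Rabs (zn1 g1 (u n) (u1 n) (exp (x n)) (gmx x n) r - Derive (zprof a) r) <= eps /\
    Rabs (zn2 g1 (u n) (u2 n) (exp (x n)) (gmx x n) r - Derive_n (zprof a) 2 r) <= eps).
Proof.
  intros He. assert (W := wi_close HW eps He). ev_use W. ev_intros n Q r Hr Hr0. specialize (Q r Hr Hr0).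
  destruct (zprof_derive a r ltac:(lra) Hr0) as [-> ->]. rewrite zprof_liouville by (auto; lra). exact Q.
Qed.

Lemma height_expansion (r : nat -> R) : is_lim_seq (fun n => (mu n - u n (r n)) / chi (mu n)) s ->
  exists e : nat -> R, is_lim_seq e 0 /\ exists N, forall n, (N <= n)%nat ->
    u n (r n) = mu n - (s + e n) * g (mu n) / g1 (mu n).
Proof.
  intros Hr. exists (fun n => (mu n - u n (r n)) / chi (mu n) - s). split.
  - replace (Finite 0) with (Finite (s - s)) by (f_equal; ring). apply is_lim_seq_minus'; [auto|apply is_lim_seq_const].
  - assert (Cmu := g_pos_ev HG HF mu 1 Hmu). destruct Cmu as [N HN]. exists N. intros n Hn.
    destruct (HN n Hn) as [P1 [P2 [P3 P4]]]. unfold drop_scale. field. split; lra.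
Qed.

Lemma mass_lim : is_lim_seq (fun n => g1 (u n (exp (x n))) * RInt (fun r => lam n * h r * f (u n r) * r) (rhob n) (rho n)) (2 * a).
Proof.
  apply lim_ext_ev with (fun n => g1 (Vx x n) * - (rho n * u1 n (rho n)) - g1 (Vx x n) * - (rhob n * u1 n (rhob n))).
  - replace (2 * a) with (2 + a - (2 - a)) by ring.
    apply is_lim_seq_minus'; [exact (wi_flux HW)|exact rhob_flux].
  - assert (E := wi_01 HW). ev_use E. ev_intros n E.
    rewrite (flux_integral f h (lam n) (mu n) (u n) (u1 n) (u2 n)); auto; try lra. fold (Vx x n). ring.
Qed.

(* f' = g' f, and g' (u) is g' (u (r_k)) up to a factor tending to 1 uniformly on the window. *)
Lemma mass_deriv_lim : is_lim_seq (fun n => RInt (fun r => lam n * h r * f1 (u n r) * r) (rhob n) (rho n)) (2 * a).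
Proof.
  assert (ML := mass_lim). apply lim_eps. intros eps He.
  set (d := Rmin 1 (eps / (2 * (2 * a + 1)))).
  assert (Hd : 0 < d /\ d <= 1 /\ d <= eps / (2 * (2 * a + 1))).
  { unfold d. split; [apply Rmin_glb_lt; [lra|apply Rdiv_lt_0_compat; lra]|split; [apply Rmin_l|apply Rmin_r]]. }
  assert (RT := wi_ratio HW d ltac:(lra)).
  assert (E := wi_01 HW).
  assert (M1 := proj1 (lim_eps _ _) ML (Rmin 1 (eps / 2)) ltac:(apply Rmin_glb_lt; lra)).
  assert (Cpos := g_pos_ev HG HF (Vx x) 1 (Vx_infty HG HF Hmu a s x Hs HC)).
  ev_use RT. ev_use E. ev_use M1. ev_use Cpos. ev_intros n [P1 [P2 [P3 P4]]] M1 E RT.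
  fold (Vx x n) in M1.
  assert (Q1 := Rmin_l 1 (eps / 2)). assert (Q2 := Rmin_r 1 (eps / 2)).
  set (I0 := RInt (fun r => lam n * h r * f (u n r) * r) (rhob n) (rho n)) in *.
  assert (X0 : ex_RInt (fun r => lam n * h r * f (u n r) * r) (rhob n) (rho n)).
  { apply (integrand_ex f h (lam n) (mu n) (u n) (u1 n) (u2 n)); auto; lra. }
  assert (X1 : ex_RInt (fun r => lam n * h r * f1 (u n r) * r) (rhob n) (rho n)).
  { apply (integrand_ex f h (lam n) (mu n) (u n) (u1 n) (u2 n)); auto; lra. }
  assert (Xs : forall c, is_RInt (fun r => c * (lam n * h r * f (u n r) * r)) (rhob n) (rho n) (c * I0)).
  { intros c. apply (is_RInt_scal (fun r => lam n * h r * f (u n r) * r)). now apply (@RInt_correct R_CompleteNormedModule). }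
  assert (Pt : forall r, rhob n < r < rho n ->
    (1 - d) * g1 (Vx x n) * (lam n * h r * f (u n r) * r) <= lam n * h r * f1 (u n r) * r <=
    (1 + d) * g1 (Vx x n) * (lam n * h r * f (u n r) * r)).
  { intros r Hr. destruct (RT r ltac:(lra) ltac:(lra)) as [R1 R2]. apply Rabs_le_between in R2.
    rewrite HF1, (nl_eq HF) by auto.
    assert (W : 0 <= lam n * h r * exp (g (u n r)) * r).
    { apply Rmult_le_pos; [|lra]. apply Rmult_le_pos; [|left; apply exp_pos]. apply Rmult_le_pos.
      - left. apply (rs_lam (HR n)).
      - left. apply (hp_pos HH). lra. }
    replace (lam n * h r * (g1 (u n r) * exp (g (u n r))) * r) with
      (g1 (u n r) / g1 (Vx x n) * g1 (Vx x n) * (lam n * h r * exp (g (u n r)) * r)) by (field; lra).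
    split; (apply Rmult_le_compat_r; [auto|]; apply Rmult_le_compat_r; lra). }
  assert (L : (1 - d) * g1 (Vx x n) * I0 <= RInt (fun r => lam n * h r * f1 (u n r) * r) (rhob n) (rho n)).
  { rewrite <- (is_RInt_unique _ _ _ _ (Xs ((1 - d) * g1 (Vx x n)))).
    apply RInt_le; [lra|eexists; apply Xs|auto|]. intros r Hr. apply Pt. auto. }
  assert (U : RInt (fun r => lam n * h r * f1 (u n r) * r) (rhob n) (rho n) <= (1 + d) * g1 (Vx x n) * I0).
  { rewrite <- (is_RInt_unique _ _ _ _ (Xs ((1 + d) * g1 (Vx x n)))).
    apply RInt_le; [lra|auto|eexists; apply Xs|]. intros r Hr. apply Pt. auto. }
  set (G := g1 (Vx x n) * I0) in *. apply Rabs_le_between in M1.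
  rewrite Rmult_assoc in L, U. fold G in L, U.
  assert (d * G <= eps / 2).
  { apply Rle_trans with (d * (2 * a + 1)); [apply Rmult_le_compat_l; lra|].
    apply Rle_trans with (eps / (2 * (2 * a + 1)) * (2 * a + 1)); [apply Rmult_le_compat_r; lra|right; field; lra]. }
  apply Rabs_le_between. lra.
Qed.

End OneBubble.

(** The mass is a difference of fluxes, each known at its own bubble. In units of 1/g'(mu) they tend
    to (2 - a') / ef(s') and (2 + a) / ef(s), which agree because ef(s') = ef(s) ef(t) and 2 - a' =
    (2 + a) ef(t). *)
Lemma neck_mass_lim (fi fi' : bool) (a s t a' s' : R) (x rho rhob x' rho' rhob' : nat -> R) :
  kap * s < 1 -> kap * t < 1 -> s' = s + t * (1 - kap * s) -> a' = 2 - (2 + a) * ef kap t ->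
  concentrated a s x -> window fi a s x rho rhob ->
  concentrated a' s' x' -> window fi' a' s' x' rho' rhob' -> (fi' = true -> s' = 0 /\ a' = 2) ->
  is_lim_seq (fun n => g1 (mu n) * RInt (fun r => lam n * h r * f (u n r) * r) (rho n) (rhob' n)) 0.
Proof.
  intros Hs Ht Es Ea HC HW HC' HW' Hfi.
  assert (Hs' : kap * s' < 1).
  { rewrite Es. assert (0 < (1 - kap * s) * (1 - kap * t)) by (apply Rmult_lt_0_compat; lra). lra. }
  assert (e1 := ef_pos kap s Hs). assert (e2 := ef_pos kap t Ht). assert (e3 := ef_pos kap s' Hs').
  destruct (drop_ratio HG HF mu (Vx x) s Hmu Hs (proj2 (proj2 (proj2 HC)))) as [V1 [_ [_ D1]]].
  destruct (drop_ratio HG HF mu (Vx x') s' Hmu Hs' (proj2 (proj2 (proj2 HC')))) as [V2 [_ [_ D2]]].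
  assert (C1 := g_pos_ev HG HF _ 1 V1). assert (C2 := g_pos_ev HG HF _ 1 V2). assert (Cmu := g_pos_ev HG HF mu 1 Hmu).
  assert (F1 := wi_flux HW). assert (F2 := rhob_flux _ _ _ _ _ _ HW' Hfi).
  apply lim_ext_ev with (fun n => g1 (Vx x' n) * - (rhob' n * u1 n (rhob' n)) / (g1 (Vx x' n) / g1 (mu n)) -
     g1 (Vx x n) * - (rho n * u1 n (rho n)) / (g1 (Vx x n) / g1 (mu n))).
  - replace (Finite 0) with (Finite ((2 - a') / ef kap s' - (2 + a) / ef kap s)).
    + apply is_lim_seq_minus'; apply is_lim_seq_div'; auto; lra.
    + f_equal. rewrite Ea, Es, ef_comp by auto. field. split; lra.
  - assert (E := wi_01 HW). assert (E' := wi_01 HW').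
    ev_use E. ev_use E'. ev_use C1. ev_use C2. ev_use Cmu. ev_intros n [_ [_ [_ P1]]] [_ [_ [_ P2]]] [_ [_ [_ P3]]] E' E.
    rewrite (flux_integral f h (lam n) (mu n) (u n) (u1 n) (u2 n)); auto; try lra. field. repeat split; lra.
Qed.

End Conclusions.

(** The quotients chi(t)/t and t g'/g are reciprocal, and their limits are [kap] and p; it is enough
    to test along the integers. *)
Lemma kap_conjugate (g g1 g2 : R -> R) (t0 q kap : R) (p : Rbar) :
  growth g g1 g2 t0 q kap -> is_lim (fun t => t * g1 t / g t) p_infty p ->
  (exists pr, p = Finite pr) -> kap * real p = 1.
Proof.
  intros HG Hp [pr ->]. simpl.
  assert (HI : is_lim_seq INR p_infty) by apply is_lim_seq_INR.
  assert (L1 := chi_over HG INR HI).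
  assert (L2 : is_lim_seq (fun n => INR n * g1 (INR n) / g (INR n)) pr).
  { apply (is_lim_comp_seq (fun t => t * g1 t / g t) INR p_infty pr); [auto| |auto].
    exists 0%nat. intros n _. discriminate. }
  assert (L3 := is_lim_seq_mult' _ _ _ _ L1 L2).
  assert (L4 : is_lim_seq (fun n => drop_scale g g1 (INR n) / INR n * (INR n * g1 (INR n) / g (INR n))) 1).
  { apply lim_ext_ev with (fun _ => 1); [apply is_lim_seq_const|].
    assert (E1 := proj1 (lim_inf _) (lim_g HG _ HI) 0).
    assert (E2 := proj1 (lim_inf _) HI (Rmax 0 t0)).
    ev_use E1. ev_use E2. ev_intros n E2 E1.
    generalize (Rmax_l 0 t0) (Rmax_r 0 t0). intros.
    assert (P := gr_g1pos HG (INR n) ltac:(lra)). unfold drop_scale. field. repeat split; lra. }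
  apply is_lim_seq_unique in L3. apply is_lim_seq_unique in L4. rewrite L3 in L4. now injection L4.
Qed.

Theorem theorem1p2
  (h h1 f f1 f2 g1 g2 : R -> R) (t0 q : R) (p : Rbar)
  (a delta eta : nat -> R)
  (lam mu : nat -> R) (u u1 u2 : nat -> R -> R)
  (Hh : C1_with I01 h h1) (Hhpos : forall r, I01 r -> 0 < h r)
  (Hf : C1_with (Rle 0) f f1) (Hfnn : forall t, 0 <= t -> 0 <= f t)
  (Ht0 : 0 <= t0) (Hfpos : forall t, t0 <= t -> 0 < f t)
  (Hf2 : C2_with (Rle t0) f f1 f2)
  (Hg1 : forall t, t0 <= t -> is_deriv_within (Rle t0) (fun s => ln (f s)) t (g1 t))
  (Hg2 : forall t, t0 <= t -> is_deriv_within (Rle t0) g1 t (g2 t))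
  (HH1 : H1 t0 f (fun s => ln (f s)) g1 g2 q p)
  (Hq : 1 <= q < 2)
  (Hseq : seq_spec q (real p) a delta eta)
  (Hlam : forall n, 0 < lam n) (Hmu : forall n, 0 < mu n)
  (Hu : forall n, C2_with I01 (u n) (u1 n) (u2 n))
  (Hode : forall n r, 0 < r < 1 ->
            - u2 n r - u1 n r / r = lam n * h r * f (u n r))
  (Hupos : forall n r, 0 < r < 1 -> 0 < u n r)
  (Hu0 : forall n, u n 0 = mu n) (Hu10 : forall n, u1 n 0 = 0)
  (Hu1 : forall n, u n 1 = 0)
  (Hmuinf : is_lim_seq mu p_infty) :
  exists phi : nat -> nat, (forall n, (phi n < phi (S n))%nat) /\
  exists rk rho rhob : nat -> nat -> R,
    (forall n, rhob 1%nat n = 0) /\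
    forall k, (1 <= k)%nat ->
      (forall n, 0 < rk k n < 1) /\
      (forall n, 0 <= rho k n < 1 /\ 0 <= rhob k n < 1) /\
      is_lim_seq (fun n => u (phi n) (rk k n) / mu (phi n)) (delta k) /\
      is_lim_seq (fun n => lam (phi n) * rk k n ^ 2 * h (rk k n)
                           * f1 (u (phi n) (rk k n))) (a k ^ 2 / 2) /\
      is_lim_seq (fun n => gam (lam (phi n)) h f1 (u (phi n)) (rk k n)) 0 /\
      is_lim_seq (rho k) 0 /\
      is_lim_seq (fun n => rhob k n / gam (lam (phi n)) h f1 (u (phi n)) (rk k n)) 0 /\
      is_lim_seq (fun n => rho k n / gam (lam (phi n)) h f1 (u (phi n)) (rk k n)) p_infty /\
      is_lim_seq (fun n => u (phi n) (rhob k n) / mu (phi n)) (delta k) /\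
      is_lim_seq (fun n => u (phi n) (rho k n) / mu (phi n)) (delta k) /\
      (forall eps, 0 < eps -> exists N, forall n, (N <= n)%nat ->
         let gm := gam (lam (phi n)) h f1 (u (phi n)) (rk k n) in
         forall s, rhob k n / gm <= s <= rho k n / gm -> 0 < s ->
           Rabs (zn g1 (u (phi n)) (rk k n) gm s - zprof (a k) s) <= eps /\
           Rabs (zn1 g1 (u (phi n)) (u1 (phi n)) (rk k n) gm s
                 - Derive (zprof (a k)) s) <= eps /\
           Rabs (zn2 g1 (u (phi n)) (u2 (phi n)) (rk k n) gm s
                 - Derive_n (zprof (a k)) 2 s) <= eps) /\
      (q = 1 ->
         forall rr : nat -> R, (rr = rk k \/ rr = rho k \/ rr = rhob k) ->
           exists e : nat -> R, is_lim_seq e 0 /\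
             exists N, forall n, (N <= n)%nat ->
               u (phi n) (rr n) = mu (phi n)
                 - (ln (/ eta k) + e n) * ln (f (mu (phi n))) / g1 (mu (phi n))) /\
      is_lim_seq (fun n => g1 (u (phi n) (rk k n))
          * RInt (fun r => lam (phi n) * h r * f (u (phi n) r) * r)
                 (rhob k n) (rho k n)) (2 * a k) /\
      is_lim_seq (fun n =>
          RInt (fun r => lam (phi n) * h r * f1 (u (phi n) r) * r)
               (rhob k n) (rho k n)) (2 * a k) /\
      is_lim_seq (fun n => g1 (mu (phi n))
          * RInt (fun r => lam (phi n) * h r * f (u (phi n) r) * r)
                 (rho k n) (rhob (S k) n)) 0.
Proof.
  destruct HH1 as [Hgp [Hqp [Hglim [Hplim _]]]].
  set (g := fun s => ln (f s)) in *. set (kap := 1 - / q).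
  assert (HG : growth g g1 g2 t0 q kap).
  { split; auto; try lra.
    - intros t Ht. apply (deriv_within_Rle g t0); [auto|apply Hg1; lra].
    - intros t Ht. apply (deriv_within_Rle g1 t0); [auto|apply Hg2; lra].
    - intros t Ht. apply Hgp; lra.
    - intros t Ht. apply Hgp; lra. }
  destruct (nonlin_of_C1 f f1 g1 g2 t0 q kap Ht0 Hf Hfnn Hfpos HG) as [Lv HF]. fold g in HF.
  destruct (hprop_of_C1 h h1 Hh Hhpos) as [K HH].
  assert (HR : forall n, rsol f h (lam n) (mu n) (u n) (u1 n) (u2 n)).
  { intros n. apply rsol_of_C2; auto. }
  assert (HP : 1 < q -> kap * real p = 1).
  { intros Hq1. apply (kap_conjugate g g1 g2 t0 q kap p HG Hplim).
    destruct Hqp as [[E _]|[_ [pr [E _]]]]; [lra|now exists pr]. }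
  assert (Hfd : forall t, 0 < t -> is_derive f t (f1 t)).
  { intros t Ht. apply (deriv_within_Rle f 0); [auto|]. apply Hf. lra. }
  (* f' = g' f, by uniqueness of the derivative of log f. *)
  assert (HF1 : forall y, Lv <= y -> f1 y = g1 y * exp (g y)).
  { intros y Hy. assert (L := nl_lev HF). assert (P := Hfpos y ltac:(lra)).
    unfold g. rewrite exp_ln by auto.
    assert (D1 : is_derive g y (/ f y * f1 y)).
    { unfold g. evar_last.
      - apply (is_derive_comp ln f); [apply is_derive_Reals, derivable_pt_lim_ln; auto|apply Hfd; lra].
      - unfold scal; simpl; unfold mult; simpl. ring. }
    assert (D2 := gr_g HG y ltac:(lra)).
    apply is_derive_unique in D1. apply is_derive_unique in D2. rewrite D1 in D2. rewrite <- D2. field. lra. }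
  assert (Hfc : forall y, 0 < y -> continuity_pt f y) by (intros y Hy; eapply deriv_cont, Hfd, Hy).
  assert (Hf1c : forall y, 0 < y -> continuity_pt f1 y).
  { intros y Hy eps He. destruct Hf as [_ Hc]. destruct (Hc y ltac:(lra) eps He) as [d [Hd H]].
    exists (Rmin d y). split; [apply Rmin_glb_lt; lra|]. intros z [_ Hz]. simpl in Hz |- *. unfold R_dist in *.
    generalize (Rmin_l d y) (Rmin_r d y). intros. assert (Hz' := Rabs_def2 _ _ Hz). apply H; lra. }
  assert (Hch : forall x, 0 <= x <= 1 -> cont_within I01 h x).
  { intros x Hx. eapply deriv_within_cont. apply Hh. exact Hx. }
  assert (Hcu : forall n x, 0 <= x <= 1 -> cont_within I01 (u n) x).
  { intros n x Hx. eapply deriv_within_cont. apply (Hu n). exact Hx. }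
  assert (Hcu1 : forall n x, 0 <= x <= 1 -> cont_within I01 (u1 n) x).
  { intros n x Hx. eapply deriv_within_cont. apply (Hu n). exact Hx. }
  destruct (seq_facts q (real p) kap a delta eta Hq eq_refl HP Hseq) as [sg [t Hst]].
  assert (Hfst : forall k, (1 <= k)%nat -> Nat.eqb k 1 = true -> sg k = 0 /\ a k = 2).
  { intros k Hk E. apply PeanoNat.Nat.eqb_eq in E. apply (Hst k Hk). exact E. }
  assert (Bub : forall k, exists T : (nat -> R) * (nat -> R) * (nat -> R), (1 <= k)%nat ->
    @concentrated g g1 h lam mu u u1 (a k) (sg k) (fst (fst T)) /\
    @window g g1 Lv h lam mu u u1 u2 (Nat.eqb k 1) (a k) (sg k) (fst (fst T)) (snd (fst T)) (snd T)).
  { intros k. destruct (Compare_dec.le_dec 1 k) as [Hk|Hk].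
    - destruct (all_bubbles HG HF HH HR Hmuinf a sg t) with (k := k) as [x [rho [rhob [B1 B2]]]]; auto.
      + intros j Hj. destruct (Hst j Hj) as [S1 [S2 [S3 [S4 [S5 [S6 [S7 _]]]]]]]. auto 10.
      + apply Hseq.
      + apply (Hst 1%nat); auto.
      + exists (x, rho, rhob). intros _. simpl. auto.
    - exists (fun _ => 0, fun _ => 0, fun _ => 0). intros; lia. }
  destruct (choice _ Bub) as [T HT]. clear Bub.
  set (X := fun k => fst (fst (T k))) in *. set (RHO := fun k => snd (fst (T k))) in *.
  set (RHOB := fun k => snd (T k)) in *.
  (* The radii are controlled for large [n] only, whereas the theorem places them in the unit
     interval for all [n]. The defaults 1/2 and 0 replace them elsewhere; 0 also keeps the inner
     radius of the first bubble equal to 0 for every [n]. *)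
  set (good := fun k n => 0 < exp (X k n) < 1 /\ 0 <= RHO k n < 1 /\ 0 <= RHOB k n < 1).
  set (pick := fun k n (y d : R) => if excluded_middle_informative (good k n) then y else d).
  set (rk := fun k n => pick k n (exp (X k n)) (1 / 2)).
  set (rho := fun k n => pick k n (RHO k n) 0).
  set (rhob := fun k n => pick k n (RHOB k n) 0).
  assert (EQ : forall k, (1 <= k)%nat -> eventually (fun n =>
    rk k n = exp (X k n) /\ rho k n = RHO k n /\ rhob k n = RHOB k n)).
  { intros k Hk. destruct (HT k Hk) as [B1 B2]. assert (E1 := proj1 B1). assert (E2 := wi_01 B2).
    ev_use E1. ev_use E2. ev_intros n E2 E1. unfold rk, rho, rhob, pick.
    destruct (excluded_middle_informative (good k n)) as [_|Hng]; [auto|]. exfalso. apply Hng.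
    unfold good. split; [apply exp_neg_01; exact E1|]. 
    change (0 < RHO k n < 1 /\ 0 <= RHOB k n <= RHO k n) in E2. lra. }
  assert (GM : forall k, (1 <= k)%nat -> eventually (fun n =>
    gam (lam n) h f1 (u n) (rk k n) = @pt_scale g g1 h lam u (X k) n)).
  { intros k Hk. destruct (HT k Hk) as [B1 B2]. destruct (Hst k Hk) as [S1 [S2 _]].
    assert (E1 := EQ k Hk).
    assert (E2 := gam_gmx HG HF HF1 HH HR Hmuinf (a k) (sg k) (X k) S2 B1).
    ev_use E1. ev_use E2. ev_intros n E2 [-> _]. exact E2. }
  exists (fun n => n). split; [intros; lia|]. exists rk, rho, rhob. split.
  { intros n. unfold rhob, pick. destruct (excluded_middle_informative _); [|reflexivity].
    destruct (HT 1%nat ltac:(lia)) as [_ B2]. exact (wi_rhob B2 n). }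
  intros k Hk. assert (HTk := HT k Hk). destruct HTk as [B1 B2].
  change (@concentrated g g1 h lam mu u u1 (a k) (sg k) (X k)) in B1.
  change (@window g g1 Lv h lam mu u u1 u2 (Nat.eqb k 1) (a k) (sg k) (X k) (RHO k) (RHOB k)) in B2.
  destruct (Hst k Hk) as [S1 [S2 [S3 [S4 [S5 [S6 [S7 [S8 [S9 S10]]]]]]]]].
  assert (Ek := EQ k Hk). assert (Gk := GM k Hk).
  assert (Hd := B1). destruct Hd as [_ [_ [_ Hx]]].
  assert (Hrho := wi_rho B2).
  assert (Hrhob := rhob_height Hu0 _ _ _ _ _ _ B2 (Hfst k Hk)).
  assert (Ux : is_lim_seq (fun n => (mu n - u n (rk k n)) / drop_scale g g1 (mu n)) (sg k)).
  { apply lim_ext_ev with (1 := Hx). ev_keep Ek. ev_intros n [-> _]. reflexivity. }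
  assert (Urho : is_lim_seq (fun n => (mu n - u n (rho k n)) / drop_scale g g1 (mu n)) (sg k)).
  { apply lim_ext_ev with (1 := Hrho). ev_keep Ek. ev_intros n [_ [-> _]]. reflexivity. }
  assert (Urhob : is_lim_seq (fun n => (mu n - u n (rhob k n)) / drop_scale g g1 (mu n)) (sg k)).
  { apply lim_ext_ev with (1 := Hrhob). ev_keep Ek. ev_intros n [_ [_ ->]]. reflexivity. }
  split.
  { intros n. unfold rk, pick. destruct (excluded_middle_informative _) as [G|_]; [apply G|lra]. }
  split.
  { intros n. unfold rho, rhob, pick. destruct (excluded_middle_informative _) as [G|_]; [split; apply G|lra]. }
  rewrite S8.
  split; [exact (height_ratio HG HF Hmuinf Hmu _ _ Ux)|].
  split.
  { apply lim_ext_ev with (1 := energy_lim HG HF HF1 HH HR Hmuinf (a k) (sg k) (X k) S1 S2 B1).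
    ev_keep Ek. ev_intros n [-> _]. reflexivity. }
  split.
  { apply lim_ext_ev with (1 := gmx_0 HG HF HH HR Hmuinf (a k) (sg k) (X k) S2 B1).
    ev_keep Gk. ev_intros n ->. reflexivity. }
  split.
  { apply lim_ext_ev with (1 := wi_0 B2). ev_keep Ek. ev_intros n [_ [-> _]]. reflexivity. }
  split.
  { apply lim_ext_ev with (1 := wi_b B2). ev_keep Ek. ev_keep Gk. ev_intros n -> [_ [_ ->]]. reflexivity. }
  split.
  { apply lim_ext_ev with (1 := wi_inf B2). ev_keep Ek. ev_keep Gk. ev_intros n -> [_ [-> _]]. reflexivity. }
  split; [exact (height_ratio HG HF Hmuinf Hmu _ _ Urhob)|].
  split; [exact (height_ratio HG HF Hmuinf Hmu _ _ Urho)|].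
  split.
  { intros eps He. assert (PC := profile_conv _ (a k) (sg k) (X k) (RHO k) (RHOB k) S1 B2 eps He).
    change (eventually (fun n => let gm := gam (lam n) h f1 (u n) (rk k n) in
         forall s, rhob k n / gm <= s <= rho k n / gm -> 0 < s ->
           Rabs (zn g1 (u n) (rk k n) gm s - zprof (a k) s) <= eps /\
           Rabs (zn1 g1 (u n) (u1 n) (rk k n) gm s - Derive (zprof (a k)) s) <= eps /\
           Rabs (zn2 g1 (u n) (u2 n) (rk k n) gm s - Derive_n (zprof (a k)) 2 s) <= eps)).
    ev_use PC. ev_keep Ek. ev_keep Gk. ev_intros n Gn [E1 [E2 E3]] PC.
    cbv zeta. rewrite Gn, E1, E2, E3. exact PC. }
  split.
  { intros Hq1 rr Hrr. rewrite <- (S9 Hq1).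
    apply (height_expansion HG HF Hmuinf (sg k) rr).
    destruct Hrr as [-> | [-> | ->]]; auto. }
  split.
  { apply lim_ext_ev with (1 := mass_lim Hfc HR Hmu Hch Hcu Hcu1 Hu0 Hu10 _ (a k) (sg k) (X k) (RHO k) (RHOB k) B2 (Hfst k Hk)).
    ev_keep Ek. ev_intros n [-> [-> ->]]. reflexivity. }
  split.
  { apply lim_ext_ev with (1 := mass_deriv_lim HG HF HF1 Hfc Hf1c HH HR Hmuinf Hmu Hch Hcu Hcu1 Hu0 Hu10 _ (a k) (sg k) (X k) (RHO k) (RHOB k) S1 S2 B1 B2 (Hfst k Hk)).
    ev_keep Ek. ev_intros n [_ [-> ->]]. reflexivity. }
  assert (Hk' : (1 <= S k)%nat) by lia. destruct (HT (S k) Hk') as [B1' B2'].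
  change (@concentrated g g1 h lam mu u u1 (a (S k)) (sg (S k)) (X (S k))) in B1'.
  change (@window g g1 Lv h lam mu u u1 u2 (Nat.eqb (S k) 1) (a (S k)) (sg (S k)) (X (S k)) (RHO (S k)) (RHOB (S k))) in B2'.
  assert (Ek' := EQ (S k) Hk').
  apply lim_ext_ev with (1 := neck_mass_lim HG HF Hfc HR Hmuinf Hmu Hch Hcu Hcu1 Hu0 Hu10 _ _ (a k) (sg k) (t k) _ _
     _ _ _ _ _ _ S2 S4 S7 S6 B1 B2 B1' B2' (Hfst (S k) Hk')).
  ev_keep Ek. ev_keep Ek'. ev_intros n [_ [_ ->]] [_ [-> _]]. reflexivity.
Qed.
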